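(* Let $K$ be an algebraically closed field and let $A$ be one of the algebras $\Lambda_4'$, $\Lambda_5'$, $\Lambda_6'$, $\Lambda_7'$, $\Lambda_8'$. Then: (i) $\dim_K HH^0(A)=5$. (ii) $\dim_K HH^1(A)=2$ if $\mathrm{char}(K)\neq 2$, and $\dim_K HH^1(A)=3$ if $\mathrm{char}(K)=2$. (iii) $\dim_K HH^2(A)=2$ if $\mathrm{char}(K)\neq 2$, and $\dim_K HH^2(A)=3$ if $\mathrm{char}(K)=2$.
   Context: For a finite-dimensional $K$-algebra $A$, $HH^n(A)=\mathrm{Ext}^n_{A^e}(A,A)$ with $A^e=A^{\mathrm{op}}\otimes_K A$ is the $n$-th Hochschild cohomology space. Paths are composed from left to right ($\alpha\beta$ means first $\alpha$, then $\beta$). The following are bound quiver algebras over $K$ with vertices $1,2,3$. $\Lambda_4'$: arrows $\alpha:1\to3$, $\gamma:3\to2$, $\delta:1\to2$, $\beta:2\to1$; relations $\delta\beta\delta=\alpha\gamma$, $(\beta\delta)^3\beta=0$, $\gamma\beta\alpha=0$. $\Lambda_5'$: arrows $\alpha:2\to2$, $\beta:1\to2$, $\gamma:2\to1$, $\delta:2\to3$, $\sigma:3\to2$; relations $\alpha^2=\gamma\beta$, $\alpha^3=\delta\sigma$, $\beta\delta=0$, $\sigma\gamma=0$, $\alpha\delta=0$, $\sigma\alpha=0$, $\beta\gamma=0$. $\Lambda_6'$: arrows $\alpha:1\to2$, $\beta:2\to1$, $\delta:2\to3$, $\gamma:3\to2$; relations $\alpha\delta\gamma\delta=0$, $\gamma\delta\gamma\beta=0$,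 $\alpha\beta=0$, $\beta\alpha=\delta\gamma\delta\gamma$. $\Lambda_7'$: arrows $\alpha:1\to1$, $\sigma:1\to3$, $\gamma:3\to2$, $\delta:1\to2$, $\beta:2\to1$; relations $\beta\delta=0$, $\alpha\sigma=0$, $\alpha\delta=\sigma\gamma$, $\gamma\beta\alpha=0$, $\alpha^2=\delta\beta$. $\Lambda_8'$: arrows $\alpha:1\to1$, $\sigma:3\to1$, $\gamma:2\to3$, $\delta:2\to1$, $\beta:1\to2$; relations $\delta\beta=0$, $\sigma\alpha=0$, $\delta\alpha=\gamma\sigma$, $\alpha\beta\gamma=0$, $\alpha^2=\beta\delta$. *)

(* Defs.v *)
From HB Require Import structures.
From mathcomp Require Import all_boot all_order all_algebra.
From mathcomp Require Import finmap monalg.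
From mathcomp Require Import boolp functions.

Set Implicit Arguments.
Unset Strict Implicit.
Unset Printing Implicit Defensive.

Import GRing.Theory.
Local Open Scope ring_scope.
Local Open Scope quotient_scope.

Record submodule (R : pzRingType) (V : lmodType R) := Submodule {
  submodule_pred :> {pred V};
  submodule_closed : submod_closed submodule_pred }.

HB.instance Definition _ (R : pzRingType) (V : lmodType R) (W : submodule V) :=
  GRing.isSubmodClosed.Build R V (submodule_pred W)
    (GRing.submod_closed_semi (submodule_closed W)).

Section QuotientModule.
Context (R : pzRingType) (V : lmodType R) (W : submodule V).

Definition quotmod : Type := Quotient.quot (submodule_pred W).
HB.instance Definition _ := GRing.Zmodule.on quotmod.
HB.instance Definition _ := EqQuotient.on quotmod.

Definition quotmod_pi (x : V) : quotmod := \pi_quotmod x.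

Lemma quotmod_eq x y : (quotmod_pi x = quotmod_pi y) <-> (x - y \in W).
Proof. by rewrite [_ \in _]Quotient.idealrBE; split=> [/eqP|/eqP]. Qed.

Definition quotmod_repr (q : quotmod) : V := repr q.

Lemma quotmod_piK (q : quotmod) : quotmod_pi (quotmod_repr q) = q.
Proof. exact: reprK. Qed.

Lemma quotmod_pi_zmod : zmod_morphism quotmod_pi.
Proof. exact: (@raddfB _ _ (\pi_(Quotient.quot (submodule_pred W)))). Qed.

HB.instance Definition _ :=
  GRing.isZmodMorphism.Build V quotmod quotmod_pi quotmod_pi_zmod.

Definition quotmod_scale (k : R) (q : quotmod) : quotmod :=
  quotmod_pi (k *: quotmod_repr q).

Lemma quotmod_scaleE k x : quotmod_scale k (quotmod_pi x) = quotmod_pi (k *: x).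
Proof.
apply/quotmod_eq; rewrite -scalerBr rpredZ //.
by apply/quotmod_eq; rewrite quotmod_piK.
Qed.

Fact quotmod_scaleA a b v :
  quotmod_scale a (quotmod_scale b v) = quotmod_scale (a * b) v.
Proof. by rewrite -(quotmod_piK v) !quotmod_scaleE scalerA. Qed.
Fact quotmod_scale1 : left_id 1 quotmod_scale.
Proof. by move=> v; rewrite -(quotmod_piK v) quotmod_scaleE scale1r. Qed.
Fact quotmod_scaleDr : right_distributive quotmod_scale +%R.
Proof.
move=> a u v; rewrite -(quotmod_piK u) -(quotmod_piK v).
by rewrite -raddfD !quotmod_scaleE -raddfD scalerDr.
Qed.
Fact quotmod_scaleDl v : {morph quotmod_scale^~ v : a b / a + b}.
Proof.
by move=> a b; rewrite -(quotmod_piK v) !quotmod_scaleE -raddfD scalerDl.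
Qed.

HB.instance Definition _ := GRing.Zmodule_isLmodule.Build R quotmod
  quotmod_scaleA quotmod_scale1 quotmod_scaleDr quotmod_scaleDl.

Lemma quotmod_pi_scalable : scalable quotmod_pi.
Proof. by move=> k x; rewrite -quotmod_scaleE. Qed.

HB.instance Definition _ :=
  GRing.isScalable.Build R V quotmod *:%R quotmod_pi quotmod_pi_scalable.

End QuotientModule.

Definition two_sided_ideal (R : pzRingType) (I : {pred R}) : Prop :=
  [/\ 0 \in I, {in I &, forall x y, x - y \in I},
      forall a, {in I, forall x, a * x \in I}
    & forall a, {in I, forall x, x * a \in I}].

Definition gen_ideal (R : pzRingType) (S : R -> Prop) : {pred R} :=
  fun x => `[< forall I : {pred R},
                 two_sided_ideal I -> (forall r, S r -> r \in I) -> x \in I >].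

Lemma gen_idealP (R : pzRingType) (S : R -> Prop) x :
  reflect (forall I : {pred R},
             two_sided_ideal I -> (forall r, S r -> r \in I) -> x \in I)
          (x \in gen_ideal S).
Proof. exact: asboolP. Qed.

Lemma gen_ideal_ideal (R : pzRingType) (S : R -> Prop) :
  two_sided_ideal (gen_ideal S).
Proof.
split=> [|x y /gen_idealP Ix /gen_idealP Iy|a x /gen_idealP Ix
         |a x /gen_idealP Ix]; apply/gen_idealP=> I II SI;
  have [I0 IB IMl IMr] := II.
- by [].
- exact: IB (Ix _ II SI) (Iy _ II SI).
- exact/IMl/(Ix _ II SI).
- exact/IMr/(Ix _ II SI).
Qed.

Lemma mem_gen_ideal (R : pzRingType) (S : R -> Prop) x :
  S x -> x \in gen_ideal S.
Proof. by move=> Sx; apply/gen_idealP=> I _; apply. Qed.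

(* algType requires 1 != 0, whence properness. *)
Record proper_ideal2 (K : fieldType) (A : algType K) := ProperIdeal2 {
  ideal2_pred :> {pred A};
  ideal2_ideal : two_sided_ideal ideal2_pred;
  ideal2_proper : 1 \notin ideal2_pred }.

Section QuotientAlgebra.
Context (K : fieldType) (A : algType K) (I : proper_ideal2 A).

Fact ideal2_submod_closed : submod_closed I.
Proof.
have [I0 IB IMl _] := ideal2_ideal I; split=> // a x y Ix Iy.
have IN z : z \in I -> - z \in I by rewrite -sub0r; exact: IB.
by rewrite -[y]opprK IB ?IN // -mulr_algl IMl.
Qed.

Definition ideal2_submodule := Submodule ideal2_submod_closed.

Definition quotalg : Type := quotmod ideal2_submodule.
HB.instance Definition _ := GRing.Lmodule.on quotalg.

Definition quotalg_pi (x : A) : quotalg := quotmod_pi ideal2_submodule x.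

Lemma quotalg_eq x y : (quotalg_pi x = quotalg_pi y) <-> (x - y \in I).
Proof. exact: quotmod_eq. Qed.

Definition quotalg_repr (q : quotalg) : A :=
  quotmod_repr (q : quotmod ideal2_submodule).

Lemma quotalg_piK q : quotalg_pi (quotalg_repr q) = q.
Proof. exact: quotmod_piK. Qed.

Lemma quotalg_pi_linear : linear quotalg_pi.
Proof. exact: (linearP (quotmod_pi ideal2_submodule)). Qed.

HB.instance Definition _ :=
  GRing.isLinear.Build K A quotalg *:%R quotalg_pi quotalg_pi_linear.

Definition quotalg_one : quotalg := quotalg_pi 1.
Definition quotalg_mul (p q : quotalg) : quotalg :=
  quotalg_pi (quotalg_repr p * quotalg_repr q).

Lemma quotalg_mulE x y :
  quotalg_mul (quotalg_pi x) (quotalg_pi y) = quotalg_pi (x * y).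
Proof.
have [I0 IB IMl IMr] := ideal2_ideal I.
have E z : quotalg_repr (quotalg_pi z) - z \in I.
  by apply/quotalg_eq; rewrite quotalg_piK.
apply/quotalg_eq; set x' := quotalg_repr _; set y' := quotalg_repr _.
have -> : x' * y' - x * y = x' * (y' - y) + (x' - x) * y.
  by rewrite mulrBr mulrBl addrA subrK.
apply: (@rpredD _ (submodule_pred ideal2_submodule)); first exact/IMl/E.
exact/IMr/E.
Qed.

Fact quotalg_mulA : associative quotalg_mul.
Proof.
move=> x y z; rewrite -(quotalg_piK x) -(quotalg_piK y) -(quotalg_piK z).
by rewrite !quotalg_mulE mulrA.
Qed.
Fact quotalg_mul1q : left_id quotalg_one quotalg_mul.
Proof. by move=> x; rewrite -(quotalg_piK x) quotalg_mulE mul1r. Qed.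
Fact quotalg_mulq1 : right_id quotalg_one quotalg_mul.
Proof. by move=> x; rewrite -(quotalg_piK x) quotalg_mulE mulr1. Qed.
Fact quotalg_mulDl : left_distributive quotalg_mul +%R.
Proof.
move=> x y z; rewrite -(quotalg_piK x) -(quotalg_piK y) -(quotalg_piK z).
by rewrite -raddfD !quotalg_mulE -raddfD mulrDl.
Qed.
Fact quotalg_mulDr : right_distributive quotalg_mul +%R.
Proof.
move=> x y z; rewrite -(quotalg_piK x) -(quotalg_piK y) -(quotalg_piK z).
by rewrite -raddfD !quotalg_mulE -raddfD mulrDr.
Qed.
Fact quotalg_oner_neq0 : quotalg_one != 0.
Proof.
apply/eqP; rewrite -[RHS](raddf0 quotalg_pi) => /quotalg_eq.
by rewrite subr0 (negPf (ideal2_proper I)).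
Qed.

HB.instance Definition _ := GRing.Zmodule_isNzRing.Build quotalg
  quotalg_mulA quotalg_mul1q quotalg_mulq1 quotalg_mulDl quotalg_mulDr
  quotalg_oner_neq0.

Lemma quotalg_pi_monoid : monoid_morphism quotalg_pi.
Proof. by split=> // x y; symmetry; exact: quotalg_mulE. Qed.

HB.instance Definition _ :=
  GRing.isMonoidMorphism.Build A quotalg quotalg_pi quotalg_pi_monoid.

Fact quotalg_scaleAl (k : K) (x y : quotalg) : k *: (x * y) = k *: x * y.
Proof.
rewrite -(quotalg_piK x) -(quotalg_piK y).
by rewrite -rmorphM -!linearZ -rmorphM /= scalerAl.
Qed.
Fact quotalg_scaleAr (k : K) (x y : quotalg) : k *: (x * y) = x * (k *: y).
Proof.
rewrite -(quotalg_piK x) -(quotalg_piK y).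
by rewrite -rmorphM -!linearZ -rmorphM /= scalerAr.
Qed.

HB.instance Definition _ :=
  GRing.Lmodule_isLalgebra.Build K quotalg quotalg_scaleAl.
HB.instance Definition _ :=
  GRing.Lalgebra_isAlgebra.Build K quotalg quotalg_scaleAr.

End QuotientAlgebra.

Section LinearExtension.
Context (R : nzRingType) (X : choiceType) (V : lmodType R).
Implicit Types (h : X -> V) (f g : {malg R[X]}).

Definition lext h f : V := \sum_(x <- msupp f) f@_x *: h x.

Lemma lextEw (d : {fset X}) h f : (msupp f `<=` d)%fset ->
  lext h f = \sum_(x <- d) f@_x *: h x.
Proof.
move=> le_fd; rewrite /lext (big_fset_incl _ le_fd) // => x _ xNf.
by rewrite mcoeff_outdom // scale0r.
Qed.

Lemma lext_is_linear h : linear (lext h).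
Proof.
move=> c f g; pose d := (msupp (c *: f + g) `|` msupp f `|` msupp g)%fset.
rewrite !(@lextEw d) ?fsubsetUr //; first last.
- by rewrite /d -fsetUA fsubsetUl.
- by rewrite /d fsetUAC fsubsetUr.
rewrite scaler_sumr -big_split /=; apply: eq_bigr => x _.
by rewrite mcoeffD mcoeffZ scalerDl scalerA.
Qed.

HB.instance Definition _ h :=
  GRing.isLinear.Build R {malg R[X]} V *:%R (lext h) (lext_is_linear h).

Lemma lextU h c x : lext h << c *g x >> = c *: h x.
Proof.
by rewrite (lextEw _ msuppU_le) big_seq_fset1 mcoeffUU.
Qed.

Lemma lextU1 h x : lext h << x >> = h x.
Proof. by rewrite lextU scale1r. Qed.

Lemma lext_uniq (F G : {linear {malg R[X]} -> V}) :
  (forall x, F << x >> = G << x >>) -> F =1 G.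
Proof.
move=> FG f; rewrite (monalgE f) !raddf_sum; apply: eq_bigr => x _ /=.
have -> : << f@_x *g x >> = f@_x *: << x >>.
  by apply/malgP=> y; rewrite mcoeffZ !mcoeffU mulrnAr mulr1.
by rewrite !linearZ /= FG.
Qed.

End LinearExtension.

(* The category is given by its arrows alone, objects being identified with
   their identities; [cat_comp x y] is "first x, then y", and [None] means that
   x and y are not composable. *)
Record catstruct := CatStruct {
  cat_arr :> choiceType;
  cat_comp : cat_arr -> cat_arr -> option cat_arr;
  cat_ids : seq cat_arr;
  cat_ids_uniq : uniq cat_ids;
  cat_ids_neq0 : cat_ids != [::];
  cat_src : cat_arr -> cat_arr;
  cat_tgt : cat_arr -> cat_arr;
  cat_src_id : forall x, cat_src x \in cat_ids;
  cat_tgt_id : forall x, cat_tgt x \in cat_ids;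
  cat_compA : forall x y z,
    obind (cat_comp x) (cat_comp y z) = obind (cat_comp^~ z) (cat_comp x y);
  cat_idl : forall e x, e \in cat_ids ->
    cat_comp e x = if e == cat_src x then Some x else None;
  cat_idr : forall e x, e \in cat_ids ->
    cat_comp x e = if e == cat_tgt x then Some x else None }.

Definition catalg (K : fieldType) (C : catstruct) : Type := {malg K[C]}.
HB.instance Definition _ K C := GRing.Lmodule.on (catalg K C).

Definition cat_basis (K : fieldType) (C : catstruct) (o : option C) :
  catalg K C := if o is Some x then << x >> else 0.
Arguments cat_basis : clear implicits.

HB.lock Definition catalg_mul (K : fieldType) (C : catstruct)
    (f g : catalg K C) : catalg K C :=
  lext (fun x => lext (fun y => cat_basis K C (cat_comp x y)) g) f.

Section CategoryAlgebra.
Context (K : fieldType) (C : catstruct).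
Local Notation catalg := (catalg K C).
Local Notation cat_basis := (cat_basis K C).
Local Notation catalg_mul := (@catalg_mul K C).

Definition catalg_one : catalg := \sum_(e <- cat_ids C) << e >>.

Lemma catalg_mulE f g : catalg_mul f g =
  lext (fun x => lext (fun y => cat_basis (cat_comp x y)) g) f.
Proof. by rewrite unlock. Qed.

Fact catalg_mul_linearl g : linear (catalg_mul^~ g).
Proof. by move=> c f h; rewrite !catalg_mulE linearP. Qed.

Fact catalg_mul_linearr f : linear (catalg_mul f).
Proof.
move=> c g h; rewrite !catalg_mulE /lext scaler_sumr -big_split /=.
apply: eq_bigr => x _; rewrite -/(lext _ _) linearP scalerDr !scalerA.
by rewrite (mulrC _ c).
Qed.

HB.instance Definition _ f :=
  GRing.isLinear.Build K catalg catalg *:%R (catalg_mul f)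
    (catalg_mul_linearr f).

Lemma catalg_mulUU (x y : C) :
  catalg_mul << x >> << y >> = cat_basis (cat_comp x y).
Proof. by rewrite catalg_mulE !lextU1. Qed.

Lemma catalg_ind (P : catalg -> Prop) :
    (forall c f g, P f -> P g -> P (c *: f + g)) ->
    (forall x : C, P << x >>) -> P 0 -> forall f, P f.
Proof.
move=> PD PU P0 f; rewrite (monalgE f).
elim: (enum_fset _) => [|x r IHr]; rewrite ?big_nil // big_cons.
have -> : << f@_x *g x >> = f@_x *: << x >> :> catalg.
  by apply/malgP=> y; rewrite mcoeffZ !mcoeffU mulrnAr mulr1.
exact: PD.
Qed.

Fact catalg_mul0 g : catalg_mul 0 g = 0.
Proof. by rewrite catalg_mulE linear0. Qed.
Fact catalg_mulr0 f : catalg_mul f 0 = 0.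
Proof. exact: linear0. Qed.

Fact catalg_mulA : associative catalg_mul.
Proof.
move=> f g h.
elim/catalg_ind: f => [c f1 f2 IH1 IH2|x|]; last by rewrite !catalg_mul0.
  by rewrite !catalg_mul_linearl IH1 IH2.
elim/catalg_ind: g => [c f1 f2 IH1 IH2|y|]; last first.
- by rewrite catalg_mul0 !catalg_mulr0 catalg_mul0.
- elim/catalg_ind: h => [c f1 f2 IH1 IH2|z|]; last by rewrite !catalg_mulr0.
    by rewrite !catalg_mul_linearr IH1 IH2.
  rewrite !catalg_mulUU; have := cat_compA x y z.
  case: (cat_comp y z) => [yz|] /=; case: (cat_comp x y) => [xy|] /= E;
    rewrite ?catalg_mulUU ?catalg_mul0 ?catalg_mulr0 //;
    by [rewrite E | rewrite -E].
- by rewrite catalg_mul_linearl !catalg_mul_linearr catalg_mul_linearl IH1 IH2.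
Qed.

Fact catalg_mul1 : left_id catalg_one catalg_mul.
Proof.
move=> f; elim/catalg_ind: f => [c f g IHf IHg|x|].
- by rewrite catalg_mul_linearr IHf IHg.
- rewrite /catalg_one catalg_mulE linear_sum /=.
  rewrite (eq_big_seq (fun e => if e == cat_src x then << x >> else 0)).
    rewrite -big_mkcond /= -big_filter filter_pred1_uniq ?cat_ids_uniq //.
      by rewrite big_seq1.
    exact: cat_src_id.
  move=> e e_id; rewrite !lextU1 cat_idl //.
  by case: eqP.
- exact: catalg_mulr0.
Qed.

Fact catalg_mulr1 : right_id catalg_one catalg_mul.
Proof.
move=> f; elim/catalg_ind: f => [c f g IHf IHg|x|].
- by rewrite catalg_mul_linearl IHf IHg.
- rewrite /catalg_one linear_sum /=.
  rewrite (eq_big_seq (fun e => if e == cat_tgt x then << x >> else 0)).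
    rewrite -big_mkcond /= -big_filter filter_pred1_uniq ?cat_ids_uniq //.
      by rewrite big_seq1.
    exact: cat_tgt_id.
  move=> e e_id; rewrite catalg_mulUU cat_idr //.
  by case: eqP.
- exact: catalg_mul0.
Qed.

Fact catalg_mulDl : left_distributive catalg_mul +%R.
Proof. by move=> f g h; rewrite !catalg_mulE linearD. Qed.
Fact catalg_mulDr : right_distributive catalg_mul +%R.
Proof. by move=> f g h; exact: linearD. Qed.

Fact catalg_oner_neq0 : catalg_one != 0.
Proof.
have [e e_id] : exists e, e \in cat_ids C.
  by case: (cat_ids C) (cat_ids_neq0 C) => // e r _; exists e; exact: mem_head.
apply/eqP=> /(congr1 (mcoeff e)) /eqP; rewrite mcoeff0 raddf_sum /=.
rewrite (bigD1_seq e) ?cat_ids_uniq //= mcoeffUU big1 ?addr0 ?oner_eq0 //.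
by move=> i /negPf i_e; rewrite mcoeffU i_e.
Qed.

HB.instance Definition _ := GRing.Zmodule_isNzRing.Build catalg
  catalg_mulA catalg_mul1 catalg_mulr1 catalg_mulDl catalg_mulDr
  catalg_oner_neq0.

Fact catalg_scaleAl (c : K) (f g : catalg) : c *: (f * g) = c *: f * g.
Proof. by rewrite /GRing.mul /= !catalg_mulE linearZ_LR. Qed.
Fact catalg_scaleAr (c : K) (f g : catalg) : c *: (f * g) = f * (c *: g).
Proof. symmetry; exact: linearZ_LR. Qed.

HB.instance Definition _ :=
  GRing.Lmodule_isLalgebra.Build K catalg catalg_scaleAl.
HB.instance Definition _ :=
  GRing.Lalgebra_isAlgebra.Build K catalg catalg_scaleAr.

Lemma catalgU (x y : C) :
  (<< x >> : catalg) * (<< y >> : catalg) = cat_basis (cat_comp x y).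
Proof. exact: catalg_mulUU. Qed.

Lemma catalg1E : (1 : catalg) = \sum_(e <- cat_ids C) << e >>.
Proof. by []. Qed.

End CategoryAlgebra.

Record quiver := Quiver {
  qvert : finType;
  qarrow : finType;
  qsrc : qarrow -> qvert;
  qtgt : qarrow -> qvert;
  qvert_gt0 : (0 < #|qvert|)%N }.

Section PathCategory.
Context (Q : quiver).
Implicit Types (v : qvert Q) (a : qarrow Q) (s : seq (qarrow Q)).

Fixpoint path_ok v s : bool :=
  if s is a :: s' then (qsrc a == v) && path_ok (qtgt a) s' else true.

(* The source is redundant unless the path is trivial. *)
Record qpath := QPath {
  path_val : qvert Q * seq (qarrow Q);
  _ : path_ok path_val.1 path_val.2 }.
HB.instance Definition _ := [isSub for path_val].
HB.instance Definition _ := [Choice of qpath by <:].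

Definition path_src (p : qpath) : qvert Q := (path_val p).1.
Definition path_arrows (p : qpath) : seq (qarrow Q) := (path_val p).2.
Definition path_tgt (p : qpath) : qvert Q :=
  last (path_src p) (map (@qtgt Q) (path_arrows p)).

Definition triv_path v : qpath := @QPath (v, [::]) isT.

Lemma path_ok_cat v s s' :
  path_ok v (s ++ s') =
  path_ok v s && path_ok (last v (map (@qtgt Q) s)) s'.
Proof. by elim: s v => //= a s IHs v; rewrite IHs andbA. Qed.

Definition path_comp (p q : qpath) : option qpath :=
  if path_tgt p == path_src q then
    insub (path_src p, path_arrows p ++ path_arrows q) else None.

Lemma path_compT p q : path_tgt p = path_src q ->
  exists2 r, path_comp p q = Some r &
    path_src r = path_src p /\ path_arrows r = path_arrows p ++ path_arrows q.
Proof.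
move=> pq; rewrite /path_comp pq eqxx.
case: insubP => [r _ val_r|]; first by exists r;
  rewrite // /path_src /path_arrows -/(val r) val_r.
rewrite /= path_ok_cat (valP p) /=.
by rewrite -/(path_tgt p) pq (valP q).
Qed.

Lemma path_compF p q : path_tgt p != path_src q -> path_comp p q = None.
Proof. by rewrite /path_comp => /negPf ->. Qed.

Lemma qpath_eq p q : path_src p = path_src q ->
  path_arrows p = path_arrows q -> p = q.
Proof.
rewrite /path_src /path_arrows => pq1 pq2; apply: val_inj.
move: pq1 pq2; rewrite /=.
by case: (path_val p) (path_val q) => [? ?] [? ?] /= -> ->.
Qed.

Lemma path_tgt_comp p q r : path_tgt p = path_src q ->
  path_src r = path_src p -> path_arrows r = path_arrows p ++ path_arrows q ->
  path_tgt r = path_tgt q.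
Proof.
by move=> pq rs ra; rewrite /path_tgt rs ra map_cat last_cat -pq.
Qed.

Definition triv_paths : seq qpath := map triv_path (enum (qvert Q)).

Lemma mem_triv_paths v : triv_path v \in triv_paths.
Proof. by apply: map_f; rewrite mem_enum. Qed.

Fact triv_paths_uniq : uniq triv_paths.
Proof. by rewrite map_inj_uniq ?enum_uniq // => v w /(congr1 path_src). Qed.

Fact triv_paths_neq0 : triv_paths != [::].
Proof.
by rewrite -size_eq0 size_map -cardE -lt0n qvert_gt0.
Qed.

Fact path_compA p q r :
  obind (path_comp p) (path_comp q r) = obind (path_comp^~ r) (path_comp p q).
Proof.
have [qr|qr] := eqVneq (path_tgt q) (path_src r); last first.
  rewrite (path_compF qr) /=.
  have [pq|pq] := eqVneq (path_tgt p) (path_src q); last by rewrite path_compF.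
  have [x -> [xs xa]] /= := path_compT pq.
  by rewrite path_compF // (path_tgt_comp pq xs xa).
have [y -> [ys ya]] /= := path_compT qr.
have [pq|pq] := eqVneq (path_tgt p) (path_src q); last first.
  by rewrite (path_compF pq) path_compF // ys.
have [x -> [xs xa]] /= := path_compT pq.
have pyE : path_tgt p = path_src y by rewrite ys.
have xrE : path_tgt x = path_src r by rewrite (path_tgt_comp pq xs xa).
have [z -> [zs za]] := path_compT pyE; have [t -> [ts ta]] := path_compT xrE.
by congr Some; apply: qpath_eq; rewrite ?zs ?ts ?za ?ta ?xs ?xa ?ya ?catA.
Qed.

Fact path_comp_idl e p : e \in triv_paths ->
  path_comp e p = if e == triv_path (path_src p) then Some p else None.
Proof.
case/mapP=> v _ ->; have [->|vp] := eqVneq v (path_src p).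
  rewrite eqxx.
  have [r -> [rs ra]] := @path_compT (triv_path (path_src p)) p erefl.
  by congr Some; apply: qpath_eq.
rewrite path_compF //; case: eqP => // /(congr1 path_src) /eqP.
by rewrite (negPf vp).
Qed.

Fact path_comp_idr e p : e \in triv_paths ->
  path_comp p e = if e == triv_path (path_tgt p) then Some p else None.
Proof.
case/mapP=> v _ ->; have [->|vp] := eqVneq v (path_tgt p).
  rewrite eqxx.
  have [r -> [rs ra]] := @path_compT p (triv_path (path_tgt p)) erefl.
  by congr Some; apply: qpath_eq; rewrite // ra cats0.
rewrite path_compF; last by rewrite eq_sym.
by case: eqP => // /(congr1 path_src) /eqP; rewrite (negPf vp).
Qed.

Definition path_cat : catstruct := {|
  cat_ids_uniq := triv_paths_uniq;
  cat_ids_neq0 := triv_paths_neq0;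
  cat_src_id := fun p => mem_triv_paths (path_src p);
  cat_tgt_id := fun p => mem_triv_paths (path_tgt p);
  cat_compA := path_compA;
  cat_idl := path_comp_idl;
  cat_idr := path_comp_idr |}.

Lemma arrow_path_ok a : path_ok (qsrc a) [:: a].
Proof. by rewrite /= eqxx. Qed.

Definition arrow_path a : qpath := QPath (path_val := (_, _)) (arrow_path_ok a).

End PathCategory.

Definition path_alg (K : fieldType) (Q : quiver) : algType K :=
  catalg K (path_cat Q).

HB.lock Definition arrow (K : fieldType) (Q : quiver) (a : qarrow Q) :
  path_alg K Q := << arrow_path a >>.

Section PathAlgebra.
Context (K : fieldType) (Q : quiver).
Local Notation path_alg := (path_alg K Q).
Local Notation arrow := (@arrow K Q).

Definition triv_coef (v : qvert Q) (f : path_alg) : K := f@_(triv_path v).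

Fact triv_coef_is_linear v c f g :
  triv_coef v (c *: f + g) = c * triv_coef v f + triv_coef v g.
Proof. by rewrite /triv_coef mcoeffD mcoeffZ. Qed.

Lemma triv_path_eq (p : qpath Q) v :
  (p == triv_path v) = (path_src p == v) && (path_arrows p == [::]).
Proof.
apply/eqP/andP=> [->|[/eqP p1 /eqP p2]]; first by rewrite eqxx.
exact: qpath_eq.
Qed.

Lemma triv_coefM v f g : triv_coef v (f * g) = triv_coef v f * triv_coef v g.
Proof.
elim/catalg_ind: f => [c f1 f2 IH1 IH2|p|].
- by rewrite mulrDl -scalerAl !triv_coef_is_linear IH1 IH2 mulrDl mulrA.
- elim/catalg_ind: g => [c g1 g2 IH1 IH2|q|].
  + rewrite mulrDr -scalerAr !triv_coef_is_linear IH1 IH2 mulrDr.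
    by rewrite !mulrA (mulrC _ c).
  + rewrite [_ * _]catalgU /triv_coef /= !mcoeffU -natrM mulnb !triv_path_eq.
    have [pq|pq] := eqVneq (path_tgt p) (path_src q); last first.
      rewrite path_compF //= mcoeff0.
      case: andP => // -[/andP[/eqP pv /eqP p0]].
      by case/andP=> /eqP qv _; move: pq; rewrite /path_tgt p0 pv qv eqxx.
    have [r -> [rs ra]] := path_compT pq; rewrite /= mcoeffU triv_path_eq rs ra.
    rewrite -!size_eq0 size_cat addn_eq0 !size_eq0 -pq /path_tgt.
    by case: (path_arrows p) => [|a s] /=; case: eqP; rewrite ?andbF.
  + by rewrite mulr0 /triv_coef mcoeff0 mulr0.
- by rewrite mul0r /triv_coef mcoeff0 mul0r.
Qed.

Lemma triv_coefB v f g : triv_coef v (f - g) = triv_coef v f - triv_coef v g.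
Proof. by rewrite /triv_coef mcoeffB. Qed.

Lemma triv_coef_arrow v a : triv_coef v (arrow a) = 0.
Proof. by rewrite unlock /triv_coef mcoeffU triv_path_eq andbF. Qed.

Lemma triv_coef1 v : triv_coef v 1 = 1.
Proof.
rewrite /triv_coef catalg1E raddf_sum /= (bigD1_seq (triv_path v)) /=.
- rewrite mcoeffUU big1 ?addr0 // => p /negPf pv.
  by rewrite mcoeffU pv.
- exact: mem_triv_paths.
- exact: triv_paths_uniq.
Qed.

Lemma triv_coefX v f n : triv_coef v (f ^+ n) = triv_coef v f ^+ n.
Proof.
by elim: n => [|n IHn]; rewrite ?triv_coef1 // !exprS triv_coefM IHn.
Qed.

Definition triv_coefE := (triv_coefB, triv_coefM, triv_coefX, triv_coef_arrow).

End PathAlgebra.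

Arguments arrow K {Q} a.

(* Relations are only required to have no trivial path as a summand; this makes
   the ideal they generate proper. *)
Definition is_relation (K : fieldType) (Q : quiver) (r : path_alg K Q) : Prop :=
  forall v, triv_coef v r = 0.

Record bound_quiver (K : fieldType) := BoundQuiver {
  bq_quiver : quiver;
  bq_rels : seq (path_alg K bq_quiver);
  bq_relsP : forall r, r \in bq_rels -> is_relation r }.

Section BoundQuiverAlgebra.
Context (K : fieldType) (B : bound_quiver K).
Let KQ : algType K := path_alg K (bq_quiver B).

Definition bq_ideal : {pred KQ} := gen_ideal (fun r : KQ => r \in bq_rels B).

Fact bq_ideal_proper : 1 \notin bq_ideal.
Proof.
have [v _] : exists v : qvert (bq_quiver B), true.
  by have /card_gt0P[v _] := qvert_gt0 (bq_quiver B); exists v.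
apply/negP=> /gen_idealP gen1.
suff: (1 : KQ) \in [pred f : KQ | triv_coef v f == 0].
  by rewrite inE triv_coef1 oner_eq0.
apply: gen1.
  split=> [|f g|f g|f g]; rewrite !inE.
  - by rewrite /triv_coef mcoeff0.
  - by rewrite /triv_coef mcoeffB => /eqP -> /eqP ->; rewrite subrr.
  - by rewrite triv_coefM => /eqP ->; rewrite mulr0.
  - by rewrite triv_coefM => /eqP ->; rewrite mul0r.
by move=> r /bq_relsP rP; rewrite inE rP.
Qed.

Definition bound_quiver_alg : algType K :=
  quotalg (ProperIdeal2 (gen_ideal_ideal _) bq_ideal_proper).

End BoundQuiverAlgebra.

Definition monoid_cat (R : pzRingType) : catstruct.
Proof.
refine (@CatStruct R (fun x y => Some (x * y)) [:: 1] isT isT (fun=> 1)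
  (fun=> 1) (fun=> mem_head _ _) (fun=> mem_head _ _) _ _ _).
- by move=> x y z; rewrite /= mulrA.
- by move=> e x; rewrite inE => /eqP ->; rewrite eqxx mul1r.
- by move=> e x; rewrite inE => /eqP ->; rewrite eqxx mulr1.
Defined.

Section EnvelopingAlgebra.
Context (K : fieldType) (A : algType K).

(* A^op (x)_K A is the free K-module on A^op * A modulo bilinearity; the
   submodule of bilinearity relations is stable under multiplication by pure
   tensors, so it is the two-sided ideal generated by these relations in the
   algebra of the multiplicative monoid of A^op * A. *)
Definition env_pairs : algType K := catalg K (monoid_cat (A^c * A)%type).

Definition env_pair (a b : A) : env_pairs := << ((a : A^c), b) >>.

Variant env_rel : env_pairs -> Prop :=
| EnvDl a a' b :
    env_rel (env_pair (a + a') b - (env_pair a b + env_pair a' b))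
| EnvDr a b b' :
    env_rel (env_pair a (b + b') - (env_pair a b + env_pair a b'))
| EnvZl c a b : env_rel (env_pair (c *: a) b - c *: env_pair a b)
| EnvZr c a b : env_rel (env_pair a (c *: b) - c *: env_pair a b).

Lemma env_pairM a b a' b' :
  env_pair a b * env_pair a' b' = env_pair (a' * a) (b * b').
Proof. exact: catalgU. Qed.

Definition env_act (m : A) (z : env_pairs) : A :=
  lext (fun ab : A^c * A => ab.2 * m * ab.1) z.

HB.instance Definition _ m :=
  GRing.isLinear.Build K env_pairs A *:%R (env_act m) (lext_is_linear _).

Lemma env_actU m a b : env_act m (env_pair a b) = b * m * a.
Proof. exact: lextU1. Qed.

Lemma env_act_linear z d x y :
  env_act (d *: x + y) z = d *: env_act x z + env_act y z.
Proof.
elim/catalg_ind: z => [c f g IHf IHg|[a b]|].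
- rewrite !linearP /= IHf IHg !scalerDr !scalerA (mulrC c) !addrA.
  by congr (_ + _); rewrite -!addrA; congr (_ + _); rewrite addrC.
- rewrite !env_actU.
  by rewrite mulrDr mulrDl -scalerAr -scalerAl.
- by rewrite !linear0 addr0.
Qed.

Lemma env_act0l z : env_act 0 z = 0.
Proof.
by have := env_act_linear z (-1) 0 0; rewrite scaler0 addr0 scaleN1r addNr.
Qed.

Lemma env_actM m f g : env_act m (f * g) = env_act (env_act m g) f.
Proof.
elim/catalg_ind: f => [c f1 f2 IH1 IH2|[a b]|].
- by rewrite mulrDl -scalerAl !linearP /= IH1 IH2.
- elim/catalg_ind: g => [c f1 f2 IH1 IH2|[a' b']|].
  + by rewrite mulrDr -scalerAr !linearP /= IH1 IH2 env_act_linear.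
  + by rewrite -!/(env_pair _ _) env_pairM !env_actU !mulrA.
  + rewrite mulr0 !linear0 -/(env_pair a b) env_actU.
    by rewrite mulr0 mul0r.
- by rewrite mul0r !linear0.
Qed.

Lemma env_act1 m : env_act m 1 = m.
Proof.
rewrite catalg1E big_seq1 -[<< _ >>]/(env_pair 1 1) env_actU.
by rewrite mul1r mulr1.
Qed.

Lemma env_act_rel m z : env_rel z -> env_act m z = 0.
Proof.
case=> [a a' b|a b b'|c a b|c a b]; rewrite (linearB (env_act m)).
- by rewrite (linearD (env_act m)) /= !env_actU mulrDr subrr.
- by rewrite (linearD (env_act m)) /= !env_actU !mulrDl subrr.
- by rewrite (linearZ_LR (env_act m)) /= !env_actU scalerAr subrr.
- by rewrite (linearZ_LR (env_act m)) /= !env_actU -!scalerAl subrr.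
Qed.

Definition env_ideal : {pred env_pairs} := gen_ideal env_rel.

Lemma env_act_ideal z : z \in env_ideal -> forall m, env_act m z = 0.
Proof.
move=> /gen_idealP genz m.
suff: z \in [pred z | `[< forall m, env_act m z = 0 >]] by move/asboolP.
apply: genz; last by move=> r relr; apply/asboolP=> ?; exact: env_act_rel.
split=> [|f g /asboolP Hf /asboolP Hg|f g /asboolP Hg|f g /asboolP Hg];
  apply/asboolP=> x.
- exact: linear0.
- by rewrite linearB /= Hf Hg subrr.
- by rewrite env_actM Hg env_act0l.
- by rewrite env_actM Hg.
Qed.

Fact env_ideal_proper : 1 \notin env_ideal.
Proof.
apply/negP=> /env_act_ideal /(_ 1) /eqP; rewrite env_act1.
by rewrite oner_eq0.
Qed.

Definition env_ideal2 : proper_ideal2 env_pairs :=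
  ProperIdeal2 (gen_ideal_ideal env_rel) env_ideal_proper.

Definition envalg : algType K := quotalg env_ideal2.

Definition env_tensor (a b : A) : envalg :=
  quotalg_pi env_ideal2 (env_pair a b).

End EnvelopingAlgebra.

(* A as a left A^e-module: (a (x) b) m = b m a. *)
Section RegularBimodule.
Context (K : fieldType) (A : algType K).

Definition envmod : Type := A.
HB.instance Definition _ := GRing.Zmodule.on envmod.

Definition envmod_scale (z : envalg A) (m : envmod) : envmod :=
  env_act (m : A) (quotalg_repr z).

Lemma envmod_scaleE (z : env_pairs A) (m : A) :
  envmod_scale (quotalg_pi (env_ideal2 A) z) m = env_act m z.
Proof.
rewrite /envmod_scale; set z' := quotalg_repr _.
apply/eqP; rewrite -subr_eq0 -linearB /=; apply/eqP.
apply: env_act_ideal.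
by apply/(@quotalg_eq _ _ (env_ideal2 A)); rewrite quotalg_piK.
Qed.

Fact envmod_scaleA x y m :
  envmod_scale x (envmod_scale y m) = envmod_scale (x * y) m.
Proof.
rewrite -(quotalg_piK x) -(quotalg_piK y) -rmorphM !envmod_scaleE.
by rewrite env_actM.
Qed.
Fact envmod_scale1 : left_id 1 envmod_scale.
Proof.
move=> m; rewrite -(rmorph1 (quotalg_pi (env_ideal2 A))) envmod_scaleE.
exact: env_act1.
Qed.
Fact envmod_scaleDr : right_distributive envmod_scale +%R.
Proof.
move=> z m n; rewrite /envmod_scale -[m in LHS]scale1r env_act_linear.
by rewrite scale1r.
Qed.
Fact envmod_scaleDl m : {morph envmod_scale^~ m : x y / x + y}.
Proof.
move=> x y; rewrite -(quotalg_piK x) -(quotalg_piK y) -raddfD !envmod_scaleE.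
by rewrite linearD.
Qed.

HB.instance Definition _ := GRing.Zmodule_isLmodule.Build (envalg A) envmod
  envmod_scaleA envmod_scale1 envmod_scaleDr envmod_scaleDl.

Lemma env_tensor_scale (a b m : A) :
  env_tensor a b *: (m : envmod) = b * m * a.
Proof. by rewrite -env_actU -envmod_scaleE. Qed.

End RegularBimodule.

Definition projective (R : nzRingType) (P : lmodType R) : Prop :=
  forall (U V : lmodType R) (g : {linear U -> V}) (f : {linear P -> V}),
    (forall v, exists u, g u = v) ->
    exists h : {linear P -> U}, forall x, g (h x) = f x.

Record proj_resolution (R : nzRingType) (M : lmodType R) := ProjResolution {
  res_mod :> nat -> lmodType R;
  res_diff : forall n, {linear res_mod n.+1 -> res_mod n};
  res_aug : {linear res_mod 0 -> M};
  res_proj : forall n, projective (res_mod n);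
  res_aug_surj : forall m, exists x, res_aug x = m;
  res_exact0 : forall x, res_aug x = 0 <-> exists y, res_diff 0 y = x;
  res_exact : forall n x,
    res_diff n x = 0 <-> exists y, res_diff n.+1 y = x }.

Section Kernel.
Context (R : pzRingType) (U V : lmodType R) (f : {linear U -> V}).

Definition ker_pred : {pred U} := fun x => f x == 0.

Lemma ker_predE x : (x \in ker_pred) = (f x == 0).
Proof. by []. Qed.

Fact ker_pred_closed : submod_closed ker_pred.
Proof.
split=> [|a x y]; rewrite !ker_predE ?linear0 // => /eqP fx /eqP fy.
by rewrite linearP fx fy scaler0 addr0.
Qed.

HB.instance Definition _ := GRing.isSubmodClosed.Build R U ker_pred
  (GRing.submod_closed_semi ker_pred_closed).

Record kernel := Kernel { ker_val : U; _ : ker_val \in ker_pred }.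
HB.instance Definition _ := [isSub for ker_val].
HB.instance Definition _ := [Choice of kernel by <:].
HB.instance Definition _ := [SubChoice_isSubLmodule of kernel by <:].

Fact ker_val_linear : linear ker_val.
Proof. by []. Qed.
HB.instance Definition _ :=
  GRing.isLinear.Build R kernel U *:%R ker_val ker_val_linear.

Lemma ker_valP (x : kernel) : f (ker_val x) = 0.
Proof. by case: x => x fx; apply/eqP. Qed.

End Kernel.

Section FreeModule.
Context (R : nzRingType).

Lemma free_projective (X : choiceType) : projective {malg R[X]}.
Proof.
move=> U V g f g_surj.
have /choice[h hP] : forall x : X, exists u, g u = f << x >>.
  by move=> x; apply: g_surj.
exists (lext h : {linear _ -> _}).
apply: (lext_uniq (F := g \o lext h)) => x /=.
by rewrite lextU1.
Qed.

Context (M : lmodType R).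

(* Standard free resolution of M: its n-th term is free on the set of elements
   of the n-th syzygy. *)
Fixpoint syzygy n : lmodType R :=
  if n is n'.+1 then
    kernel (lext (@id (syzygy n')) : {linear {malg R[syzygy n']} -> syzygy n'})
  else M.

Definition free_res_mod n : lmodType R := {malg R[syzygy n]}.
Definition free_res_aug n : {linear free_res_mod n -> syzygy n} := lext id.
Definition free_res_diff n : {linear free_res_mod n.+1 -> free_res_mod n} :=
  @ker_val _ _ _ (free_res_aug n) \o free_res_aug n.+1.

Fact free_res_aug_surj n (m : syzygy n) : exists x, free_res_aug n x = m.
Proof. by exists << m >>; rewrite /free_res_aug /= lextU1. Qed.

Fact free_res_exact0 n x :
  free_res_aug n x = 0 <-> exists y, free_res_diff n y = x.
Proof.
split=> [/eqP x0|[y <-]]; last exact: (ker_valP (f := free_res_aug n)).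
by exists << Kernel x0 : syzygy n.+1 >>; rewrite /= lextU1.
Qed.

Fact free_res_exact n x :
  free_res_diff n x = 0 <-> exists y, free_res_diff n.+1 y = x.
Proof.
rewrite -free_res_exact0; split=> [x0|x0]; last by rewrite /= [lext _ _]x0.
exact: (@val_inj _ _ (kernel (free_res_aug n))).
Qed.

Definition free_resolution : proj_resolution M :=
  @ProjResolution R M free_res_mod free_res_diff (free_res_aug 0)
    (fun n => @free_projective (syzygy n)) (@free_res_aug_surj 0)
    (@free_res_exact0 0) free_res_exact.

End FreeModule.

Section Cohomology.
Context (K : fieldType) (C : nat -> lmodType K).
Context (d : forall n, {linear C n -> C n.+1}).

Definition coboundary n : C n -> Prop :=
  match n with
  | 0 => fun x => x = 0
  | n'.+1 => fun x => exists y, d n' y = x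
  end.

Definition coboundary_pred n : {pred kernel (d n)} :=
  fun z => `[< coboundary (ker_val z) >].

Fact coboundary_closed n : submod_closed (@coboundary_pred n).
Proof.
split=> [|a x y /asboolP dx /asboolP dy]; apply/asboolP.
  by rewrite linear0; case: n => //= n; exists 0; rewrite linear0.
rewrite linearP; case: n x y dx dy => [|n] x y /=.
  by move=> -> ->; rewrite scaler0 addr0.
by case=> [x' <-] [y' <-]; exists (a *: x' + y'); rewrite linearP.
Qed.

Definition cohomology n : lmodType K :=
  quotmod (Submodule (@coboundary_closed n)).

End Cohomology.

Section RestrictionOfScalars.
Context (K : fieldType) (R : algType K) (N : lmodType R).

Definition restr : Type := N.
HB.instance Definition _ := GRing.Zmodule.on restr.

Definition restr_scale (c : K) (x : restr) : restr := c%:A *: (x : N).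

Fact restr_scaleA a b x :
  restr_scale a (restr_scale b x) = restr_scale (a * b) x.
Proof. by rewrite /restr_scale scalerA -scalerAl mul1r scalerA. Qed.
Fact restr_scale1 : left_id 1 restr_scale.
Proof. by move=> x; rewrite /restr_scale !scale1r. Qed.
Fact restr_scaleDr : right_distributive restr_scale +%R.
Proof. by move=> a x y; rewrite /restr_scale scalerDr. Qed.
Fact restr_scaleDl x : {morph restr_scale^~ x : a b / a + b}.
Proof. by move=> a b; rewrite /restr_scale !scalerDl. Qed.

HB.instance Definition _ := GRing.Zmodule_isLmodule.Build K restr
  restr_scaleA restr_scale1 restr_scaleDr restr_scaleDl.

End RestrictionOfScalars.

Section Hom.
Context (K : fieldType) (R : algType K).

Definition hom_pred (M N : lmodType R) : {pred M -> restr N} :=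
  fun f => `[< linear (f : M -> N) >].

Fact hom_pred_closed (M N : lmodType R) : submod_closed (@hom_pred M N).
Proof.
split=> [|c f g /asboolP fl /asboolP gl]; apply/asboolP=> a x y.
  by rewrite /= scaler0 addr0.
rewrite /= -[LHS]/(c%:A *: (f _ : N) + (g _ : N)) fl gl.
rewrite -[in RHS]/(c%:A *: (f _ : N) + (g _ : N)).
rewrite !scalerDr !scalerA -scalerAl -scalerAr mul1r mulr1.
by rewrite !addrA; congr (_ + _); rewrite -!addrA; congr (_ + _); rewrite addrC.
Qed.

HB.instance Definition _ (M N : lmodType R) :=
  GRing.isSubmodClosed.Build K (M -> restr N) (@hom_pred M N)
    (GRing.submod_closed_semi (@hom_pred_closed M N)).

(* K acts on N through the central c%:A. *)
Record hom (M N : lmodType R) := Hom {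
  hom_val :> M -> restr N;
  _ : hom_val \in @hom_pred M N }.
HB.instance Definition _ (M N : lmodType R) := [isSub for @hom_val M N].
HB.instance Definition _ (M N : lmodType R) := [Choice of hom M N by <:].
HB.instance Definition _ (M N : lmodType R) :=
  [SubChoice_isSubLmodule of hom M N by <:].

Lemma hom_linear (M N : lmodType R) (f : hom M N) : linear (f : M -> N).
Proof. by case: f => f f_lin; apply/asboolP. Qed.

Section Precomposition.
Context (M M' N : lmodType R) (u : {linear M' -> M}).

Fact hom_pre_subproof (f : hom M N) :
  (fun x => f (u x)) \in @hom_pred M' N.
Proof. by apply/asboolP=> a x y; rewrite linearP hom_linear. Qed.

Definition hom_pre (f : hom M N) : hom M' N := Hom (hom_pre_subproof f).

Fact hom_pre_linear : linear hom_pre.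
Proof. by move=> c f g; apply: val_inj. Qed.
HB.instance Definition _ :=
  GRing.isLinear.Build K (hom M N) (hom M' N) *:%R hom_pre hom_pre_linear.

End Precomposition.

Definition ext_of (M : lmodType R) (P : proj_resolution M) (N : lmodType R)
    (n : nat) : lmodType K :=
  @cohomology K (fun n => hom (P n) N)
    (fun n => @hom_pre _ _ N (res_diff P n)) n.

Definition Ext (n : nat) (M N : lmodType R) : lmodType K :=
  ext_of (free_resolution M) N n.

End Hom.

Definition HH (K : fieldType) (n : nat) (A : algType K) : lmodType K :=
  @Ext K (envalg A) n (envmod A) (envmod A).

Definition has_dim (K : fieldType) (V : lmodType K) (d : nat) : Prop :=
  exists2 f : V -> 'rV[K]_d, linear f & bijective f.

Definition v1 : 'I_3 := Ordinal (isT : 0 < 3)%N.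
Definition v2 : 'I_3 := Ordinal (isT : 1 < 3)%N.
Definition v3 : 'I_3 := Ordinal (isT : 2 < 3)%N.

Fact I3_gt0 : (0 < #|'I_3|)%N.
Proof. by rewrite card_ord. Qed.

Variant arrow4 := alpha4 | beta4 | gamma4 | delta4.
Variant arrow5 := alpha5 | beta5 | gamma5 | delta5 | sigma5.

Definition arrow4_to (a : arrow4) : 'I_4 :=
  match a with
  | alpha4 => inord 0 | beta4 => inord 1 | gamma4 => inord 2 | delta4 => inord 3
  end.
Definition arrow4_of (i : 'I_4) : arrow4 :=
  nth alpha4 [:: alpha4; beta4; gamma4; delta4] i.
Fact arrow4_toK : cancel arrow4_to arrow4_of.
Proof. by case; rewrite /arrow4_of inordK. Qed.
HB.instance Definition _ := Finite.copy arrow4 (can_type arrow4_toK).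

Definition arrow5_to (a : arrow5) : 'I_5 :=
  match a with
  | alpha5 => inord 0 | beta5 => inord 1 | gamma5 => inord 2 | delta5 => inord 3
  | sigma5 => inord 4
  end.
Definition arrow5_of (i : 'I_5) : arrow5 :=
  nth alpha5 [:: alpha5; beta5; gamma5; delta5; sigma5] i.
Fact arrow5_toK : cancel arrow5_to arrow5_of.
Proof. by case; rewrite /arrow5_of inordK. Qed.
HB.instance Definition _ := Finite.copy arrow5 (can_type arrow5_toK).

Definition quiver4 (ends : arrow4 -> 'I_3 * 'I_3) : quiver :=
  Quiver (fun a => (ends a).1) (fun a => (ends a).2) I3_gt0.
Definition quiver5 (ends : arrow5 -> 'I_3 * 'I_3) : quiver :=
  Quiver (fun a => (ends a).1) (fun a => (ends a).2) I3_gt0.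

Definition quiver_Lambda4 : quiver := quiver4 (fun a =>
  match a with
  | alpha4 => (v1, v3)
  | gamma4 => (v3, v2)
  | delta4 => (v1, v2)
  | beta4 => (v2, v1)
  end).

Section Lambda4.
Context (K : fieldType).
Let al := arrow K (alpha4 : qarrow quiver_Lambda4).
Let be := arrow K (beta4 : qarrow quiver_Lambda4).
Let ga := arrow K (gamma4 : qarrow quiver_Lambda4).
Let de := arrow K (delta4 : qarrow quiver_Lambda4).

Definition rels_Lambda4 : seq (path_alg K quiver_Lambda4) :=
  [:: de * be * de - al * ga; (be * de) ^+ 3 * be; ga * be * al].

Fact rels_Lambda4P r : r \in rels_Lambda4 -> is_relation r.
Proof.
move=> r_rel v; apply/eqP; move: r r_rel; apply/allP.
by rewrite /= !triv_coefE !(mulr0, mul0r, expr0n, subr0) eqxx.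
Qed.

Definition Lambda4' : algType K := bound_quiver_alg (BoundQuiver rels_Lambda4P).
End Lambda4.

Definition quiver_Lambda5 : quiver := quiver5 (fun a =>
  match a with
  | alpha5 => (v2, v2)
  | beta5 => (v1, v2)
  | gamma5 => (v2, v1)
  | delta5 => (v2, v3)
  | sigma5 => (v3, v2)
  end).

Section Lambda5.
Context (K : fieldType).
Let al := arrow K (alpha5 : qarrow quiver_Lambda5).
Let be := arrow K (beta5 : qarrow quiver_Lambda5).
Let ga := arrow K (gamma5 : qarrow quiver_Lambda5).
Let de := arrow K (delta5 : qarrow quiver_Lambda5).
Let si := arrow K (sigma5 : qarrow quiver_Lambda5).

Definition rels_Lambda5 : seq (path_alg K quiver_Lambda5) :=
  [:: al ^+ 2 - ga * be; al ^+ 3 - de * si; be * de; si * ga; al * de;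
      si * al; be * ga].

Fact rels_Lambda5P r : r \in rels_Lambda5 -> is_relation r.
Proof.
move=> r_rel v; apply/eqP; move: r r_rel; apply/allP.
by rewrite /= !triv_coefE !(mulr0, mul0r, expr0n, subr0) eqxx.
Qed.

Definition Lambda5' : algType K := bound_quiver_alg (BoundQuiver rels_Lambda5P).
End Lambda5.

Definition quiver_Lambda6 : quiver := quiver4 (fun a =>
  match a with
  | alpha4 => (v1, v2)
  | beta4 => (v2, v1)
  | delta4 => (v2, v3)
  | gamma4 => (v3, v2)
  end).

Section Lambda6.
Context (K : fieldType).
Let al := arrow K (alpha4 : qarrow quiver_Lambda6).
Let be := arrow K (beta4 : qarrow quiver_Lambda6).
Let ga := arrow K (gamma4 : qarrow quiver_Lambda6).
Let de := arrow K (delta4 : qarrow quiver_Lambda6).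

Definition rels_Lambda6 : seq (path_alg K quiver_Lambda6) :=
  [:: al * de * ga * de; ga * de * ga * be; al * be;
      be * al - de * ga * de * ga].

Fact rels_Lambda6P r : r \in rels_Lambda6 -> is_relation r.
Proof.
move=> r_rel v; apply/eqP; move: r r_rel; apply/allP.
by rewrite /= !triv_coefE !(mulr0, mul0r, expr0n, subr0) eqxx.
Qed.

Definition Lambda6' : algType K := bound_quiver_alg (BoundQuiver rels_Lambda6P).
End Lambda6.

Definition quiver_Lambda7 : quiver := quiver5 (fun a =>
  match a with
  | alpha5 => (v1, v1)
  | sigma5 => (v1, v3)
  | gamma5 => (v3, v2)
  | delta5 => (v1, v2)
  | beta5 => (v2, v1)
  end).

Section Lambda7.
Context (K : fieldType).
Let al := arrow K (alpha5 : qarrow quiver_Lambda7).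
Let be := arrow K (beta5 : qarrow quiver_Lambda7).
Let ga := arrow K (gamma5 : qarrow quiver_Lambda7).
Let de := arrow K (delta5 : qarrow quiver_Lambda7).
Let si := arrow K (sigma5 : qarrow quiver_Lambda7).

Definition rels_Lambda7 : seq (path_alg K quiver_Lambda7) :=
  [:: be * de; al * si; al * de - si * ga; ga * be * al;
      al ^+ 2 - de * be].

Fact rels_Lambda7P r : r \in rels_Lambda7 -> is_relation r.
Proof.
move=> r_rel v; apply/eqP; move: r r_rel; apply/allP.
by rewrite /= !triv_coefE !(mulr0, mul0r, expr0n, subr0) eqxx.
Qed.

Definition Lambda7' : algType K := bound_quiver_alg (BoundQuiver rels_Lambda7P).
End Lambda7.

Definition quiver_Lambda8 : quiver := quiver5 (fun a =>
  match a with
  | alpha5 => (v1, v1)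
  | sigma5 => (v3, v1)
  | gamma5 => (v2, v3)
  | delta5 => (v2, v1)
  | beta5 => (v1, v2)
  end).

Section Lambda8.
Context (K : fieldType).
Let al := arrow K (alpha5 : qarrow quiver_Lambda8).
Let be := arrow K (beta5 : qarrow quiver_Lambda8).
Let ga := arrow K (gamma5 : qarrow quiver_Lambda8).
Let de := arrow K (delta5 : qarrow quiver_Lambda8).
Let si := arrow K (sigma5 : qarrow quiver_Lambda8).

Definition rels_Lambda8 : seq (path_alg K quiver_Lambda8) :=
  [:: de * be; si * al; de * al - ga * si; al * be * ga;
      al ^+ 2 - be * de].

Fact rels_Lambda8P r : r \in rels_Lambda8 -> is_relation r.
Proof.
move=> r_rel v; apply/eqP; move: r r_rel; apply/allP.
by rewrite /= !triv_coefE !(mulr0, mul0r, expr0n, subr0) eqxx.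
Qed.

Definition Lambda8' : algType K := bound_quiver_alg (BoundQuiver rels_Lambda8P).
End Lambda8.

(* Main.v *)
(* Each of the algebras has a basis of paths in which a product of two basis
   elements is again a basis element or zero.  Over any field, the bimodule
   resolution starting with the vertices, the arrows and the relations is exact
   up to the first syzygies among the relations: there is a contracting homotopy
   with integer coefficients, linear on the left, so that exactness amounts to
   finitely many identities between integer combinations of tensors of basis
   elements.  Comparing this resolution with the standard free one, the groups
   [HH 0], [HH 1] and [HH 2] are the cohomology of a complex of small matrices
   with integer entries, independent of the field.  Their elementary divisors
   are 1 and 2, whence the distinction of characteristic 2. *)
From HB Require Import structures.
From mathcomp Require Import all_boot all_algebra.
From mathcomp Require Import finmap monalg.
From mathcomp Require Import boolp.
Require Import Defs.

Set Implicit Arguments.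
Unset Strict Implicit.
Unset Printing Implicit Defensive.

Import GRing.Theory.
Local Open Scope ring_scope.

(** * Comparison of projective resolutions *)

(** As the field is arbitrary, all computations are made on indices of basis elements and on
    integers, an index beyond the basis standing for zero; soundness lemmas carry them over to the
    algebra. The projective bimodules A s (x) t A are not free, so they are realised as the rows
    fixed by a diagonal idempotent matrix over A^e; differentials become matrices and cochains
    become columns. The contracting homotopy can be linear on one side only: an A^e-linear one would
    make A a projective bimodule and annihilate all higher cohomology. No rank is computed. A
    dimension follows from an identity kappa = D X + Y D + Z Theta between tabulated maps. Over the
    integers with kappa = 2 it serves all characteristics other than 2 at once; modulo 2 with kappa
    = 1 it serves characteristic 2. The divisor 2 has the same origin in all five algebras: an arrow
    occurring twice in one side of a relation is sent to a longer path, and the relation changes by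
    twice a nonzero path. In characteristic 2 this gives one more derivation, and one more class in
    degree 2 that is no longer a coboundary. *)

Lemma has_dim_quotmod (K : fieldType) (V : lmodType K) (W : submodule V)
    (d : nat) (theta : {linear V -> 'rV[K]_d}) :
  (forall x, theta x = 0 <-> x \in W) -> (forall y, exists x, theta x = y) ->
  has_dim (quotmod W) d.
Proof.
move=> kerE surj.
have thetaE x : theta (quotmod_repr (quotmod_pi W x)) = theta x.
  apply/eqP; rewrite -subr_eq0 -linearB; apply/eqP/kerE/quotmod_eq.
  by rewrite quotmod_piK.
have piE (q : quotmod W) : quotmod_pi W (quotmod_repr q) = q by exact: quotmod_piK.
exists (fun q => theta (quotmod_repr q)).
  move=> a x y; rewrite -{1}(piE x) -{1}(piE y).
  by rewrite -linearP thetaE linearP.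
have [sec secP] := choice surj.
exists (fun y => quotmod_pi W (sec y)) => [q|y]; last by rewrite thetaE secP.
rewrite -[RHS]piE; apply/quotmod_eq/kerE.
by rewrite linearB /= secP subrr.
Qed.

Section Corestriction.
Context (R : pzRingType) (P U V : lmodType R) (q : {linear U -> V})
  (u : {linear P -> U}) (qu0 : forall x, q (u x) = 0).

Fact corestr_subproof x : u x \in ker_pred q.
Proof. by rewrite ker_predE qu0. Qed.

(** Projectivity is stated for surjections only; corestriction to a kernel turns exactness in the
    middle into a surjection. *)
Definition corestr x : kernel q := Kernel (corestr_subproof x).

Fact corestr_linear : linear corestr.
Proof. by move=> a x y; apply: val_inj; rewrite /= linearP. Qed.
HB.instance Definition _ :=
  GRing.isLinear.Build R P (kernel q) *:%R corestr corestr_linear.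

End Corestriction.

Lemma projective_lift (R : nzRingType) (P W U V : lmodType R)
    (p : {linear W -> U}) (q : {linear U -> V}) (u : {linear P -> U}) :
  projective P -> (forall w, q (p w) = 0) ->
  (forall x, q x = 0 -> exists w, p w = x) ->
  (forall x, q (u x) = 0) ->
  exists h : {linear P -> W}, forall x, p (h x) = u x.
Proof.
move=> Pproj qp0 ex qu0.
have surj (v : kernel q) : exists w, corestr qp0 w = v.
  have [w pw] := ex _ (ker_valP v).
  by exists w; apply: val_inj.
have [h hP] := Pproj _ _ (corestr qp0) (corestr qu0) surj.
by exists h => x; have /(congr1 val) := hP x.
Qed.

Section Comparison.
Context (R : nzRingType).

(* [C 0] is the resolved module, so that [C n.+1] is the n-th term of the
   resolution. *)
Record aug_complex := AugComplex {
  aug_mod :> nat -> lmodType R;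
  aug_diff : forall n, {linear aug_mod n.+1 -> aug_mod n};
  aug_diffK : forall n x, aug_diff n (aug_diff n.+1 x) = 0;
  aug_proj : forall n, projective (aug_mod n.+1) }.

(** Exactness at [C 0], ..., [C N] and no further: the certified resolutions break off after
    finitely many terms. *)
Definition exact_below (C : aug_complex) (N : nat) : Prop :=
  (forall m : C 0, exists x, aug_diff C 0 x = m) /\
  (forall n, (n < N)%N -> forall x : C n.+1, aug_diff C n x = 0 ->
     exists y, aug_diff C n.+1 y = x).

Definition aug_cycle (C : aug_complex) n : C n -> Prop :=
  match n with
  | 0 => fun _ => True
  | m.+1 => fun x => aug_diff C m x = 0
  end.

Lemma aug_lift (Y : aug_complex) N n (P : lmodType R) (u : {linear P -> Y n}) :
  exact_below Y N -> (n <= N)%N -> projective P ->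
  (forall x, aug_cycle (u x)) ->
  exists h : {linear P -> Y n.+1}, forall x, aug_diff Y n (h x) = u x.
Proof.
move=> [surj ex] + Pproj; case: n u => [|n] u n_N uZ; first exact: Pproj.
by apply: projective_lift uZ => // [w|]; [exact: aug_diffK | exact: ex].
Qed.

Lemma aug_chain_map (X Y : aug_complex) N (f0 : {linear X 0 -> Y 0}) :
  exact_below Y N ->
  exists f : forall n, {linear X n -> Y n}, f 0 = f0 /\
    forall n, (n <= N)%N -> forall x,
      aug_diff Y n (f n.+1 x) = f n (aug_diff X n x).
Proof.
move=> exY.
(* The lift exists only in the exact range and over a commuting square. Stated as an implication,
   with the zero map as the other case, the step is total and can be iterated by choice; that the
   premises hold is proved afterwards by induction. *)
have step n (g : {linear X n -> Y n}) : exists g' : {linear X n.+1 -> Y n.+1},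
    (n <= N)%N -> (forall x, aug_cycle (g (aug_diff X n x))) ->
    forall x, aug_diff Y n (g' x) = g (aug_diff X n x).
  have [[n_N gZ]|no] := EM ((n <= N)%N /\
      forall x, aug_cycle (g (aug_diff X n x))); last first.
    by exists (\0 : {linear _ -> _}) => n_N gZ; case: no.
  have [h hP] := aug_lift (u := g \o aug_diff X n) exY n_N (@aug_proj X n) gZ.
  by exists h.
pose f := fix f n : {linear X n -> Y n} :=
  if n is n'.+1 then sval (cid (step n' (f n'))) else f0.
exists f; split=> // n n_N x.
suff fZ: forall x, aug_cycle (f n (aug_diff X n x)).
  by rewrite [f n.+1]/=; case: cid => h /= ->.
elim: n n_N {x} => [//|n IHn] n_N x.
rewrite [f n.+1]/=; case: cid => h /= -> //; last exact/IHn/ltnW.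
  by rewrite aug_diffK linear0.
exact: ltnW.
Qed.

(** The homotopy can start with [h 0 = 0] because [f 0 = 0]. In degree 0, where only the zero
    cochain is a coboundary, this makes homotopic maps agree on cocycles. *)
Lemma aug_homotopy (X Y : aug_complex) N (f : forall n, {linear X n -> Y n}) :
  exact_below Y N -> (forall x, f 0 x = 0) ->
  (forall n, (n <= N)%N -> forall x,
     aug_diff Y n (f n.+1 x) = f n (aug_diff X n x)) ->
  exists h : forall n, {linear X n -> Y n.+1}, (forall x, h 0 x = 0) /\
    forall n, (n < N)%N -> forall x,
      f n.+1 x = aug_diff Y n.+1 (h n.+1 x) + h n (aug_diff X n x).
Proof.
move=> exY f0 fd.
have step n (g : {linear X n -> Y n.+1}) :
    exists g' : {linear X n.+1 -> Y n.+2},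
    (n < N)%N ->
    (forall x, aug_diff Y n (g (aug_diff X n x)) = f n (aug_diff X n x)) ->
    forall x, aug_diff Y n.+1 (g' x) = f n.+1 x - g (aug_diff X n x).
  have [[n_N gZ]|no] := EM ((n < N)%N /\
      forall x, aug_diff Y n (g (aug_diff X n x)) = f n (aug_diff X n x));
    last by exists (\0 : {linear _ -> _}) => n_N gZ; case: no.
  have [|h hP] := aug_lift (u := f n.+1 \- (g \o aug_diff X n))
    exY n_N (@aug_proj X n).
    by move=> x /=; rewrite linearB /= gZ fd ?subrr // ltnW.
  by exists h.
pose h := fix h n : {linear X n -> Y n.+1} :=
  if n is n'.+1 then sval (cid (step n' (h n'))) else \0.
exists h; split=> // n n_N x.
suff hP: forall x, aug_diff Y n (h n (aug_diff X n x)) = f n (aug_diff X n x).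
  by rewrite [h n.+1]/=; case: cid => g /= ->; rewrite ?subrK.
elim: n n_N {x} => [_ x|n IHn n_N x]; first by rewrite f0 linear0.
rewrite [h n.+1]/=; case: cid => g /= -> //; [|exact: ltnW|exact/IHn/ltnW].
by rewrite aug_diffK linear0 subr0.
Qed.

End Comparison.

Section AugmentedResolution.
Context (R : nzRingType) (M : lmodType R) (P : proj_resolution M).

Definition res_aug_mod n : lmodType R := if n is m.+1 then P m else M.

Definition res_aug_diff n : {linear res_aug_mod n.+1 -> res_aug_mod n} :=
  match n with 0 => res_aug P | m.+1 => res_diff P m end.

Fact res_aug_diffK n x : res_aug_diff n (res_aug_diff n.+1 x) = 0.
Proof.
case: n x => [|n] x /=; first by apply/res_exact0; exists x.
by apply/res_exact; exists x.
Qed.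

Definition res_aug_complex : aug_complex R :=
  AugComplex res_aug_diffK (@res_proj _ _ P).

Lemma res_aug_exact N : exact_below res_aug_complex N.
Proof.
split=> [m|[|n] _ x /= x0]; first exact: res_aug_surj.
  exact/res_exact0.
exact/res_exact.
Qed.

End AugmentedResolution.

(** * Ext computed from a truncated projective resolution *)

Section HomTheory.
Context (K : fieldType) (R : algType K) (U N : lmodType R).

Lemma hom_ext (f g : hom U N) : (forall x, f x = g x) -> f = g.
Proof. by move=> fg; apply: val_inj; apply/funext. Qed.

Lemma hom0 (f : hom U N) : f 0 = 0.
Proof.
by have := hom_linear f (-1) 0 0; rewrite scaler0 addr0 scaleN1r addNr.
Qed.

Lemma homD (f : hom U N) x y : f (x + y) = f x + f y.
Proof. by have := hom_linear f 1 x y; rewrite !scale1r. Qed.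

Lemma homB (f : hom U N) x y : f (x - y) = f x - f y.
Proof.
by rewrite addrC -scaleN1r [LHS]hom_linear scaleN1r addrC.
Qed.

End HomTheory.

Section AugmentedCohomology.
Context (K : fieldType) (R : algType K) (N : lmodType R) (Y : aug_complex R).

Definition aug_cocycle n (c : hom (Y n.+1) N) : Prop :=
  forall y, c (aug_diff Y n.+1 y) = 0.

Definition aug_coboundary n : hom (Y n.+1) N -> Prop :=
  match n return hom (Y n.+1) N -> Prop with
  | 0 => fun c => c = 0
  | m.+1 => fun c =>
      exists c' : hom (Y m.+1) N, hom_pre (aug_diff Y m.+1) c' = c
  end.

Lemma aug_coboundary_cocycle n (c : hom (Y n.+1) N) :
  aug_coboundary c -> aug_cocycle c.
Proof.
case: n c => [|m] c /=; first by move->.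
by case=> c' <- y /=; rewrite aug_diffK hom0.
Qed.

End AugmentedCohomology.

(** Chain maps in both directions lift the isomorphism of the resolved modules, and both composites
    are homotopic to the identity. The three clauses say that [f] maps cocycles to cocycles, is well
    defined and injective on classes, and is surjective on classes. The bound [n.+1] is what the
    cocycle condition requires, since it is tested on [X n.+2] and [Y n.+2]. *)
Lemma aug_cohomology_iso (K : fieldType) (R : algType K) (N : lmodType R)
    (X Y : aug_complex R) (n : nat)
    (i0 : {linear X 0 -> Y 0}) (j0 : {linear Y 0 -> X 0}) :
    cancel i0 j0 -> cancel j0 i0 ->
    exact_below X n.+1 -> exact_below Y n.+1 ->
  exists f : {linear Y n.+1 -> X n.+1},
  [/\ forall z : hom (X n.+1) N, aug_cocycle z -> aug_cocycle (hom_pre f z),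
      forall z : hom (X n.+1) N, aug_cocycle z ->
        aug_coboundary (hom_pre f z) <-> aug_coboundary z
    & forall c : hom (Y n.+1) N, aug_cocycle c ->
        exists2 z : hom (X n.+1) N, aug_cocycle z &
          aug_coboundary (hom_pre f z - c)].
Proof.
move=> i0K j0K exX exY.
have [f [f0 fd]] := aug_chain_map j0 exX.
have [g [g0 gd]] := aug_chain_map i0 exY.
have [|m m_n x|h [h0 hd]] :=
    @aug_homotopy _ X X n.+1 (fun k => (f k \o g k) \- idfun) exX.
- by move=> x /=; rewrite f0 g0 i0K subrr.
- by rewrite /= linearB /= fd // gd.
have [|m m_n x|k [k0 kd]] :=
    @aug_homotopy _ Y Y n.+1 (fun k => (g k \o f k) \- idfun) exY.
- by move=> x /=; rewrite f0 g0 j0K subrr.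
- by rewrite /= linearB /= gd // fd.
have {}hd x := hd n (leqnn _) x; have {}kd x := kd n (leqnn _) x.
have fdS := fd _ (leqnn _); have {}fd := fd _ (leqnSn _).
have gdS := gd _ (leqnn _); have {}gd := gd _ (leqnSn _).
exists (f n.+1); split=> [z zZ y|z zZ|c cZ]; first by rewrite /= -fdS.
(* This is f g - 1 = d h + h d with the term z d h dropped, as z is a cocycle. *)
- have zE x : z x = z (f n.+1 (g n.+1 x)) - z (h n (aug_diff X n x)).
    rewrite -[z (h _ _)]add0r -(zZ (h n.+1 x)) -homD -hd /= homB.
    by rewrite subKr.
  split=> [|zB].
    case: n z zE hd fd gd {zZ fdS gdS kd exX exY} => [|m] z zE hd fd gd /=.
      move=> zf; apply: hom_ext => x; rewrite zE h0 hom0 subr0.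
      by have /(congr1 (fun c => hom_val c (g 1 x))) := zf.
    case=> c' cE.
    (* If z f = c' d, then [zE] reads z = (c' g - z h) d. *)
    exists (hom_pre (g m.+1) c' - hom_pre (h m.+1) z); apply: hom_ext => x.
    rewrite zE -[LHS]/(c' (g _ (aug_diff X _ x)) - z _) -gd; congr (_ - _).
    by have /(congr1 (fun c => hom_val c (g m.+2 x))) := cE.
  case: n z zB fd gd {zZ zE fdS gdS hd kd exX exY} => [|m] z /=.
    by move=> -> _ _; apply: hom_ext.
  case=> z' <- fd gd; exists (hom_pre (f m.+1) z'); apply: hom_ext => x /=.
  by rewrite fd.
(* The other homotopy, g f - 1 = d k + k d, shows that c g f - c = (c k) d for a cocycle c. *)
- exists (hom_pre (g n.+1) c) => [x|] /=; first by rewrite -gdS.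
  have cE x : c (g n.+1 (f n.+1 x)) - c x = c (k n (aug_diff Y n x)).
    by rewrite -homB [_ - _]kd homD cZ add0r.
  case: n c cE {cZ fd gd fdS gdS hd kd exX exY} => [|m] c cE /=.
    by apply: hom_ext => x; rewrite -[LHS]/(c _ - c _) cE k0 hom0.
  exists (hom_pre (k m.+1) c); apply: hom_ext => x.
  by rewrite -[RHS]/(c _ - c _) cE.
Qed.

Section ExtDimension.
Context (K : fieldType) (R : algType K) (M N : lmodType R).
Context (P : proj_resolution M) (Y : aug_complex R) (n : nat).
Context (i0 : {linear M -> Y 0}) (j0 : {linear Y 0 -> M}).

Lemma has_dim_ext_of (d : nat) (theta : {linear hom (Y n.+1) N -> 'rV[K]_d}) :
  cancel i0 j0 -> cancel j0 i0 -> exact_below Y n.+1 ->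
  (forall c : hom (Y n.+1) N,
     aug_cocycle c -> theta c = 0 <-> aug_coboundary c) ->
  (forall y, exists2 c : hom (Y n.+1) N, aug_cocycle c & theta c = y) ->
  has_dim (ext_of P N n) d.
Proof.
move=> i0K j0K exY thetaP theta_surj.
pose X := res_aug_complex P.
have [f [fZ fB f_surj]] := aug_cohomology_iso (X := X) N i0K j0K
  (@res_aug_exact _ _ P n.+1) exY.
pose hd m : {linear hom (P m) N -> hom (P m.+1) N} := hom_pre (res_diff P m).
pose th : {linear kernel (hd n) -> 'rV[K]_d} :=
  theta \o ((hom_pre f : {linear hom (P n) N -> hom (Y n.+1) N}) \o
    @ker_val _ _ _ (hd n)).
have zX (z : kernel (hd n)) : aug_cocycle (Y := X) (ker_val z : hom (X n.+1) N).
  by move=> x; have /(congr1 (fun c => hom_val c x)) := ker_valP z.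
have cobE (z : hom (P n) N) : aug_coboundary (Y := X) (n := n) z <->
    coboundary hd z.
  by case: (n) z.
apply: (has_dim_quotmod (theta := th)) => [z|y].
  rewrite (thetaP _ (fZ _ (zX z))) (fB _ (zX z)) cobE.
  by split=> [?|/asboolP//]; apply/asboolP.
have [c cZ <-] := theta_surj y; have [z zZ cobz] := f_surj c cZ.
have z_ker : z \in ker_pred (hd n).
  by rewrite ker_predE; apply/eqP/hom_ext => x; exact: zZ.
exists (Kernel z_ker); apply/eqP; rewrite /th /= -subr_eq0 -linearB; apply/eqP.
exact/thetaP/cobz/aug_coboundary_cocycle.
Qed.

End ExtDimension.

(** * Resolutions given by idempotent matrices *)

Section MatrixAction.
Context (R : nzRingType) (N : lmodType R).

(** A column of elements of [N] encodes a cochain, and precomposition with x |-> x D on rows becomes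
    this action of [D] on columns. *)
Definition mxact p q (D : 'M[R]_(p, q)) (c : 'I_q -> N) : 'I_p -> N :=
  fun i => \sum_j D i j *: c j.

Definition rowact q (c : 'I_q -> N) (x : 'rV[R]_q) : N := \sum_j x 0 j *: c j.

Fact rowact_linear q (c : 'I_q -> N) : linear (rowact c).
Proof.
move=> a x y; rewrite /rowact scaler_sumr -big_split /=; apply: eq_bigr => j _.
by rewrite !mxE scalerDl scalerA.
Qed.
HB.instance Definition _ q (c : 'I_q -> N) :=
  GRing.isLinear.Build R 'rV[R]_q N *:%R (rowact c) (rowact_linear c).

Lemma rowact_row p q (D : 'M[R]_(p, q)) c i : rowact c (row i D) = mxact D c i.
Proof. by apply: eq_bigr => j _; rewrite mxE. Qed.

Lemma rowact_mulmx p q (D : 'M[R]_(p, q)) c x :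
  rowact c (x *m D) = rowact (mxact D c) x.
Proof.
rewrite /rowact (eq_bigr (fun j => \sum_i x 0 i *: (D i j *: c j))).
  by rewrite exchange_big; apply: eq_bigr => i _; rewrite scaler_sumr.
by move=> j _; rewrite mxE scaler_suml; apply: eq_bigr => i _; rewrite scalerA.
Qed.

Lemma mxact_mulmx p q r (D : 'M[R]_(p, q)) (D' : 'M[R]_(q, r)) c i :
  mxact (D *m D') c i = mxact D (mxact D' c) i.
Proof. by rewrite -!rowact_row row_mul rowact_mulmx. Qed.

End MatrixAction.

Section IdempotentModule.
Context (R : nzRingType) (m : nat) (E : 'M[R]_m).

Definition idem_defect : {linear 'rV[R]_m -> 'rV[R]_m} := idfun \- mulmxr E.

(** For idempotent [E] this is a direct summand of a free module; a diagonal [E] with entries t (x)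
    s gives the sum of the bimodules A s (x) t A. *)
Definition idem_mod : lmodType R := kernel idem_defect.

Lemma idem_modP (x : idem_mod) : ker_val x *m E = ker_val x.
Proof. by apply/esym/eqP; rewrite -subr_eq0; apply/eqP; exact: ker_valP x. Qed.

Fact idem_elt_subproof x : x *m E = x -> x \in ker_pred idem_defect.
Proof. by move=> xE; rewrite ker_predE /= xE subrr. Qed.

Definition idem_elt x (xE : x *m E = x) : idem_mod :=
  Kernel (idem_elt_subproof xE).

Hypothesis EE : E *m E = E.

Lemma row_idem i : row i E *m E = row i E.
Proof. by rewrite -row_mul EE. Qed.

Definition idem_gen i : idem_mod := idem_elt (row_idem i).

Lemma idem_mod_gen (x : idem_mod) : x = \sum_i ker_val x 0 i *: idem_gen i.
Proof.
apply: val_inj; rewrite linear_sum /= -[LHS]idem_modP mulmx_sum_row.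
by apply: eq_bigr.
Qed.

Lemma idem_mod_proj : projective idem_mod.
Proof.
move=> U V g f g_surj.
have [u uP] := choice (fun i => g_surj (f (idem_gen i))).
exists (rowact u \o @ker_val _ _ _ idem_defect : {linear idem_mod -> U}) => x /=.
rewrite /rowact linear_sum [in RHS](idem_mod_gen x) linear_sum /=.
by apply: eq_bigr => i _; rewrite !linearZ /= uP.
Qed.

End IdempotentModule.

Section IdempotentMap.
Context (R : nzRingType) (p q : nat).
Context (E : 'M[R]_p) (E' : 'M[R]_q) (D : 'M[R]_(p, q)) (DE : D *m E' = D).

Fact idem_map_subproof (x : idem_mod E) : ker_val x *m D *m E' = ker_val x *m D.
Proof. by rewrite -mulmxA DE. Qed.

Definition idem_map (x : idem_mod E) : idem_mod E' :=
  idem_elt (idem_map_subproof x).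

Fact idem_map_linear : linear idem_map.
Proof. by move=> a x y; apply: val_inj; rewrite /= mulmxDl scalemxAl. Qed.
HB.instance Definition _ := GRing.isLinear.Build R (idem_mod E) (idem_mod E')
  *:%R idem_map idem_map_linear.

End IdempotentMap.
Arguments idem_map {R p q} E {E' D} DE x.

Section IdempotentHom.
Context (K : fieldType) (R : algType K) (N : lmodType R) (m : nat).
Context (E : 'M[R]_m) (EE : E *m E = E).

Definition hom_col (f : hom (idem_mod E) N) : 'I_m -> N :=
  fun i => f (idem_gen EE i).

(** A homomorphism is determined by its values on the rows of [E], because x = x E. Thus the
    homomorphisms out of [idem_mod E] correspond to the columns fixed by [E]. *)
Lemma hom_colE (f : hom (idem_mod E) N) (x : idem_mod E) :
  f x = rowact (hom_col f) (ker_val x) :> N.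
Proof.
rewrite [in LHS](idem_mod_gen EE x) /rowact.
elim/big_rec2: _ => [|i u y _ <-]; first exact: hom0.
by rewrite homD -(hom_linear f) -[X in f (X + _)]addr0 -homD addr0.
Qed.

Lemma hom_col_idem (f : hom (idem_mod E) N) i : mxact E (hom_col f) i = hom_col f i.
Proof. by rewrite [RHS]hom_colE /= rowact_row. Qed.

Fact col_hom_subproof (c : 'I_m -> N) :
  (fun x : idem_mod E => rowact c (ker_val x)) \in @hom_pred K R (idem_mod E) N.
Proof. by apply/asboolP => a x y; rewrite !linearP. Qed.

Definition col_hom (c : 'I_m -> N) : hom (idem_mod E) N :=
  Hom (col_hom_subproof c).

Lemma col_homK (c : 'I_m -> N) i : mxact E c i = c i -> hom_col (col_hom c) i = c i.
Proof. by move=> cE; rewrite /hom_col /= rowact_row. Qed.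

End IdempotentHom.

Section MatrixResolution.
Context (K : fieldType) (R : algType K) (M N : lmodType R) (m : nat -> nat).
Context (E : forall n, 'M[R]_(m n)) (D : forall n, 'M[R]_(m n.+1, m n)).
Context (eps : 'I_(m 0) -> M).
Hypothesis EE : forall n, E n *m E n = E n.
Hypothesis ED : forall n, E n.+1 *m D n = D n.
Hypothesis DE : forall n, D n *m E n = D n.
Hypothesis DD : forall n, D n.+1 *m D n = 0.
Hypothesis Eeps : forall i, mxact (E 0) eps i = eps i.
Hypothesis Deps : forall i, mxact (D 0) eps i = 0.

Definition mxres_mod n : lmodType R :=
  if n is k.+1 then idem_mod (E k) else M.

Definition mxres_aug : {linear idem_mod (E 0) -> M} :=
  rowact eps \o @ker_val _ _ _ (idem_defect (E 0)).

Definition mxres_diff n : {linear mxres_mod n.+1 -> mxres_mod n} :=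
  match n return {linear mxres_mod n.+1 -> mxres_mod n} with
  | 0 => mxres_aug
  | k.+1 => idem_map (E k.+1) (DE k)
  end.

Fact mxres_diffK n x : mxres_diff n (mxres_diff n.+1 x) = 0.
Proof.
case: n x => [|n] x /=.
  by rewrite rowact_mulmx /rowact big1 // => i _; rewrite Deps scaler0.
by apply: val_inj; rewrite /= -mulmxA DD mulmx0.
Qed.

Definition mxres : aug_complex R :=
  AugComplex mxres_diffK (fun n => idem_mod_proj (EE n)).

Lemma mxres_exact b :
  (forall a, exists x, rowact eps x = a) ->
  (forall x, x *m E 0 = x -> rowact eps x = 0 ->
     exists y : 'rV_(m 1), y *m D 0 = x) ->
  (forall n, (n < b)%N -> forall x : 'rV_(m n.+1), x *m E n.+1 = x ->
     x *m D n = 0 -> exists y : 'rV_(m n.+2), y *m D n.+1 = x) ->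
  exact_below mxres b.+1.
Proof.
(* A preimage y need not be fixed by [E], but y E is, and it has the same image since E D = D.
   Exactness may therefore be checked with arbitrary rows. *)
have DP n (x : idem_mod (E n)) : (exists y : 'rV_(m n.+1), y *m D n = ker_val x) ->
    exists y, mxres_diff n.+1 y = x.
  case=> y yx; have yE : y *m E n.+1 *m E n.+1 = y *m E n.+1.
    by rewrite -mulmxA EE.
  by exists (idem_elt yE); apply: val_inj; rewrite /= -mulmxA ED.
move=> surj ex0 exS; split=> [a|[|n] n_b x x0].
- have [x <-] := surj a; have xE : x *m E 0 *m E 0 = x *m E 0.
    by rewrite -mulmxA EE.
  exists (idem_elt xE); rewrite /= rowact_mulmx /rowact.
  by apply: eq_bigr => i _; rewrite Eeps.
- by apply/DP/ex0; [exact: idem_modP | exact: x0].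
- apply/DP/exS => //; first exact: idem_modP.
  exact: (congr1 (@ker_val _ _ _ _) x0).
Qed.

Definition mx_coboundary k : ('I_(m k) -> N) -> Prop :=
  match k return ('I_(m k) -> N) -> Prop with
  | 0 => fun c => forall i, c i = 0
  | l.+1 => fun c => exists2 c', forall i, mxact (E l) c' i = c' i &
                      forall i, mxact (D l) c' i = c i
  end.

Lemma mxact_hom_col n (f : hom (mxres n.+1) N) i :
  mxact (D n) (hom_col (EE n) f) i =
  f (idem_map (E n.+1) (DE n) (idem_gen (EE n.+1) i)).
Proof.
by rewrite [RHS](hom_colE (EE n)) /= rowact_mulmx rowact_row -mxact_mulmx ED.
Qed.

Lemma mxres_cocycle n (f : hom (mxres n.+1) N) :
  aug_cocycle f <-> forall i, mxact (D n) (hom_col (EE n) f) i = 0.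
Proof.
split=> [fZ i|fZ y]; first by rewrite mxact_hom_col; exact: fZ.
rewrite [LHS](hom_colE (EE n)) /= rowact_mulmx.
by rewrite /rowact big1 // => i _; rewrite fZ scaler0.
Qed.

Lemma mxres_coboundary n (f : hom (mxres n.+1) N) :
  aug_coboundary f <-> mx_coboundary (hom_col (EE n) f).
Proof.
case: n f => [|n] f /=.
  split=> [-> //|f0]; apply: hom_ext => x; rewrite [LHS](hom_colE (EE 0)).
  by rewrite /rowact big1 // => i _; rewrite f0 scaler0.
split=> [[f' <-]|[c' cE cD]].
  exists (hom_col (EE n) f') => i; first exact: hom_col_idem.
  by rewrite mxact_hom_col.
exists (col_hom (E n) c'); apply: hom_ext => x /=.
rewrite [RHS](hom_colE (EE n.+1)) rowact_mulmx.
by apply: eq_bigr => i _; rewrite cD.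
Qed.

(** Here [theta] lives on plain columns, so that certificates need not mention the type of
    homomorphisms; [k%:A] is the action of the base field on a module over [R]. *)
Lemma has_dim_mxres (n d : nat) (theta : ('I_(m n) -> N) -> 'rV[K]_d)
    (P : proj_resolution M) :
  (forall k c c',
     theta (fun i => k%:A *: c i + c' i) = k *: theta c + theta c') ->
  exact_below mxres n.+1 ->
  (forall c : 'I_(m n) -> N, (forall i, mxact (E n) c i = c i) ->
     (forall i, mxact (D n) c i = 0) -> theta c = 0 <-> mx_coboundary c) ->
  (forall y, exists2 c : 'I_(m n) -> N,
     (forall i, mxact (E n) c i = c i) /\ (forall i, mxact (D n) c i = 0) &
     theta c = y) ->
  has_dim (ext_of P N n) d.
Proof.
move=> theta_linear ex thetaP theta_surj.
pose th (f : hom (mxres n.+1) N) : 'rV[K]_d := theta (hom_col (EE n) f).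
have th_lin : linear th by move=> k f g; rewrite /th -theta_linear.
pose th_ := GRing.isLinear.Build K (hom (mxres n.+1) N) 'rV[K]_d *:%R th th_lin.
pose thL : {linear hom (mxres n.+1) N -> 'rV[K]_d} := HB.pack th th_.
apply: (@has_dim_ext_of K R M N P mxres n idfun idfun d thL) => //.
  move=> c /mxres_cocycle cZ; rewrite mxres_coboundary; apply: thetaP => // i.
  exact: hom_col_idem.
move=> y; have [c [cE cZ] <-] := theta_surj y.
have colK : hom_col (EE n) (col_hom (E n) c) = c.
  by apply/funext => i; exact: col_homK.
exists (col_hom (E n) c); last by rewrite /= /th colK.
by apply/mxres_cocycle => i; rewrite colK.
Qed.

End MatrixResolution.

(** * Coordinates on the enveloping algebra *)

Section EnvelopingTensors.
Context (K : fieldType) (A : algType K).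
Implicit Types (a b : A).

Lemma envalg_ind (Pr : envalg A -> Prop) :
  (forall c f g, Pr f -> Pr g -> Pr (c *: f + g)) ->
  (forall a b, Pr (env_tensor a b)) -> Pr 0 -> forall z, Pr z.
Proof.
move=> PD PT P0 z; rewrite -(quotalg_piK z).
elim/catalg_ind: (quotalg_repr z) => [c f g IHf IHg|[a b]|].
- by rewrite linearP; exact: PD.
- exact: PT.
- by rewrite linear0.
Qed.

Lemma env_tensorM a b a' b' :
  env_tensor a b * env_tensor a' b' = env_tensor (a' * a) (b * b').
Proof. by rewrite /env_tensor -rmorphM /= env_pairM. Qed.

Lemma env_tensor11 : env_tensor 1 1 = 1 :> envalg A.
Proof.
rewrite -[RHS](rmorph1 (quotalg_pi (env_ideal2 A))) /env_tensor.
by rewrite catalg1E big_seq1.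
Qed.

Fact env_tensor_rel (z z' : env_pairs A) : env_rel (z - z') ->
  quotalg_pi (env_ideal2 A) z = quotalg_pi (env_ideal2 A) z'.
Proof. by move=> rel; apply/quotalg_eq; exact: mem_gen_ideal. Qed.

Fact env_tensor_linearr a : linear (env_tensor a).
Proof.
move=> c b b'; rewrite /env_tensor (env_tensor_rel (EnvDr _ _ _)) linearD /=.
by rewrite (env_tensor_rel (EnvZr _ _ _)) linearZ.
Qed.
HB.instance Definition _ a := GRing.isLinear.Build K A (envalg A) *:%R
  (env_tensor a) (env_tensor_linearr a).

Lemma env_tensor_linearl b c a a' :
  env_tensor (c *: a + a') b = c *: env_tensor a b + env_tensor a' b.
Proof.
rewrite /env_tensor (env_tensor_rel (EnvDl _ _ _)) linearD /=.
by rewrite (env_tensor_rel (EnvZl _ _ _)) linearZ.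
Qed.

Lemma env_tensor0l b : env_tensor 0 b = 0.
Proof.
by have := env_tensor_linearl b (-1) 0 0; rewrite scaler0 addr0 scaleN1r addNr.
Qed.

Section Extension.
Context (V : lmodType K) (B : A -> A -> V).
Hypothesis Bl : forall b c a a', B (c *: a + a') b = c *: B a b + B a' b.
Hypothesis Br : forall a, linear (B a).

Let ext0 : {linear env_pairs A -> V} := lext (fun ab : A^c * A => B ab.1 ab.2).

(** The bilinearity relations generate a two-sided ideal, whereas [B] respects no multiplication.
    Hence the stronger claim that u z w is killed for all u and w: multiplying a bilinearity
    relation by pure tensors on both sides gives again a bilinearity relation, on which [B]
    vanishes. *)
Lemma env_ext_ideal z : z \in @env_ideal K A -> ext0 z = 0.
Proof.
have ext0E a b : ext0 (env_pair a b) = B a b by rewrite /ext0 /= lextU1.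
move=> /gen_idealP/(_ [pred z | `[< forall u w, ext0 (u * z * w) = 0 >]]) Hz.
suff: z \in [pred z | `[< forall u w, ext0 (u * z * w) = 0 >]].
  by move=> /asboolP/(_ 1 1); rewrite mul1r mulr1.
apply: Hz.
  split=> [|x y /asboolP Hx /asboolP Hy|a x /asboolP Hx|a x /asboolP Hx];
    apply/asboolP=> u w.
  - by rewrite mulr0 mul0r linear0.
  - by rewrite mulrBr mulrBl linearB /= Hx Hy subrr.
  - by rewrite (mulrA u) Hx.
  - by rewrite (mulrA u) -(mulrA _ a) Hx.
move=> r rel; apply/asboolP => u w.
elim/catalg_ind: u => [c f g IHf IHg|[p q]|]; last by rewrite !mul0r linear0.
  by rewrite !mulrDl -!scalerAl linearP /= IHf IHg scaler0 addr0.
elim/catalg_ind: w => [c f g IHf IHg|[p' q']|]; last by rewrite mulr0 linear0.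
  by rewrite mulrDr -scalerAr linearP /= IHf IHg scaler0 addr0.
rewrite -!/(env_pair _ _).
have BD a a' b : B (a + a') b = B a b + B a' b.
  by have := Bl b 1 a a'; rewrite !scale1r.
have B0 b : B 0 b = 0.
  by have := Bl b (-1) 0 0; rewrite scaler0 addr0 scaleN1r addNr.
have BZ c a b : B (c *: a) b = c *: B a b.
  by have := Bl b c a 0; rewrite !addr0 B0 addr0.
have BD' a b b' : B a (b + b') = B a b + B a b'.
  by have := Br a 1 b b'; rewrite !scale1r.
have B0' a : B a 0 = 0.
  by have := Br a (-1) 0 0; rewrite scaler0 addr0 scaleN1r addNr.
have BZ' c a b : B a (c *: b) = c *: B a b.
  by have := Br a c b 0; rewrite !addr0 B0' addr0.
case: rel => [a a' b|a b b'|c a b|c a b];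
  rewrite !(mulrBr, mulrBl, mulrDr, mulrDl) -?(scalerAl, scalerAr) -?scalerAl
    !env_pairM !(linearB, linearD) /= ?linearZ /= !ext0E;
  rewrite ?(mulrDr, mulrDl) -?(scalerAl, scalerAr) -?(scalerAl, scalerAr)
    ?(BD, BD', BZ, BZ') -?opprD ?scalerN subrr //.
Qed.

Definition env_ext (z : envalg A) : V := ext0 (quotalg_repr z).

Lemma env_ext_pi z : env_ext (quotalg_pi (env_ideal2 A) z) = ext0 z.
Proof.
apply/eqP; rewrite -subr_eq0 -linearB; apply/eqP/env_ext_ideal.
by apply/(@quotalg_eq _ _ (env_ideal2 A)); rewrite quotalg_piK.
Qed.

Fact env_ext_linear : linear env_ext.
Proof.
by move=> c x y; rewrite -(quotalg_piK x) -(quotalg_piK y) -linearP !env_ext_pi linearP.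
Qed.
HB.instance Definition _ :=
  GRing.isLinear.Build K (envalg A) V *:%R env_ext env_ext_linear.

Lemma env_ext_tensor a b : env_ext (env_tensor a b) = B a b.
Proof. by rewrite env_ext_pi /ext0 /= lextU1. Qed.

End Extension.
End EnvelopingTensors.

(** * Formal integer combinations and multiplicative bases *)

Definition fsum (T : Type) := seq (int * T).

Definition feval (T : Type) (V : zmodType) (F : T -> V) (l : fsum T) : V :=
  \sum_(t <- l) F t.2 *~ t.1.

Definition fscale (T : Type) (c : int) (l : fsum T) : fsum T :=
  [seq (c * t.1, t.2) | t <- l].

Definition fbind (T T' : Type) (l : fsum T) (f : T -> fsum T') : fsum T' :=
  flatten [seq fscale t.1 (f t.2) | t <- l].

Definition fcoef (T : eqType) (l : fsum T) (k : T) : int :=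
  foldr (fun t s => if t.2 == k then t.1 + s else s) 0 l.

(* Vanishing modulo [p] (over the integers if [p = 0]) of all coefficients,
   except at the keys that are not [live], which stand for zero. *)
Definition fnull (T : eqType) (p : nat) (live : pred T) (l : fsum T) : bool :=
  all (fun t => live t.2 ==> (p %| absz (fcoef l t.2))%N) l.

Definition assoc (T : eqType) (T' : Type) (x0 : T') (t : seq (T * T')) (x : T) : T' :=
  foldr (fun xy r => if xy.1 == x then xy.2 else r) x0 t.

Section FormalSums.
Context (T : Type) (V : zmodType).
Implicit Types (F : T -> V) (l : fsum T).

Lemma feval_nil F : feval F [::] = 0.
Proof. by rewrite /feval big_nil. Qed.

Lemma feval_cons F t l : feval F (t :: l) = F t.2 *~ t.1 + feval F l.
Proof. by rewrite /feval big_cons. Qed.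

Lemma feval1 F x : feval F [:: (1, x)] = F x.
Proof. by rewrite feval_cons feval_nil addr0. Qed.

Lemma feval_cat F l l' : feval F (l ++ l') = feval F l + feval F l'.
Proof. by rewrite /feval big_cat. Qed.

Lemma feval_scale F c l : feval F (fscale c l) = feval F l *~ c.
Proof.
elim: l => [|t l IHl]; first by rewrite !feval_nil mul0rz.
by rewrite /= !feval_cons IHl mulrzDl -mulrzA mulrC.
Qed.

Lemma feval_flatten F (s : seq (fsum T)) :
  feval F (flatten s) = \sum_(l <- s) feval F l.
Proof.
by elim: s => [|l s IHs]; rewrite ?feval_nil ?big_nil //= feval_cat big_cons IHs.
Qed.

Lemma eq_feval F F' l : F =1 F' -> feval F l = feval F' l.
Proof. by move=> FF'; apply: eq_bigr => t _; rewrite FF'. Qed.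

Lemma raddf_feval (W : zmodType) (phi : {additive V -> W}) F l :
  phi (feval F l) = feval (phi \o F) l.
Proof. by rewrite raddf_sum; apply: eq_bigr => t _; rewrite raddfMz. Qed.

End FormalSums.

Lemma feval_bind (T T' : Type) (V : zmodType) (F : T -> V) (l : fsum T') f :
  feval F (fbind l f) = feval (fun x => feval F (f x)) l.
Proof.
elim: l => [|t l IHl]; first by rewrite /fbind /= !feval_nil.
by rewrite /fbind /= feval_cat feval_scale feval_cons -IHl.
Qed.

(** After grouping by key, each coefficient is a multiple of p or belongs to a key with value zero.
    For p = 0 the first hypothesis is void and divisibility by p means being zero, so identities
    over the integers and modulo 2 share this lemma. *)
Lemma fnullP (T : eqType) (V : zmodType) (F : T -> V) p (live : pred T) l :
  (forall v : V, v *+ p = 0) -> (forall k, ~~ live k -> F k = 0) ->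
  fnull p live l -> feval F l = 0.
Proof.
move=> Vp Fdead /allP nul.
have coefE k : \sum_(t <- l | t.2 == k) t.1 = fcoef l k.
  elim: (l) => [|t r IHr]; first by rewrite big_nil.
  by rewrite big_cons /= IHr.
have -> : feval F l = \sum_(k <- undup [seq t.2 | t <- l]) F k *~ fcoef l k.
  rewrite /feval (eq_big_seq (fun t =>
      \sum_(k <- undup [seq t.2 | t <- l] | t.2 == k) F k *~ t.1)).
    rewrite (exchange_big_dep xpredT) //=; apply: eq_bigr => k _.
    by rewrite -coefE mulrz_sumr.
  move=> t tl; rewrite big_mkcond.
  rewrite (bigD1_seq t.2) ?undup_uniq ?mem_undup ?map_f //= eqxx.
  by rewrite big1 ?addr0 // => k /negPf; rewrite eq_sym => ->.
rewrite big1_seq // => k /andP[_]; rewrite mem_undup => /mapP[t tl ->].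
have [tlive|/Fdead->] := boolP (live t.2); last by rewrite mul0rz.
have /implyP/(_ tlive) p_dvd := nul t tl.
have /dvdzP[q ->] : (p %| fcoef l t.2)%Z by rewrite dvdzE.
by rewrite mulrC mulrzA -pmulrn Vp mul0rz.
Qed.

(* A basis [b 0, ..., b n.-1] closed under multiplication up to zero; indices
   [i >= n] all stand for zero. *)
Record mult_basis (K : fieldType) (A : algType K) (n : nat)
    (mul : nat -> nat -> nat) (ids : seq nat) := MultBasis {
  mb_elt :> nat -> A;
  mb_coord : {linear A -> 'rV[K]_n};
  mb_dead : forall i, (n <= i)%N -> mb_elt i = 0;
  mb_mul : forall i j, mb_elt i * mb_elt j = mb_elt (mul i j);
  mb_sum : forall a, a = \sum_(i < n) mb_coord a 0 i *: mb_elt i;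
  mb_coordE : forall i, mb_coord (mb_elt i) = \row_j (j == i :> nat)%:R;
  mb_one : 1 = \sum_(v <- ids) mb_elt v }.

(* [(g, (k, l))] is the tensor [b k (x) b l] of the enveloping algebra placed
   in the [g]-th coordinate of a row vector. *)
Definition bikey : Type := nat * (nat * nat).

Section RowVectors.
Context (K : fieldType) (A : algType K) (n : nat) (mul : nat -> nat -> nat).
Context (ids : seq nat) (b : mult_basis A n mul ids).
Local Notation R := (envalg A).

Definition bi_tensor (k l : nat) : R := env_tensor (b k) (b l).

Definition nat_delta (V : pzRingType) m (g : nat) : 'rV[V]_m :=
  \row_j (j == g :> nat)%:R.

Definition bi_elt m (key : bikey) : 'rV[R]_m :=
  bi_tensor key.2.1 key.2.2 *: nat_delta R m key.1.

Definition bi_live (key : bikey) : bool := (key.2.1 < n)%N && (key.2.2 < n)%N.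

Lemma bi_elt_dead m key : ~~ bi_live key -> bi_elt m key = 0.
Proof.
rewrite negb_and -!leqNgt /bi_elt /bi_tensor => /orP[] /(mb_dead b) ->.
  by rewrite env_tensor0l scale0r.
by rewrite linear0 scale0r.
Qed.

Definition bi_val m (u : fsum bikey) : 'rV[R]_m := feval (bi_elt m) u.

(** Multiplication by [bi_tensor k l] from the left; the first tensor factor belongs to the opposite
    algebra, so there [k] is multiplied on the right. *)
Definition bi_act (k l : nat) (u : fsum bikey) : fsum bikey :=
  [seq (t.1, (t.2.1, (mul t.2.2.1 k, mul l t.2.2.2))) | t <- u].

Lemma bi_val_act m k l u :
  bi_val m (bi_act k l u) = bi_tensor k l *: bi_val m u.
Proof.
rewrite /bi_val /feval big_map scaler_sumr; apply: eq_bigr => t _ /=.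
rewrite -scalerMzr /bi_elt scalerA /bi_tensor env_tensorM.
by rewrite !(mb_mul b).
Qed.

Definition bi_lact (l : nat) (u : fsum bikey) : fsum bikey :=
  [seq (t.1, (t.2.1, (t.2.2.1, mul l t.2.2.2))) | t <- u].

Lemma bi_val_lact m l u :
  bi_val m (bi_lact l u) = env_tensor 1 (b l) *: bi_val m u.
Proof.
rewrite /bi_val /feval big_map scaler_sumr; apply: eq_bigr => t _ /=.
by rewrite -scalerMzr /bi_elt scalerA /bi_tensor env_tensorM mulr1 (mb_mul b).
Qed.

Definition bi_mx p q (D : seq (fsum bikey)) : 'M[R]_(p, q) :=
  \matrix_(i < p) bi_val q (nth [::] D i).

Definition bi_diff (D : seq (fsum bikey)) (key : bikey) : fsum bikey :=
  bi_act key.2.1 key.2.2 (nth [::] D key.1).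

Lemma nat_delta_mul p q g (D : seq (fsum bikey)) : (size D <= p)%N ->
  nat_delta R p g *m bi_mx p q D = bi_val q (nth [::] D g).
Proof.
move=> D_p; rewrite mulmx_sum_row.
have [g_p|p_g] := ltnP g p; last first.
  rewrite nth_default ?(leq_trans D_p) // [RHS]feval_nil big1 // => i _.
  by rewrite mxE ltn_eqF ?scale0r // (leq_trans (ltn_ord i)).
rewrite (bigD1 (Ordinal g_p)) //= mxE eqxx scale1r rowK big1 ?addr0 // => i.
by rewrite -val_eqE /= mxE => /negPf->; rewrite scale0r.
Qed.

Lemma bi_elt_mx p q D key : (size D <= p)%N ->
  bi_elt p key *m bi_mx p q D = bi_val q (bi_diff D key).
Proof.
by move=> D_p; rewrite -scalemxAl nat_delta_mul // -bi_val_act.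
Qed.

Lemma bi_val_mx p q D u : (size D <= p)%N ->
  bi_val p u *m bi_mx p q D = bi_val q (fbind u (bi_diff D)).
Proof.
move=> D_p; rewrite /bi_val -[LHS]/(mulmxr _ _) raddf_feval feval_bind.
by apply: eq_feval => key; rewrite /= bi_elt_mx.
Qed.

(** A^e is free over its subalgebra 1 (x) A with basis the elements [b i] (x) 1; these are the
    coordinates. Acting by 1 (x) y is left multiplication by y on bimodules. *)
Definition left_coord (i : 'I_n) : R -> A :=
  env_ext (fun x y : A => mb_coord b x 0 i *: y).

Fact left_coord_subproof (i : 'I_n) :
  (forall (y : A) c x x', mb_coord b (c *: x + x') 0 i *: y =
     c *: (mb_coord b x 0 i *: y) + mb_coord b x' 0 i *: y) /\
  (forall x, linear (fun y : A => mb_coord b x 0 i *: y)).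
Proof.
split=> [y c x x'|x c y y']; first by rewrite linearP !mxE scalerDl scalerA.
by rewrite scalerDr !scalerA mulrC.
Qed.

HB.instance Definition _ i := GRing.isLinear.Build K R A *:%R (left_coord i)
  (env_ext_linear (left_coord_subproof i).1 (left_coord_subproof i).2).

Lemma left_coord_tensor i x y :
  left_coord i (env_tensor x y) = mb_coord b x 0 i *: y.
Proof. by case: (left_coord_subproof i) => *; exact: env_ext_tensor. Qed.

Lemma left_coord_act i y z :
  left_coord i (env_tensor 1 y * z) = y * left_coord i z.
Proof.
elim/envalg_ind: z => [c f g IHf IHg|x x'|]; last by rewrite !(linear0, mulr0).
  by rewrite mulrDr -scalerAr !linearP /= IHf IHg mulrDr -scalerAr.
by rewrite env_tensorM mulr1 !left_coord_tensor -scalerAr.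
Qed.

Lemma left_coord_sum z :
  z = \sum_(i < n) env_tensor 1 (left_coord i z) * env_tensor (b i) 1.
Proof.
elim/envalg_ind: z => [c f g IHf IHg|x y|].
- rewrite {1}IHf {1}IHg scaler_sumr -big_split /=; apply: eq_bigr => i _.
  by rewrite !linearP /= mulrDl -scalerAl.
- rewrite {1}[x](mb_sum b); elim/big_ind2: _ => [|u u' v v' <- <-|i _].
  + by rewrite env_tensor0l.
  + by have := env_tensor_linearl y 1 u' v'; rewrite !scale1r.
  + rewrite left_coord_tensor env_tensorM !mulr1 linearZ /=.
    by have := env_tensor_linearl y (mb_coord b x 0 i) (b i) 0;
      rewrite !addr0 env_tensor0l addr0.
- by rewrite big1 // => i _; rewrite !linear0 mul0r.
Qed.

(** The left A-linear map with value [S g i] at [b i] (x) 1 in coordinate [g]. It does not commute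
    with the action of all of A^e, so it is only declared additive. *)
Definition bi_lin m m' (S : nat -> nat -> 'rV[R]_m') (x : 'rV[R]_m) : 'rV[R]_m' :=
  \sum_(g < m) \sum_(i < n) env_tensor 1 (left_coord i (x 0 g)) *: S g i.

Fact bi_lin_zmod m m' S : zmod_morphism (@bi_lin m m' S).
Proof.
move=> x y; rewrite -sumrB; apply: eq_bigr => g _; rewrite -sumrB.
by apply: eq_bigr => i _; rewrite !mxE !linearB scalerBl.
Qed.
HB.instance Definition _ m m' S := GRing.isZmodMorphism.Build 'rV[R]_m 'rV[R]_m'
  (@bi_lin m m' S) (@bi_lin_zmod m m' S).

Lemma bi_linB m m' S x y :
  @bi_lin m m' S (x - y) = bi_lin S x - bi_lin S y.
Proof. exact: bi_lin_zmod. Qed.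

Lemma bi_lin_act m m' S y x :
  @bi_lin m m' S (env_tensor 1 y *: x) = env_tensor 1 y *: bi_lin S x.
Proof.
rewrite scaler_sumr; apply: eq_bigr => g _; rewrite scaler_sumr.
apply: eq_bigr => i _; rewrite mxE left_coord_act scalerA env_tensorM.
by rewrite mulr1.
Qed.

Lemma bi_lin_elt m m' S g k l : (forall i, (m <= g)%N -> S g i = 0) ->
  (forall i, (n <= i)%N -> S g i = 0) ->
  @bi_lin m m' S (bi_elt m (g, (k, l))) = env_tensor 1 (b l) *: S g k.
Proof.
move=> Sm Sn; rewrite /bi_lin.
have elt0 (h : 'I_m) i : env_tensor 1 (left_coord i (bi_elt m (g, (k, l)) 0 h)) =
    (if (h == g :> nat) && (i == k :> nat) then env_tensor 1 (b l) else 0).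
  rewrite /bi_elt !mxE /=; case: eqP => _; last by rewrite mulr0 !linear0.
  rewrite mulr1 left_coord_tensor mb_coordE mxE.
  by case: eqP => _; rewrite ?scale1r // scale0r linear0.
have [g_m|m_g] := ltnP g m; last first.
  rewrite Sm // scaler0 big1 // => h _; rewrite big1 // => i _.
  by rewrite elt0 ltn_eqF ?scale0r // (leq_trans (ltn_ord h)).
have [k_n|n_k] := ltnP k n; last first.
  rewrite Sn // scaler0 big1 // => h _; rewrite big1 // => i _.
  by rewrite elt0 (@ltn_eqF i) ?andbF ?scale0r // (leq_trans (ltn_ord i)).
rewrite (eq_bigr (fun h => if h == Ordinal g_m then
    env_tensor 1 (b l) *: S g k else 0)); first by rewrite -big_mkcond big_pred1_eq.
move=> h _; rewrite -val_eqE /=; case: eqP => [h_g|/eqP/negPf h_g]; last first.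
  by rewrite big1 // => i _; rewrite elt0 h_g scale0r.
rewrite (eq_bigr (fun i => if i == Ordinal k_n then
    env_tensor 1 (b l) *: S g k else 0)); first by rewrite -big_mkcond big_pred1_eq.
move=> i _; rewrite -val_eqE /= elt0 h_g eqxx /=.
by case: eqP => [->|_]; rewrite ?scale0r.
Qed.

(** For the summand A s (x) t A this is s (x) t [b i]. These elements generate the summand as a left
    A-module, which is the content of [bi_decomp]. *)
Definition bi_gen (ends : seq (nat * nat)) g i : bikey :=
  (g, (mul (nth (n, n) ends g).2 i, (nth (n, n) ends g).1)).

Definition bi_idem (ends : seq (nat * nat)) : seq (fsum bikey) :=
  [seq [:: (1, (g, ((nth (n, n) ends g).2, (nth (n, n) ends g).1)))]
  | g <- iota 0 (size ends)].

Lemma bi_decomp m (ends : seq (nat * nat)) (x : 'rV[R]_m) :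
  size ends = m -> x *m bi_mx m m (bi_idem ends) = x ->
  x = bi_lin (fun g i => bi_elt m (bi_gen ends g i)) x.
Proof.
move=> ends_m xE; rewrite -[LHS]xE mulmx_sum_row; apply: eq_bigr => g _.
rewrite rowK (nth_map 0%N) ?size_iota ?ends_m // nth_iota ?ends_m // add0n.
rewrite /bi_val feval1 [X in X *: _]left_coord_sum scaler_suml.
apply: eq_bigr => i _; rewrite /bi_elt /= !scalerA /bi_tensor -mulrA.
by rewrite env_tensorM mul1r (mb_mul b).
Qed.

End RowVectors.

(** * Certified exactness *)

(* The beginning of a bimodule resolution: [rd_ends] lists, in each degree, the
   pairs [(s, t)] of idempotents such that the resolution has a summand
   [A s (x) t A]; [rd_diff] gives the images of the generators [s (x) t] and
   [rd_htpy] the values [h (s (x) b k)] of a left [A]-linear contracting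
   homotopy. *)
Record res_data := ResData {
  rd_ends : seq (seq (nat * nat));
  rd_diff : seq (seq (fsum bikey));
  rd_htpy : seq (seq ((nat * nat) * fsum bikey)) }.

Section ResolutionCheck.
Context (n : nat) (mul : nat -> nat -> nat) (ids : seq nat) (rd : res_data).

Definition rd_gens k : seq (nat * nat) := nth [::] (rd_ends rd) k.
Definition rd_rows k : seq (fsum bikey) := nth [::] (rd_diff rd) k.
Definition rd_h k (key : bikey) : fsum bikey :=
  if (key.1 < size (rd_gens k))%N && (key.2.1 < n)%N then
    bi_lact mul key.2.2 (assoc [::] (nth [::] (rd_htpy rd) k) (key.1, key.2.1))
  else [::].

Definition bi_eqb (u v : fsum bikey) : bool :=
  fnull 0 (bi_live n) (u ++ fscale (-1) v).

Definition rd_aug (key : bikey) : nat :=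
  mul (mul key.2.2 (nth (n, n) (rd_gens 0) key.1).1) key.2.1.

(** The sum of e (x) e over the vertices, a preimage of 1. The contracting homotopy starts with the
    left linear map a |-> a [rd_unit]. *)
Definition rd_unit : fsum bikey := flatten (bi_idem n (rd_gens 0)).

Definition all_below (N : nat) (P : nat -> bool) := all P (iota 0 N).

(* The last clause is the homotopy identity [1 = h d + d h] on the elements
   [s (x) t (b i)], which generate each summand on the left. *)
Definition res_check : bool :=
  [&& (size (rd_ends rd) <= 4)%N, ids == [seq st.1 | st <- rd_gens 0],
      all (fun st => st.1 == st.2) (rd_gens 0),
      all_below 4 (fun k => all (fun st =>
        (mul st.1 st.1 == st.1) && (mul st.2 st.2 == st.2)) (rd_gens k)),
      all_below 3 (fun k =>
        (size (rd_rows k) <= size (rd_gens k.+1))%N &&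
        all_below (size (rd_gens k.+1)) (fun g =>
        let st := nth (n, n) (rd_gens k.+1) g in
        let row := nth [::] (rd_rows k) g in
        [&& bi_eqb (bi_act mul st.2 st.1 row) row,
            bi_eqb (fbind row (bi_diff mul (bi_idem n (rd_gens k)))) row &
            if k is k'.+1 then bi_eqb (fbind row (bi_diff mul (rd_rows k'))) [::]
            else fnull 0 (gtn n) [seq (t.1, rd_aug t.2) | t <- row]])) &
      all_below 3 (fun k => all_below (size (rd_gens k)) (fun g =>
        all_below n (fun i =>
          let key := bi_gen n mul (rd_gens k) g i in
          bi_eqb [:: (1, key)]
            ((if k is k'.+1 then
                fbind (bi_diff mul (rd_rows k') key) (rd_h k')
              else bi_lact mul (rd_aug key) rd_unit) ++
             fbind (rd_h k key) (bi_diff mul (rd_rows k))))))].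

Lemma all_belowP N (P : nat -> bool) :
  reflect (forall k, (k < N)%N -> P k) (all_below N P).
Proof.
apply: (iffP allP) => [H k k_N|H k]; first by apply: H; rewrite mem_iota.
by rewrite mem_iota; exact: H.
Qed.

End ResolutionCheck.

Section ResolutionSoundness.
Context (K : fieldType) (A : algType K) (n : nat) (mul : nat -> nat -> nat).
Context (ids : seq nat) (b : mult_basis A n mul ids) (rd : res_data).
Local Notation R := (envalg A).
Hypothesis rdP : res_check n mul ids rd.

Let m k := size (rd_gens rd k).
Definition rd_E k : 'M[R]_(m k) := bi_mx b (m k) (m k) (bi_idem n (rd_gens rd k)).
Definition rd_D k : 'M[R]_(m k.+1, m k) := bi_mx b (m k.+1) (m k) (rd_rows rd k).
Definition rd_eps (g : 'I_(m 0)) : envmod A := b (nth (n, n) (rd_gens rd 0) g).1.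

Lemma bi_eqbP q u v : bi_eqb n u v -> bi_val b q u = bi_val b q v.
Proof.
rewrite /bi_eqb => uv; have := fnullP (F := bi_elt b q) _ _ uv.
move=> /(_ (fun=> mulr0n _)) /(_ (@bi_elt_dead _ _ _ _ _ b q)).
rewrite feval_cat feval_scale mulrN1z => /eqP.
by rewrite subr_eq0 => /eqP.
Qed.

(** Beyond the tabulated degrees all modules are zero. This lets the matrix identities below hold in
    every degree, as [mxres] demands, though only finitely many are checked. *)
Lemma rd_gens_nil k : (4 <= k)%N -> m k = 0%N.
Proof.
have /and5P[ends4 _ _ _ _] := rdP => k4.
by rewrite /m /rd_gens nth_default // (leq_trans ends4).
Qed.

Lemma bi_idem_nth ends g : (g < size ends)%N ->
  nth [::] (bi_idem n ends) g =
  [:: (1, (g, ((nth (n, n) ends g).2, (nth (n, n) ends g).1)))].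
Proof. by move=> g_e; rewrite (nth_map 0%N) ?size_iota // nth_iota. Qed.

Lemma size_bi_idem ends : size (bi_idem n ends) = size ends.
Proof. by rewrite size_map size_iota. Qed.

Lemma rd_idem k g (st := nth (n, n) (rd_gens rd k) g) : (g < m k)%N ->
  mul st.1 st.1 = st.1 /\ mul st.2 st.2 = st.2.
Proof.
move=> g_m; have [k4|/rd_gens_nil m0] := ltnP k 4; last by rewrite m0 in g_m.
have [_ _ _ /andP[/all_belowP/(_ k k4)/allP/(_ st)]] := and4P rdP.
by move=> /(_ (mem_nth _ g_m))/andP[/eqP-> /eqP->].
Qed.

Lemma rd_EE k : rd_E k *m rd_E k = rd_E k.
Proof.
apply/row_matrixP => g; rewrite row_mul rowK bi_idem_nth //.
rewrite /bi_val feval1 bi_elt_mx ?size_bi_idem // /bi_diff /=.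
rewrite bi_idem_nth // /bi_val feval1 /=.
by have [-> ->] := rd_idem (ltn_ord g).
Qed.

Lemma rd_rowP k g (st := nth (n, n) (rd_gens rd k.+1) g)
    (row := nth [::] (rd_rows rd k) g) : (g < m k.+1)%N ->
  [/\ (size (rd_rows rd k) <= m k.+1)%N,
      bi_eqb n (bi_act mul st.2 st.1 row) row,
      bi_eqb n (fbind row (bi_diff mul (bi_idem n (rd_gens rd k)))) row &
      is_true (if k is k'.+1 then
          bi_eqb n (fbind row (bi_diff mul (rd_rows rd k'))) [::]
        else fnull 0 (gtn n) [seq (t.1, rd_aug n mul rd t.2) | t <- row])].
Proof.
move=> g_m; have [k3|k3] := ltnP k 3; last first.
  by rewrite rd_gens_nil in g_m.
have [_ _ _ /and3P[_ /all_belowP/(_ k k3)/andP[sz rowsP] _]] := and4P rdP.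
by have /all_belowP/(_ g g_m)/and3P[? ? ?] := rowsP; split.
Qed.

Lemma rd_rows_size k : (k < 3)%N -> (size (rd_rows rd k) <= m k.+1)%N.
Proof.
by move=> k3; have [_ _ _ /and3P[_ /all_belowP/(_ k k3)/andP[]]] := and4P rdP.
Qed.

Lemma rd_ED k : rd_E k.+1 *m rd_D k = rd_D k.
Proof.
apply/row_matrixP => g; rewrite row_mul !rowK bi_idem_nth //.
have [sz ED _ _] := rd_rowP (ltn_ord g).
by rewrite /bi_val feval1 bi_elt_mx //; exact: bi_eqbP.
Qed.

Lemma rd_DE k : rd_D k *m rd_E k = rd_D k.
Proof.
apply/row_matrixP => g; rewrite row_mul !rowK.
have [sz _ DE _] := rd_rowP (ltn_ord g).
by rewrite bi_val_mx ?size_bi_idem //; exact: bi_eqbP.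
Qed.

Lemma rd_DD k : rd_D k.+1 *m rd_D k = 0.
Proof.
apply/row_matrixP => g; rewrite row_mul !rowK row0.
have [sz _ _ DD] := rd_rowP (ltn_ord g).
have [k3|k3] := ltnP k 3; last first.
  by move: (ltn_ord g); rewrite [X in (_ < X)%N]rd_gens_nil // ltnW.
by rewrite bi_val_mx ?rd_rows_size // (bi_eqbP _ DD) /bi_val feval_nil.
Qed.

Lemma rowact_bi_elt q (c : nat -> A) key :
  (forall g, (q <= g)%N -> c g = 0) ->
  rowact (fun g : 'I_q => c g : envmod A) (bi_elt b q key) =
  b key.2.2 * c key.1 * b key.2.1.
Proof.
move=> cq; rewrite /bi_elt linearZ /= env_tensor_scale; congr (_ * _ * _).
rewrite /rowact; have [g_q|q_g] := ltnP key.1 q; last first.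
  rewrite cq // big1 // => i _.
  by rewrite mxE ltn_eqF ?scale0r // (leq_trans (ltn_ord i)).
rewrite (bigD1 (Ordinal g_q)) //= mxE eqxx scale1r big1 ?addr0 // => i.
by rewrite -val_eqE /= mxE => /negPf->; rewrite scale0r.
Qed.

Lemma rd_eps_elt key :
  rowact rd_eps (bi_elt b (m 0) key) = b (rd_aug n mul rd key).
Proof.
pose c g : A := b (nth (n, n) (rd_gens rd 0) g).1.
rewrite -[rd_eps]/(fun g : 'I_(m 0) => c g : envmod A) rowact_bi_elt.
  by rewrite /c !(mb_mul b).
by move=> g g_m; rewrite /c nth_default // (mb_dead b).
Qed.

Lemma rd_eps_val u : rowact rd_eps (bi_val b (m 0) u) =
  feval (fun key => b (rd_aug n mul rd key) : envmod A) u.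
Proof.
by rewrite /bi_val raddf_feval; apply: eq_feval => key /=; exact: rd_eps_elt.
Qed.

Lemma rd_ends0 g (st := nth (n, n) (rd_gens rd 0) g) : st.1 = st.2.
Proof.
have [g_m|m_g] := ltnP g (m 0); last by rewrite /st nth_default.
have [_ _ /allP/(_ st (mem_nth _ g_m))/eqP-> _] := and4P rdP.
by [].
Qed.

Lemma rd_Eeps g : mxact (rd_E 0) rd_eps g = rd_eps g.
Proof.
rewrite -rowact_row rowK bi_idem_nth // rd_eps_val feval1 /rd_aug /=.
by rewrite -rd_ends0 !(rd_idem (ltn_ord g)).1.
Qed.

Lemma rd_Deps g : mxact (rd_D 0) rd_eps g = 0.
Proof.
rewrite -rowact_row rowK rd_eps_val.
have [_ _ _ Dnull] := rd_rowP (ltn_ord g).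
have := fnullP (V := A) (F := b) (fun=> mulr0n _) _ Dnull.
rewrite /feval big_map; apply.
by move=> i; rewrite -leqNgt; exact: mb_dead.
Qed.

Lemma rd_eps_unit : rowact rd_eps (bi_val b (m 0) (rd_unit n rd)) = 1.
Proof.
rewrite rd_eps_val feval_flatten big_map -{1}[size _]subn0 -/(index_iota _ _).
have [_ /eqP ids_eq _ _] := and4P rdP.
have idsE : \sum_(v <- ids) b v = \sum_(v <- [seq st.1 | st <- rd_gens rd 0]) b v.
  exact: congr_big.
rewrite (mb_one b) idsE big_map (big_nth (n, n)) big_nat [RHS]big_nat.
apply: eq_bigr => g /andP[_ g_m]; rewrite feval1 /rd_aug /= -rd_ends0.
by rewrite !(rd_idem g_m).1.
Qed.

Definition rd_htpy_fun k g i : 'rV[R]_(m k.+1) :=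
  if (g < m k)%N && (i < n)%N then
    bi_val b (m k.+1) (assoc [::] (nth [::] (rd_htpy rd) k) (g, i))
  else 0.

Lemma rd_htpy_elt k key : (k < 3)%N ->
  bi_lin b (m := m k) (rd_htpy_fun k) (bi_elt b (m k) key) =
  bi_val b (m k.+1) (rd_h n mul rd k key).
Proof.
move=> k3; case: key => g [i l]; rewrite bi_lin_elt.
- rewrite /rd_h /rd_htpy_fun /=; case: ifP => _; first by rewrite bi_val_lact.
  by rewrite /bi_val feval_nil scaler0.
- by move=> j m_g; rewrite /rd_htpy_fun ltnNge m_g.
- by move=> j n_j; rewrite /rd_htpy_fun andbC ltnNge n_j.
Qed.

Lemma rd_htpy_val k u : (k < 3)%N ->
  bi_lin b (m := m k) (rd_htpy_fun k) (bi_val b (m k) u) =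
  bi_val b (m k.+1) (fbind u (rd_h n mul rd k)).
Proof.
move=> k3; rewrite /bi_val raddf_feval feval_bind; apply: eq_feval => key /=.
exact: rd_htpy_elt.
Qed.

(** As [T] is linear on the left only, it has to be tested on all s (x) t [b i] and not just on the
    bimodule generators s (x) t. *)
Lemma rd_gen_fix k (T : {additive 'rV[R]_(m k) -> 'rV[R]_(m k)}) x :
  (forall y z, T (env_tensor 1 y *: z) = env_tensor 1 y *: T z) ->
  (forall g i, (g < m k)%N -> (i < n)%N ->
     T (bi_elt b (m k) (bi_gen n mul (rd_gens rd k) g i)) =
     bi_elt b (m k) (bi_gen n mul (rd_gens rd k) g i)) ->
  x *m rd_E k = x -> T x = x.
Proof.
move=> Tact Tgen xE; rewrite (bi_decomp erefl xE).
rewrite /bi_lin raddf_sum; apply: eq_bigr => g _; rewrite raddf_sum.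
by apply: eq_bigr => i _; rewrite Tact Tgen.
Qed.

Lemma rd_exact0 x : x *m rd_E 0 = x -> rowact rd_eps x = 0 ->
  exists y, y *m rd_D 0 = x.
Proof.
move=> xE x0; exists (bi_lin b (m := m 0) (rd_htpy_fun 0) x).
(* The right-hand side of the homotopy identity in degree 0. Once [T x = x] is known, the first
   summand vanishes with the augmentation of [x], and [x] is the image of its homotopy. *)
pose T z := env_tensor 1 (rowact rd_eps z : A) *: bi_val b (m 0) (rd_unit n rd) +
  bi_lin b (m := m 0) (rd_htpy_fun 0) z *m rd_D 0.
have T_zmod : zmod_morphism T.
  move=> y z; rewrite /T !raddfB /= scalerBl mulmxBl opprD !addrA.
  by congr (_ + _); rewrite addrAC.
pose T_ := GRing.isZmodMorphism.Build _ _ T T_zmod.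
pose TT : {additive _ -> _} := HB.pack T T_.
have: TT x = x.
  apply: rd_gen_fix xE => [y z|g i g_m i_n] /=; rewrite /T.
    have -> : rowact rd_eps (env_tensor 1 y *: z) = y * (rowact rd_eps z : A).
      by rewrite linearZ /= env_tensor_scale mulr1.
    by rewrite bi_lin_act -scalemxAl scalerDr scalerA env_tensorM mulr1.
  rewrite rd_eps_elt rd_htpy_elt // bi_val_mx; last exact: rd_rows_size.
  rewrite -bi_val_lact /bi_val -feval_cat.
  have [_ _ _ /and3P[_ _ ]] := and4P rdP.
  move=> /all_belowP/(_ 0%N isT)/all_belowP/(_ g g_m)/all_belowP/(_ i i_n).
  by move/(bi_eqbP (m 0)); rewrite {1}/bi_val feval1 => ->.
by rewrite /= /T x0 linear0 scale0r add0r.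
Qed.

Lemma rd_exactS k (x : 'rV_(m k.+1)) : (k < 2)%N ->
  x *m rd_E k.+1 = x -> x *m rd_D k = 0 ->
  exists y, y *m rd_D k.+1 = x.
Proof.
move=> k2 xE x0; exists (bi_lin b (m := m k.+1) (rd_htpy_fun k.+1) x).
pose T z := bi_lin b (m := m k) (rd_htpy_fun k) (z *m rd_D k) +
  bi_lin b (m := m k.+1) (rd_htpy_fun k.+1) z *m rd_D k.+1.
have T_zmod : zmod_morphism T.
  move=> y z; rewrite /T (mulmxBl y z) !bi_linB mulmxBl opprD !addrA.
  by congr (_ + _); rewrite addrAC.
pose T_ := GRing.isZmodMorphism.Build _ _ T T_zmod.
pose TT : {additive _ -> _} := HB.pack T T_.
have: TT x = x.
  apply: rd_gen_fix xE => [y z|g i g_m i_n] /=; rewrite /T.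
    by rewrite -scalemxAl !bi_lin_act -scalemxAl scalerDr.
  have [sz _ _ _] := rd_rowP g_m.
  rewrite rd_htpy_elt; last exact: k2.
  rewrite bi_elt_mx; last exact: sz.
  rewrite rd_htpy_val; last exact: leqW.
  rewrite bi_val_mx; last exact: rd_rows_size.
  rewrite /bi_val -feval_cat.
  have [_ _ _ /and3P[_ _ ]] := and4P rdP.
  move=> /all_belowP/(_ k.+1 k2)/all_belowP/(_ g g_m)/all_belowP/(_ i i_n).
  by move/(bi_eqbP (m k.+1)); rewrite {1}/bi_val feval1 => ->.
by rewrite /= /T x0 raddf0 add0r.
Qed.

End ResolutionSoundness.

Lemma envmod_scale_in (K : fieldType) (A : algType K) (k : K) (a : A) :
  k%:A *: (a : envmod A) = k *: a.
Proof.
rewrite -env_tensor11 -linearZ env_tensor_scale mulr1.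
by rewrite mulr_algl.
Qed.

Lemma envmod_scaleC (K : fieldType) (A : algType K) (z : envalg A) (k : K) (a : A) :
  z *: (k *: a : envmod A) = k *: (z *: (a : envmod A) : A).
Proof.
by have := env_act_linear (quotalg_repr z) k a 0; rewrite addr0 env_act0l addr0.
Qed.

(** * Certified dimensions *)

(* [(g, i)] is the cochain with value [b i] on the [g]-th generator. *)
Definition cokey : Type := nat * nat.

(* Certificate that the cohomology in some degree has dimension
   [size cc_Z] over a field in which [cc_p] vanishes and [cc_kappa] does not:
   [cc_kappa] times the identity on cochains is [D X + Y D + Z Theta]. *)
Record co_cert := CoCert {
  cc_p : nat;
  cc_kappa : nat;
  cc_X : seq (cokey * fsum cokey);
  cc_Y : seq (cokey * fsum cokey);
  cc_Z : seq (fsum cokey);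
  cc_Theta : seq (cokey * fsum nat) }.

Section CochainCheck.
Context (n : nat) (mul : nat -> nat -> nat) (rd : res_data).

Definition co_in q (key : cokey) : bool := (key.1 < q)%N && (key.2 < n)%N.

Definition co_restr (T : Type) q (f : cokey -> fsum T) (key : cokey) : fsum T :=
  if co_in q key then f key else [::].

(** The transpose of [rd_rows]: a term l (x) r of the row of [g], placed in coordinate h, sends a
    cochain with value m at h to one with value l m r at [g]. *)
Definition co_diff k (key : cokey) : fsum cokey :=
  flatten [seq [seq (t.1, (g, mul (mul t.2.2.2 key.2) t.2.2.1))
               | t <- nth [::] (rd_rows rd k) g & t.2.1 == key.1]
          | g <- iota 0 (size (rd_gens rd k.+1))].

(** Homomorphisms from A s (x) t A to A are elements of s A t, so a basis cochain is projected by m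
    |-> s m t. *)
Definition co_proj k (key : cokey) : cokey :=
  let st := nth (n, n) (rd_gens rd k) key.1 in
  (key.1, mul (mul st.1 key.2) st.2).

Definition co_live (key : cokey) : bool := (key.2 < n)%N.

(** For a cocycle c the first clause becomes kappa c = D X c + Z Theta c, so Theta c = 0 makes c a
    coboundary. The second clause says that Theta kills coboundaries. The last two say that the
    members of [cc_Z] are cocycles with Theta Z = kappa, whence surjectivity of Theta. Together
    Theta induces an isomorphism on cohomology once kappa is invertible. *)
Definition co_check k (c : co_cert) : bool :=
  let m k := size (rd_gens rd k) in
  let D k := co_restr (m k) (co_diff k) in
  let theta := co_restr (m k) (assoc [::] (cc_Theta c)) in
  [&& all_below (m k) (fun g => all_below n (fun i =>
        let key := co_proj k (g, i) in
        fnull (cc_p c) co_live ((- (cc_kappa c)%:Z, key) ::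
          (if k is k'.+1 then fbind (assoc [::] (cc_X c) key) (D k') else [::]) ++
          fbind (D k key) (co_restr (m k.+1) (assoc [::] (cc_Y c))) ++
          fbind (theta key) (fun j => nth [::] (cc_Z c) j)))),
      (if k is k'.+1 then all_below (m k') (fun g => all_below n (fun i =>
           fnull (cc_p c) xpredT (fbind (D k' (co_proj k' (g, i))) theta)))
       else true),
      all (fun z => all (fun t => co_proj k t.2 == t.2) z &&
             fnull (cc_p c) co_live (fbind z (D k))) (cc_Z c) &
      all_below (size (cc_Z c)) (fun j => fnull (cc_p c) xpredT
        ((- (cc_kappa c)%:Z, j) :: fbind (nth [::] (cc_Z c) j) theta))].

End CochainCheck.

Section CochainSoundness.
Context (K : fieldType) (A : algType K) (n : nat) (mul : nat -> nat -> nat).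
Context (ids : seq nat) (b : mult_basis A n mul ids).

Definition co_elt (key : cokey) (j : nat) : A := if j == key.1 then b key.2 else 0.

Definition co_val (u : fsum cokey) (j : nat) : A := feval (co_elt^~ j) u.

(** The linear extension of [F] from basis cochains to all columns. Through it a table over keys
    acts on cochains with coefficients in the field, and composition of such maps is [fbind] of
    tables. *)
Definition co_lin q (V : lmodType K) (F : cokey -> V) (c : 'I_q -> A) : V :=
  \sum_(h < q) \sum_(i < n) mb_coord b (c h) 0 i *: F (h : nat, i : nat).

Lemma co_linP q (V : lmodType K) (F : cokey -> V) k (c c' : 'I_q -> A) :
  co_lin F (fun j => k *: c j + c' j) = k *: co_lin F c + co_lin F c'.
Proof.
rewrite /co_lin scaler_sumr -big_split; apply: eq_bigr => h _ /=.
rewrite scaler_sumr -big_split; apply: eq_bigr => i _ /=.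
by rewrite linearP !mxE scalerDl scalerA.
Qed.

Lemma eq_co_lin q (V : lmodType K) (F F' : cokey -> V) (c c' : 'I_q -> A) :
  F =1 F' -> c =1 c' -> co_lin F c = co_lin F' c'.
Proof.
by move=> FF' cc'; apply: eq_bigr => h _; apply: eq_bigr => i _; rewrite FF' cc'.
Qed.

Lemma eq_co_lin_in q (V : lmodType K) (F F' : cokey -> V) (c : 'I_q -> A) :
  (forall key, co_in n q key -> F key = F' key) -> co_lin F c = co_lin F' c.
Proof.
move=> FF'; apply: eq_bigr => h _; apply: eq_bigr => i _.
by rewrite FF' // /co_in !ltn_ord.
Qed.

Lemma co_linD q (V : lmodType K) (F F' : cokey -> V) (c : 'I_q -> A) :
  co_lin (fun key => F key + F' key) c = co_lin F c + co_lin F' c.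
Proof.
rewrite /co_lin -big_split; apply: eq_bigr => h _ /=.
by rewrite -big_split; apply: eq_bigr => i _; rewrite scalerDr.
Qed.

Lemma co_linMn q (V : lmodType K) (F : cokey -> V) (c : 'I_q -> A) (k : nat) :
  co_lin (fun key => F key *+ k) c = co_lin F c *+ k.
Proof.
rewrite /co_lin -sumrMnl; apply: eq_bigr => h _ /=.
by rewrite -sumrMnl; apply: eq_bigr => i _; rewrite scalerMnr.
Qed.

Lemma co_lin_linear q (V W : lmodType K) (phi : {linear V -> W}) (F : cokey -> V)
    (c : 'I_q -> A) :
  phi (co_lin F c) = co_lin (fun key => phi (F key)) c.
Proof.
rewrite /co_lin linear_sum; apply: eq_bigr => h _ /=.
by rewrite linear_sum; apply: eq_bigr => i _; rewrite linearZ.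
Qed.

Lemma co_lin0 q (V : lmodType K) (F : cokey -> V) :
  co_lin F (fun _ : 'I_q => 0) = 0.
Proof.
rewrite /co_lin big1 // => h _; rewrite big1 // => i _.
by rewrite linear0 mxE scale0r.
Qed.

Lemma co_lin_sum q (V : lmodType K) (F : cokey -> V) I (r : seq I)
    (a : I -> K) (c : I -> 'I_q -> A) :
  co_lin F (fun j => \sum_(x <- r) a x *: c x j) =
  \sum_(x <- r) a x *: co_lin F (c x).
Proof.
elim: r => [|x r IHr].
  by rewrite big_nil -[RHS](co_lin0 q F); apply: eq_co_lin => // j; rewrite big_nil.
rewrite big_cons -IHr -co_linP; apply: eq_co_lin => // j.
by rewrite big_cons.
Qed.

Lemma co_lin_comp q q' (V : lmodType K) (F : cokey -> V) (W : cokey -> 'I_q' -> A)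
    (c : 'I_q -> A) :
  co_lin F (fun j => co_lin (fun key => W key j) c) =
  co_lin (fun key => co_lin F (W key)) c.
Proof.
rewrite [RHS]/co_lin pair_bigA /= -co_lin_sum; apply: eq_co_lin => // j.
by rewrite /co_lin pair_bigA.
Qed.

Lemma co_lin_elt q (V : lmodType K) (F : cokey -> V) key :
  co_lin F (fun j : 'I_q => co_elt key j) = if co_in n q key then F key else 0.
Proof.
case: key => h i; rewrite /co_lin /co_elt /co_in /=.
have [h_q|q_h] := ltnP h q; last first.
  rewrite big1 // => g _; rewrite big1 // => j _.
  by rewrite ltn_eqF ?(leq_trans (ltn_ord g)) // linear0 mxE scale0r.
rewrite (bigD1 (Ordinal h_q)) //= eqxx [X in _ + X]big1 ?addr0 => [|g]; last first.
  rewrite -val_eqE /= => /negPf ->; rewrite big1 // => j _.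
  by rewrite linear0 mxE scale0r.
have [i_n|n_i] := ltnP i n; last first.
  by rewrite (mb_dead b) // linear0 big1 // => j _; rewrite mxE scale0r.
rewrite mb_coordE (bigD1 (Ordinal i_n)) //= mxE eqxx scale1r big1 ?addr0 // => j.
by rewrite -val_eqE /= mxE => /negPf->; rewrite scale0r.
Qed.

Lemma co_lin_val q (V : lmodType K) (F : cokey -> V) u :
  co_lin F (fun j : 'I_q => co_val u j) =
  feval (fun key => if co_in n q key then F key else 0) u.
Proof.
elim: u => [|t u IHu].
  by rewrite feval_nil -[RHS](co_lin0 q F); apply: eq_co_lin => // j; exact: feval_nil.
rewrite feval_cons -IHu -co_lin_elt -scaler_int -co_linP.
by apply: eq_co_lin => // j; rewrite /co_val feval_cons scaler_int.
Qed.

Lemma mxact_co_lin p q (D : 'M[envalg A]_(p, q)) (c : 'I_q -> A) g :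
  mxact D (c : 'I_q -> envmod A) g =
  co_lin (fun key => mxact D (fun j => co_elt key j : envmod A) g : A) c.
Proof.
rewrite /mxact /co_lin; apply: eq_bigr => h _.
rewrite [c h in LHS](mb_sum b) scaler_sumr; apply: eq_bigr => i _.
rewrite envmod_scaleC; apply: (congr1 (fun a : A => mb_coord b (c h) 0 i *: a)).
rewrite (bigD1 h) //= /co_elt eqxx big1 ?addr0 // => j.
by rewrite -val_eqE => /negPf->; rewrite scaler0.
Qed.

End CochainSoundness.

Section CohomologyDimension.
Context (K : fieldType) (A : algType K) (n : nat) (mul : nat -> nat -> nat).
Context (ids : seq nat) (b : mult_basis A n mul ids) (rd : res_data).
Hypothesis rdP : res_check n mul ids rd.
Local Notation R := (envalg A).
Local Notation m k := (size (rd_gens rd k)).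
Local Notation D k := (co_restr n (m k) (co_diff mul rd k)).
Local Notation proj k := (co_proj n mul rd k).

Lemma mxact_rd_D k key (g : 'I_(m k.+1)) :
  mxact (rd_D b rd k) (fun j : 'I_(m k) => co_elt b key j : envmod A) g =
  co_val b (D k key) g.
Proof.
rewrite /co_restr /co_in; have [h_m|m_h] := ltnP key.1 (m k); last first.
  rewrite /= /co_val feval_nil /mxact big1 // => j _.
  by rewrite /co_elt ltn_eqF ?scaler0 // (leq_trans (ltn_ord j)).
have [i_n|n_i] := ltnP key.2 n; last first.
  rewrite /= /co_val feval_nil /mxact big1 // => j _.
  by rewrite /co_elt (mb_dead b) // if_same scaler0.
rewrite -rowact_row rowK /bi_val raddf_feval.
have elt_out j : (m k <= j)%N -> co_elt b key j = 0.
  by move=> m_j; rewrite /co_elt gtn_eqF // (leq_trans h_m).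
rewrite (eq_feval _ (F' := fun t => b t.2.2 * co_elt b key t.1 * b t.2.1 : A));
  last by move=> t; exact: rowact_bi_elt.
rewrite /co_val /co_diff feval_flatten big_map.
rewrite (bigD1_seq (g : nat)) ?mem_iota ?iota_uniq //= [X in _ + X]big1 ?addr0.
  rewrite /feval big_map big_filter [LHS]big_mkcond [RHS]big_mkcond /=.
  rewrite [RHS]big_mkcond; apply: eq_bigr => t _; rewrite /co_elt /= eqxx.
  by case: eqP => _; rewrite ?mulr0 ?mul0r ?mul0rz // !(mb_mul b).
move=> g' /negPf g'g; rewrite /feval big_map big1 // => t _.
by rewrite /co_elt /= eq_sym g'g mul0rz.
Qed.

Lemma mxact_rd_D_val k u (g : 'I_(m k.+1)) :
  mxact (rd_D b rd k) (fun j : 'I_(m k) => co_val b u j : envmod A) g =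
  co_val b (fbind u (D k)) g.
Proof.
rewrite (mxact_co_lin b) (co_lin_val b) /co_val feval_bind.
apply: eq_feval => key; rewrite mxact_rd_D /co_restr.
by case: (co_in _ _ key); rewrite /co_val ?feval_nil.
Qed.

Lemma mxact_rd_E k key (g : 'I_(m k)) : co_in n (m k) key ->
  mxact (rd_E b rd k) (fun j : 'I_(m k) => co_elt b key j : envmod A) g =
  co_elt b (proj k key) g.
Proof.
case/andP=> h_m _; rewrite -rowact_row rowK bi_idem_nth // /bi_val feval1.
rewrite (rowact_bi_elt b (c := co_elt b key)) => [|j m_j]; last first.
  by rewrite /co_elt gtn_eqF // (leq_trans h_m).
rewrite /co_elt /co_proj /=; case: eqP => [->|_].
  by rewrite !(mb_mul b).
by rewrite mulr0 mul0r.
Qed.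

Section FixedCochain.
Context (k : nat) (c : 'I_(m k) -> A).
Hypothesis cE : forall g, mxact (rd_E b rd k) (c : 'I_(m k) -> envmod A) g = c g.

(** A column fixed by [E] is its own projection. This is why the identities of [co_check] are tested
    on projected keys only. *)
Lemma co_lin_proj (V : lmodType K) (F : cokey -> V) :
  co_lin b F c = co_lin b (fun key =>
    if co_in n (m k) (proj k key) then F (proj k key) else 0) c.
Proof.
transitivity (co_lin b F (fun j : 'I_(m k) =>
    co_lin b (fun key => co_elt b (proj k key) j) c)).
  apply: eq_co_lin => // j; rewrite -cE (mxact_co_lin b).
  apply: eq_bigr => h _; apply: eq_bigr => i _; congr (_ *: _).
  by rewrite mxact_rd_E // /co_in /= !ltn_ord.
rewrite co_lin_comp; apply: eq_co_lin => // key.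
exact: co_lin_elt.
Qed.

Lemma fixed_cochain j : c j = co_lin b (fun key => co_elt b (proj k key) j) c.
Proof.
rewrite -cE (mxact_co_lin b).
apply: eq_bigr => h _; apply: eq_bigr => i _; congr (_ *: _).
by rewrite mxact_rd_E // /co_in /= !ltn_ord.
Qed.

Lemma fixed_cochain_diff g : mxact (rd_D b rd k) (c : 'I_(m k) -> envmod A) g =
  co_lin b (fun key => co_val b (D k (proj k key)) g) c.
Proof.
rewrite (mxact_co_lin b) co_lin_proj; apply: eq_co_lin => // key.
rewrite mxact_rd_D /co_restr.
by case: (co_in _ _ _); rewrite /co_val ?feval_nil.
Qed.

End FixedCochain.
Lemma co_table_lin (X : Type) q q' (V : lmodType K) (G : X -> V)
    (t : cokey -> fsum X) (f : cokey -> fsum cokey) (c : 'I_q -> A) :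
  co_lin b (fun key => feval G (t key))
    (fun j : 'I_q' => co_lin b (fun key => co_val b (f key) j) c) =
  co_lin b (fun key => feval G (fbind (f key) (co_restr n q' t))) c.
Proof.
rewrite co_lin_comp; apply: eq_co_lin => // key.
rewrite (co_lin_val b) feval_bind; apply: eq_feval => key'.
by rewrite /co_restr; case: (co_in _ _ _); rewrite ?feval_nil.
Qed.

Section Certificate.
Context (k : nat) (cert : co_cert).
Hypothesis certP : co_check n mul rd k cert.
Hypotheses (p0 : (cc_p cert)%:R = 0 :> K) (kap0 : (cc_kappa cert)%:R != 0 :> K).
Local Notation d := (size (cc_Z cert)).
Local Notation kap := ((cc_kappa cert)%:R : K).
Local Notation th := (co_restr n (m k) (assoc [::] (cc_Theta cert))).
Local Notation Z j := (nth [::] (cc_Z cert) j).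

Definition cert_theta (c : 'I_(m k) -> A) : 'rV[K]_d :=
  co_lin b (fun key => feval (nat_delta K d) (assoc [::] (cc_Theta cert) key)) c.

Lemma cert_p (V : lmodType K) (v : V) : v *+ cc_p cert = 0.
Proof. by rewrite -scaler_nat p0 scale0r. Qed.

Lemma cert_theta_val u :
  cert_theta (fun j => co_val b u j) = feval (nat_delta K d) (fbind u th).
Proof.
rewrite /cert_theta (co_lin_val b) feval_bind; apply: eq_feval => key.
by rewrite /co_restr; case: (co_in _ _ key); rewrite ?feval_nil.
Qed.

Lemma fnull_co u (j : nat) : fnull (cc_p cert) (co_live n) u -> co_val b u j = 0.
Proof.
apply: fnullP => [v|key]; first exact: cert_p.
by rewrite /co_live -leqNgt /co_elt => /(mb_dead b)->; rewrite if_same.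
Qed.

Definition cert_Z (y : 'rV[K]_d) (j : nat) : A :=
  \sum_(l < d) y 0 l *: co_val b (Z l) j.

Fact cert_Z_linear j : linear (cert_Z^~ j).
Proof.
move=> a x y; rewrite /cert_Z scaler_sumr -big_split; apply: eq_bigr => l _ /=.
by rewrite !mxE scalerDl scalerA.
Qed.

Lemma cert_Z_delta u j :
  cert_Z (feval (nat_delta K d) u) j = co_val b (fbind u (fun l => Z l)) j.
Proof.
pose L := GRing.isLinear.Build K 'rV[K]_d A *:%R (cert_Z^~ j) (cert_Z_linear j).
pose phi : {linear 'rV[K]_d -> A} := HB.pack (cert_Z^~ j) L.
rewrite /co_val feval_bind -[LHS]/(phi _) raddf_feval; apply: eq_feval => l /=.
rewrite /cert_Z; have [l_d|d_l] := ltnP l d; last first.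
  rewrite nth_default // feval_nil big1 // => i _.
  by rewrite mxE ltn_eqF ?scale0r // (leq_trans (ltn_ord i)).
rewrite (bigD1 (Ordinal l_d)) //= mxE eqxx scale1r big1 ?addr0 // => i.
by rewrite -val_eqE /= mxE => /negPf->; rewrite scale0r.
Qed.

Section FixedCocycle.
Context (c : 'I_(m k) -> A).
Hypothesis cE : forall g, mxact (rd_E b rd k) (c : 'I_(m k) -> envmod A) g = c g.

Definition cert_X (j : nat) : A := co_lin b (fun key =>
  co_val b (if k is k'.+1 then
      fbind (assoc [::] (cc_X cert) (proj k key)) (D k') else [::]) j) c.

Lemma cert_homotopy j :
  (forall g, mxact (rd_D b rd k) (c : 'I_(m k) -> envmod A) g = 0) ->
  kap *: c j = cert_X j + cert_Z (cert_theta c) j.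
Proof.
move=> cD.
(* This term is Y evaluated at D c, which is zero. *)
have YD : co_lin b (fun key => co_val b (fbind (D k (proj k key))
    (co_restr n (m k.+1) (assoc [::] (cc_Y cert)))) j) c = 0.
  rewrite /co_val -(co_table_lin (m k.+1) (fun key => co_elt b key j)
    (assoc [::] (cc_Y cert)) (fun key => D k (proj k key))).
  rewrite -[RHS](co_lin0 b (m k.+1) (fun key =>
    feval (fun key' => co_elt b key' j) (assoc [::] (cc_Y cert) key))).
  by apply: eq_co_lin => // g; rewrite -(fixed_cochain_diff cE) cD.
have ZT : cert_Z (cert_theta c) j =
    co_lin b (fun key => co_val b (fbind (th (proj k key)) (fun l => Z l)) j) c.
  pose L := GRing.isLinear.Build K 'rV[K]_d A *:%R (cert_Z^~ j) (cert_Z_linear j).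
  pose phi : {linear 'rV[K]_d -> A} := HB.pack (cert_Z^~ j) L.
  rewrite /cert_theta co_lin_proj // -[LHS]/(phi _) co_lin_linear.
  apply: eq_co_lin => // key; rewrite -cert_Z_delta /= /co_restr.
  by case: (co_in _ _ _); rewrite ?feval_nil.
rewrite ZT -[_ + _]addr0 -YD /cert_X -!co_linD scaler_nat.
rewrite [X in X *+ _](fixed_cochain cE) -co_linMn.
apply: eq_co_lin_in => -[g i] /andP[/= g_m i_n].
have /and4P[/all_belowP/(_ g g_m)/all_belowP/(_ i i_n)/(fnull_co j) homP _ _ _] :=
  certP.
apply/eqP; rewrite -subr_eq0 -opprB oppr_eq0; apply/eqP; rewrite -{}[RHS]homP.
rewrite /co_val feval_cons !feval_cat mulrNz -pmulrn [LHS]addrC.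
by congr (_ + _); rewrite -!addrA; congr (_ + _); rewrite addrC.
Qed.

End FixedCocycle.

Lemma mxact_rd_E_val z (g : 'I_(m k)) : all (fun t => proj k t.2 == t.2) z ->
  mxact (rd_E b rd k) (fun j : 'I_(m k) => co_val b z j : envmod A) g = co_val b z g.
Proof.
move=> /allP zP; rewrite (mxact_co_lin b) (co_lin_val b) /co_val.
apply: eq_big_seq => t /zP/eqP tP; congr (_ *~ _).
have [t_in|] := boolP (co_in n (m k) t.2); first by rewrite mxact_rd_E // tP.
rewrite negb_and -!leqNgt /co_elt => /orP[m_t|/(mb_dead b)->]; last by rewrite if_same.
by rewrite ltn_eqF // (leq_trans _ m_t).
Qed.

Lemma cert_surj (y : 'rV[K]_d) : exists2 c : 'I_(m k) -> envmod A,
  (forall i, mxact (rd_E b rd k) c i = c i) /\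
  (forall i, mxact (rd_D b rd k) c i = 0) & cert_theta c = y.
Proof.
have /and4P[_ _ /allP cycP /all_belowP dualP] := certP.
have ZP (l : 'I_d) := cycP _ (mem_nth [::] (ltn_ord l)).
(* Theta takes the l-th cocycle of the certificate to kappa times the l-th unit vector, whence the
   division by kappa. *)
exists (fun j => \sum_(l < d) (kap^-1 * y 0 l) *: co_val b (Z l) j).
  split=> g; rewrite (mxact_co_lin b) co_lin_sum.
    apply: eq_bigr => l _; rewrite -mxact_co_lin mxact_rd_E_val //.
    by have /andP[] := ZP l.
  rewrite big1 // => l _; rewrite -mxact_co_lin mxact_rd_D_val fnull_co ?scaler0 //.
  by have /andP[] := ZP l.
rewrite /cert_theta co_lin_sum.
have thZ (l : 'I_d) : co_lin b (fun key =>
    feval (nat_delta K d) (assoc [::] (cc_Theta cert) key)) 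
    (fun j : 'I_(m k) => co_val b (Z l) j) =
    kap *: nat_delta K d l.
  rewrite -[LHS]/(cert_theta _) cert_theta_val.
  have := fnullP (F := nat_delta K d) (fun v => cert_p v) _ (dualP l (ltn_ord l)).
  rewrite feval_cons mulrNz -pmulrn scaler_nat => nul.
  by apply/eqP; rewrite -subr_eq0 addrC; apply/eqP/nul.
rewrite (eq_bigr (fun l : 'I_d => y 0 l *: nat_delta K d l)) => [|l _]; last first.
  by rewrite thZ scalerA mulrAC mulVf // mul1r.
apply/rowP => i; rewrite summxE (bigD1 i) //= !mxE eqxx mulr1 big1 ?addr0 // => l.
by rewrite eq_sym -val_eqE !mxE => /negPf->; rewrite mulr0.
Qed.

End Certificate.

Lemma mxact_rd_D_lin k (W : cokey -> fsum cokey) q (c : 'I_q -> A) (g : 'I_(m k.+1)) :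
  mxact (rd_D b rd k)
    (fun j : 'I_(m k) => co_lin b (fun key => co_val b (W key) j) c : envmod A) g =
  co_lin b (fun key => co_val b (fbind (W key) (D k)) g) c.
Proof.
rewrite (mxact_co_lin b) co_lin_comp; apply: eq_co_lin => // key.
by rewrite -mxact_co_lin mxact_rd_D_val.
Qed.

Lemma cert_theta_diff k cert (c : 'I_(m k) -> A) :
  co_check n mul rd k.+1 cert -> (cc_p cert)%:R = 0 :> K ->
  (forall g, mxact (rd_E b rd k) (c : 'I_(m k) -> envmod A) g = c g) ->
  cert_theta (k := k.+1) cert (mxact (rd_D b rd k) (c : 'I_(m k) -> envmod A)) = 0.
Proof.
move=> /and4P[_ /all_belowP bdP _ _] p0 cE; rewrite /cert_theta.
rewrite (eq_co_lin b (F' := fun key => feval (nat_delta K (size (cc_Z cert)))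
    (assoc [::] (cc_Theta cert) key)) (fun=> erefl) (fixed_cochain_diff cE)).
rewrite (co_table_lin _ _ _ (fun key => D k (proj k key))).
rewrite /co_lin big1 // => h _; rewrite big1 // => i _.
rewrite (fnullP (p := cc_p cert) (live := xpredT)) ?scaler0 //.
  by move=> v; exact: cert_p.
by have /all_belowP/(_ i (ltn_ord i)) := bdP h (ltn_ord h).
Qed.

Lemma has_dim_HH k (cert : co_cert) :
  (k <= 2)%N -> co_check n mul rd k cert ->
  (cc_p cert)%:R = 0 :> K -> (cc_kappa cert)%:R != 0 :> K ->
  has_dim (HH k A) (size (cc_Z cert)).
Proof.
move=> k2 certP p0 kap0; set d := size (cc_Z cert).
apply: (@has_dim_mxres K R (envmod A) (envmod A) (fun j => m j) (rd_E b rd)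
  (rd_D b rd) (rd_eps b (rd := rd)) (rd_EE b rdP) (rd_ED b rdP) (rd_DE b rdP)
  (rd_DD b rdP) (rd_Deps b rdP) k d (@cert_theta k cert)
  (free_resolution (envmod A))).
- move=> a c c'; rewrite /cert_theta -co_linP; apply: eq_co_lin => // j.
  by rewrite envmod_scale_in.
- apply: mxres_exact => [||a|x|l l_k x].
  + exact: rd_ED.
  + exact: rd_Eeps.
  + exists (env_tensor 1 (a : A) *: bi_val b (m 0) (rd_unit n rd)).
    by rewrite linearZ /= rd_eps_unit // env_tensor_scale !mulr1.
  + exact: rd_exact0.
  + by apply: rd_exactS => //; exact: leq_trans l_k k2.
- move=> c cE cD; split=> [c0|].
    have := cert_homotopy certP p0 cE _ cD; rewrite c0 /cert_X.
    have Z0 j : cert_Z (cert := cert) 0 j = 0.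
      by rewrite /cert_Z big1 // => l _; rewrite mxE scale0r.
    case: k cert k2 certP p0 kap0 @d c cE {cD c0} Z0
      => [|k] cert k2 certP p0 kap0 d c cE Z0 hE.
      move=> j; have := hE j; rewrite Z0 addr0 /co_val /co_lin.
      rewrite big1 => [/eqP|h _]; last first.
        by rewrite big1 // => i _; rewrite feval_nil scaler0.
      by rewrite scaler_eq0 (negPf kap0) => /eqP.
    pose X (j : 'I_(m k)) := co_lin b (fun key =>
      co_val b (assoc [::] (cc_X cert) (proj k.+1 key)) j) c.
    (* X c / kappa may fail to be fixed by [E]; its image under [E] is fixed and has the same
       coboundary, because D E = D. The summand 0 gives the term the shape required by [co_linP]. *)
    pose c' (j : 'I_(m k)) : envmod A := (cc_kappa cert)%:R^-1 *: X j + 0.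
    exists (mxact (rd_E b rd k) c') => g; rewrite -mxact_mulmx ?rd_EE // rd_DE //.
    rewrite (mxact_co_lin b) co_linP co_lin0 addr0 -mxact_co_lin mxact_rd_D_lin.
    have := hE g; rewrite Z0 addr0 => <-.
    by rewrite scalerA mulVf // scale1r.
  case: k cert k2 certP p0 kap0 @d c cE {cD}
    => [|k] cert k2 certP p0 kap0 d c cE.
    move=> c0; rewrite -[RHS](co_lin0 b (m 0)
      (fun key => feval (nat_delta K d) (assoc [::] (cc_Theta cert) key))).
    exact: eq_co_lin.
  case=> c' c'E /funext <-.
  exact: cert_theta_diff.
- exact: cert_surj.
Qed.

End CohomologyDimension.

(** * Multiplication tables of bound quiver algebras *)

Section PathProducts.
Context (K : fieldType) (Q : quiver).
Implicit Types (v : qvert Q) (s : seq (qarrow Q)).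

Definition vert_elt v : path_alg K Q := << triv_path v >>.

Lemma path_elt v s (ok : path_ok v s) :
  << QPath (path_val := (v, s)) ok >> = vert_elt v * \prod_(a <- s) arrow K a
    :> path_alg K Q.
Proof.
elim: s v ok => [|a s IHs] v ok.
  by rewrite big_nil mulr1; congr << _ >>; exact: qpath_eq.
have /andP[/eqP src_a ok_s] := ok.
have a_tgt : arrow K a = arrow K a * vert_elt (qtgt a).
  rewrite unlock [RHS]catalgU /= path_comp_idr ?mem_triv_paths //.
  by rewrite eqxx.
have a_src : vert_elt v * arrow K a = arrow K a.
  rewrite unlock [LHS]catalgU /= path_comp_idl ?mem_triv_paths //.
  by rewrite -src_a eqxx.
rewrite big_cons mulrA a_src a_tgt -mulrA -(IHs _ ok_s) unlock [RHS]catalgU /=.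
have [|r -> [rs ra]] := @path_compT _ (arrow_path a) (QPath (path_val := (_, _)) ok_s).
  by [].
by congr << _ >>; apply: qpath_eq; rewrite ?rs ?ra.
Qed.

Lemma path_elt0 v s : ~~ path_ok v s -> vert_elt v * \prod_(a <- s) arrow K a = 0.
Proof.
elim: s v => [|a s IHs] v //=; rewrite negb_and big_cons mulrA.
have a_tgt : arrow K a = arrow K a * vert_elt (qtgt a).
  rewrite unlock [RHS]catalgU /= path_comp_idr ?mem_triv_paths //.
  by rewrite eqxx.
case/orP=> [src_a|/IHs s0]; last first.
  by rewrite a_tgt -!mulrA s0 !mulr0.
suff -> : vert_elt v * arrow K a = 0 by rewrite mul0r.
rewrite unlock [LHS]catalgU /= path_comp_idl ?mem_triv_paths //.
by rewrite triv_path_eq /path_src /= andbT eq_sym (negPf src_a).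
Qed.

Lemma path_elt_vert v s w :
  vert_elt v * \prod_(a <- s) arrow K a * vert_elt w =
  if last v [seq qtgt a | a <- s] == w then vert_elt v * \prod_(a <- s) arrow K a
  else 0.
Proof.
have [ok|/path_elt0->] := boolP (path_ok v s); last by rewrite mul0r if_same.
rewrite -(path_elt ok) [LHS]catalgU /= path_comp_idr ?mem_triv_paths //.
rewrite triv_path_eq {1}/path_src /= andbT eq_sym.
by rewrite /path_tgt /path_src /path_arrows /=; case: eqP.
Qed.

End PathProducts.

(* Vertices and arrows are numbered; [td_words] lists paths (start vertex and
   arrows) forming a basis, [td_rels] the relations [u = v] or [u = 0], and the
   entry [(j, steps)] of [td_rmul] in position [(i, a)] says that [b i * a] is
   [b j]; entries that merely extend the path are omitted.  A rewriting step
   [(pos, (r, back))] applies the [r]-th relation at position [pos], from right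
   to left if [back]. *)
Record table_data := TableData {
  td_ends : seq (nat * nat);
  td_words : seq (nat * seq nat);
  td_rels : seq (seq nat * option (seq nat));
  td_rmul : seq ((nat * nat) * (nat * seq (nat * (nat * bool)))) }.

Section TableCheck.
Context (nv : nat) (td : table_data).
Local Notation n := (size (td_words td)).
Local Notation na := (size (td_ends td)).

Definition td_word i : nat * seq nat := nth (0%N, [::]) (td_words td) i.
Definition td_end a : nat * nat := nth (0, 0)%N (td_ends td) a.

Fixpoint word_ok v (w : seq nat) : bool :=
  if w is a :: w' then ((td_end a).1 == v) && word_ok (td_end a).2 w' else true.

Definition word_tgt v (w : seq nat) : nat := last v [seq (td_end a).2 | a <- w].

Definition td_tgt i : nat := word_tgt (td_word i).1 (td_word i).2.

(** By default the extended word is looked up in the list. If it is absent, [index] yields the size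
    of the list, that is zero, and with no rewriting steps [table_check] accepts this only for a
    word that is not a path. *)
Definition rmul_entry i a : nat * seq (nat * (nat * bool)) :=
  let: (v, w) := td_word i in
  assoc (index (v, rcons w a) (td_words td), [::]) (td_rmul td) (i, a).

Definition rmul i a : nat :=
  let j := (rmul_entry i a).1 in if (i < n)%N && (j < n)%N then j else n.

Definition td_id v : nat := index (v, [::]) (td_words td).

Definition td_ids : seq nat := [seq td_id v | v <- iota 0 nv].

Definition table_mul : seq (seq nat) :=
  [seq [seq foldl rmul (if td_tgt i == (td_word j).1 then i else n) (td_word j).2
       | j <- iota 0 n] | i <- iota 0 n].

(** [None] is the zero element. A step that does not match leaves the word unchanged, so every list
    of steps is sound and only its outcome is checked. *)
Definition rewrite_step (w : seq nat) (st : nat * (nat * bool)) :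
    option (seq nat) :=
  let: (pos, (r, back)) := st in
  let: (u, v) := nth ([::], Some [::]) (td_rels td) r in
  let replace x y := take pos w ++ y ++ drop (size x) (drop pos w) in
  let matches x := take (size x) (drop pos w) == x in
  if back then
    if v is Some v' then if matches v' then Some (replace v' u) else Some w
    else Some w
  else if matches u then omap (replace u) v else Some w.

Definition rewrite_steps (w : seq nat) (steps : seq (nat * (nat * bool))) :
    option (seq nat) :=
  foldl (fun o st => obind (rewrite_step^~ st) o) (Some w) steps.

Definition word_nf v (w : seq nat) : nat :=
  if word_ok v w then foldl rmul (td_id v) w else n.

(** Two opposite implications are checked. The table follows from the relations, by the rewriting
    steps, so the listed paths span; and the relations hold in the table, from every starting
    vertex, which prevents the listed paths from becoming dependent. *)
Definition table_check : bool :=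
  [&& all (fun vw => [&& (vw.1 < nv)%N, word_ok vw.1 vw.2 &
        all (gtn na) vw.2]) (td_words td),
      all (fun st => (st.1 < nv)%N && (st.2 < nv)%N) (td_ends td),
      all_below nv (fun v => (td_id v < n)%N),
      all_below n (fun i => foldl rmul (td_id (td_word i).1) (td_word i).2 == i),
      all_below n (fun i => all_below na (fun a =>
        let: (v, w) := td_word i in
        let: (j, steps) := rmul_entry i a in
        if (j < n)%N then
          [&& v == (td_word j).1, rewrite_steps (rcons w a) steps == Some (td_word j).2
            & td_tgt j == (td_end a).2]
        else ~~ word_ok v (rcons w a) || (rewrite_steps (rcons w a) steps == None))),
      all_below nv (fun v => all (fun r =>
        if r.2 is Some w then word_nf v r.1 == word_nf v w
        else word_nf v r.1 == n) (td_rels td)) &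
      all (fun r => all (gtn na) r.1 && all (gtn na) (odflt [::] r.2))
        (td_rels td)].

(** Associativity is required only when the last factor is an arrow; induction on words gives the
    general case. *)
Definition mul_check (mul : nat -> nat -> nat) : bool :=
  [&& all_below n (fun i => all_below n (fun j => all_below na (fun a =>
        rmul (mul i j) a == mul i (rmul j a)))),
      all_below n (fun i => all_below nv (fun v =>
        mul i (td_id v) == if td_tgt i == v then i else n)) &
      all_below n (fun i => mul i n == n)].

End TableCheck.

Definition mul_of (n : nat) (t : seq (seq nat)) (i j : nat) : nat :=
  nth n (nth [::] t i) j.

Section TableSoundness.
Context (K : fieldType) (B : bound_quiver K).
Local Notation Q := (bq_quiver B).
Local Notation KQ := (path_alg K Q).
Context (nv : nat) (td : table_data) (t : seq (seq nat)).
Local Notation n := (size (td_words td)).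
Local Notation na := (size (td_ends td)).
Context (vx : nat -> qvert Q) (vidx : qvert Q -> nat).
Context (ar : nat -> qarrow Q) (aidx : qarrow Q -> nat).
Hypothesis vxK : forall v, (v < nv)%N -> vidx (vx v) = v.
Hypothesis enum_vx : enum (qvert Q) = [seq vx v | v <- iota 0 nv].
Hypothesis arK : forall a, (a < na)%N -> aidx (ar a) = a.
Hypothesis aidxK : cancel aidx ar.
Hypothesis aidx_lt : forall a, (aidx a < na)%N.
Hypothesis endsP : forall a : qarrow Q,
  td_end td (aidx a) = (vidx (qsrc a), vidx (qtgt a)).

Definition word_elt (w : seq nat) : KQ := \prod_(a <- w) arrow K (ar a).
Definition rel_elt (r : seq nat * option (seq nat)) : KQ :=
  if r.2 is Some w then word_elt r.1 - word_elt w else word_elt r.1.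

Hypothesis relsP : bq_rels B = [seq rel_elt r | r <- td_rels td].
Hypothesis tdP : table_check nv td.
Hypothesis tE : t = table_mul td.
Let mul := mul_of n t.
Hypothesis mulP : mul_check nv td mul.

Context (A : algType K) (piA : {rmorphism KQ -> A}).
Hypothesis pi_scale : forall k x, piA (k *: x) = k *: piA x.
Hypothesis pi_surj : forall a, exists x, piA x = a.
Hypothesis pi_ker : forall x, piA x = 0 <-> x \in @bq_ideal K B.

Definition table_elt (i : nat) : A :=
  if (i < n)%N then
    piA (vert_elt K (vx (td_word td i).1) * word_elt (td_word td i).2)
  else 0.

Lemma vidxK u : vx (vidx u) = u.
Proof.
have : u \in enum (qvert Q) by rewrite mem_enum.
by rewrite enum_vx => /mapP[v]; rewrite mem_iota => /= v_nv ->; rewrite vxK.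
Qed.

Lemma vidx_lt u : (vidx u < nv)%N.
Proof.
have : u \in enum (qvert Q) by rewrite mem_enum.
by rewrite enum_vx => /mapP[v]; rewrite mem_iota => /= v_nv ->; rewrite vxK.
Qed.

Lemma endsE a : (a < na)%N -> td_end td a = (vidx (qsrc (ar a)), vidx (qtgt (ar a))).
Proof. by move=> a_na; rewrite -endsP arK. Qed.

Lemma word_ok_path v w : (v < nv)%N -> all (gtn na) w ->
  word_ok td v w = path_ok (vx v) (map ar w).
Proof.
elim: w v => //= a w IHw v v_nv /andP[a_na w_na]; rewrite endsE //=.
rewrite IHw ?vidx_lt // vidxK; congr (_ && _).
by apply/eqP/eqP => [<-|->]; rewrite ?vidxK ?vxK.
Qed.

Lemma word_tgt_path v w : (v < nv)%N -> all (gtn na) w ->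
  vx (word_tgt td v w) = last (vx v) [seq qtgt a | a <- map ar w].
Proof.
elim: w v => //= a w IHw v v_nv /andP[a_na w_na].
by rewrite /word_tgt /= endsE //= -/(word_tgt _ _ _) IHw ?vidx_lt // vidxK.
Qed.

Lemma word_eltE w : word_elt w = \prod_(a <- map ar w) arrow K a.
Proof. by rewrite big_map. Qed.

Lemma pi_rel r : r \in td_rels td ->
  piA (word_elt r.1) = oapp (fun w => piA (word_elt w)) 0 r.2.
Proof.
move=> r_td; have: rel_elt r \in bq_rels B by rewrite relsP map_f.
move=> /(mem_gen_ideal (S := fun x : KQ => x \in bq_rels B)) rI.
have : piA (rel_elt r) = 0.
  exact/pi_ker.
rewrite /rel_elt; case: (r.2) => [w|//] /=.
by rewrite rmorphB => /eqP; rewrite subr_eq0 => /eqP.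
Qed.

Lemma pi_rewrite_step w st :
  piA (word_elt w) = oapp (fun w => piA (word_elt w)) 0 (rewrite_step td w st).
Proof.
case: st => pos [r back]; rewrite /rewrite_step.
set rel := nth _ _ r.
have relE : piA (word_elt rel.1) = oapp (fun w => piA (word_elt w)) 0 rel.2.
  have [r_lt|r_ge] := ltnP r (size (td_rels td)); first exact/pi_rel/mem_nth.
  by rewrite /rel nth_default.
case: rel relE => u v /= relE.
have split_w x : take (size x) (drop pos w) == x ->
    word_elt w = word_elt (take pos w) * word_elt x *
      word_elt (drop (size x) (drop pos w)).
  move=> /eqP xE; rewrite -{1}(cat_take_drop pos w) /word_elt big_cat /=.
  by rewrite -{1}(cat_take_drop (size x) (drop pos w)) big_cat /= mulrA xE.
have catE x y z : piA (word_elt (x ++ y ++ z)) =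
    piA (word_elt x) * piA (word_elt y) * piA (word_elt z).
  by rewrite /word_elt !big_cat /= mulrA !rmorphM.
case: back.
  case: v relE => // v' relE; case: ifP => // /split_w->.
  by rewrite /= catE !rmorphM; congr (_ * _ * _); exact/esym.
case: ifP => // /split_w->; case: v relE => [v'|] /= relE.
  by rewrite catE !rmorphM; congr (_ * _ * _).
by rewrite !rmorphM [X in _ * X * _]relE mulr0 mul0r.
Qed.

Lemma pi_rewrite_steps w steps :
  piA (word_elt w) = oapp (fun w => piA (word_elt w)) 0 (rewrite_steps td w steps).
Proof.
rewrite /rewrite_steps -[LHS]/(oapp (fun w => piA (word_elt w)) 0 (Some w)).
elim: steps (Some w) => [|st steps IH] //= o; rewrite -IH.
by case: o => //= w'; exact: pi_rewrite_step.
Qed.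

Lemma td_wordP i (vw := td_word td i) : (i < n)%N ->
  [/\ (vw.1 < nv)%N, word_ok td vw.1 vw.2 & all (gtn na) vw.2].
Proof.
move=> i_n; have /and5P[/allP words_ok _ _ _ _] := tdP.
exact/and3P/words_ok/mem_nth.
Qed.

Lemma rmulP i a : (i < n)%N -> (a < na)%N ->
  if (rmul td i a < n)%N then
    [/\ (td_word td i).1 = (td_word td (rmul td i a)).1,
        piA (word_elt (rcons (td_word td i).2 a)) =
          piA (word_elt (td_word td (rmul td i a)).2) &
        td_tgt td (rmul td i a) = (td_end td a).2]
  else rmul td i a = n /\
    (~~ word_ok td (td_word td i).1 (rcons (td_word td i).2 a) \/
     piA (word_elt (rcons (td_word td i).2 a)) = 0).
Proof.
move=> i_n a_na; have /and5P[_ _ _ _ /andP[+ _]] := tdP.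
move=> /all_belowP/(_ i i_n)/all_belowP/(_ a a_na).
rewrite /rmul i_n /=; case: (td_word td i) => v w /=.
case: (rmul_entry td i a) => j steps /=; case: ifP => j_n; rewrite ?j_n.
  case/and3P=> /eqP v_j /eqP steps_j /eqP tgt_j; split=> //.
  by rewrite (pi_rewrite_steps _ steps) steps_j.
rewrite ltnn; case/orP=> [|/eqP steps0]; first by split=> //; left.
by split=> //; right; rewrite (pi_rewrite_steps _ steps) steps0.
Qed.

Lemma rmul_dead i a : (n <= i)%N -> rmul td i a = n.
Proof. by move=> n_i; rewrite /rmul ltnNge n_i. Qed.

Lemma foldl_rmul_dead i w : (n <= i)%N -> (n <= foldl (rmul td) i w)%N.
Proof. by elim: w i => //= a w IHw i n_i; rewrite IHw // rmul_dead. Qed.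

Lemma table_elt_dead i : (n <= i)%N -> table_elt i = 0.
Proof. by move=> n_i; rewrite /table_elt ltnNge n_i. Qed.

Lemma table_elt_arrow i a : (a < na)%N ->
  table_elt i * piA (arrow K (ar a)) = table_elt (rmul td i a).
Proof.
move=> a_na; have [i_n|n_i] := ltnP i n; last first.
  by rewrite rmul_dead // !table_elt_dead // mul0r.
have [v_nv w_ok w_na] := td_wordP i_n.
have -> : table_elt i * piA (arrow K (ar a)) =
    piA (vert_elt K (vx (td_word td i).1) * word_elt (rcons (td_word td i).2 a)).
  rewrite /table_elt i_n -rmorphM -mulrA /word_elt.
  by rewrite -cats1 big_cat big_seq1.
have := rmulP i_n a_na; case: ifP => [j_n [v_j w_j _]|_ [-> w0]].
  by rewrite /table_elt j_n -v_j !rmorphM w_j.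
rewrite table_elt_dead //; case: w0 => [w0|w0]; last by rewrite rmorphM w0 mulr0.
rewrite word_eltE path_elt0 ?rmorph0 // -word_ok_path //.
by rewrite all_rcons /= a_na.
Qed.

Lemma table_elt_word i w : all (gtn na) w ->
  table_elt i * piA (word_elt w) = table_elt (foldl (rmul td) i w).
Proof.
elim: w i => [|a w IHw] i /=; first by rewrite /word_elt big_nil rmorph1 mulr1.
case/andP=> a_na w_na; rewrite /word_elt big_cons rmorphM mulrA.
by rewrite table_elt_arrow // IHw.
Qed.

Lemma td_idP v : (v < nv)%N ->
  (td_id td v < n)%N /\ td_word td (td_id td v) = (v, [::]).
Proof.
move=> v_nv; have /and5P[_ _ /all_belowP/(_ v v_nv) id_n _ _] := tdP.
by split=> //; rewrite /td_word nth_index // -index_mem.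
Qed.

Lemma table_elt_id v : (v < nv)%N -> table_elt (td_id td v) = piA (vert_elt K (vx v)).
Proof.
move=> v_nv; have [id_n idE] := td_idP v_nv.
by rewrite /table_elt id_n idE /word_elt big_nil mulr1.
Qed.

Lemma table_elt_vert i v : (v < nv)%N -> table_elt i * piA (vert_elt K (vx v)) =
  table_elt (if td_tgt td i == v then i else n).
Proof.
move=> v_nv; have [i_n|n_i] := ltnP i n; last first.
  by rewrite (table_elt_dead n_i) mul0r; case: ifP => _; rewrite table_elt_dead.
have [u_nv w_ok w_na] := td_wordP i_n.
rewrite {1}/table_elt i_n -rmorphM word_eltE path_elt_vert -word_tgt_path //.
have -> : (vx (word_tgt td (td_word td i).1 (td_word td i).2) == vx v) =
    (td_tgt td i == v).
  apply/eqP/eqP => [|<- //]; rewrite /td_tgt.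
  move=> /(congr1 vidx); rewrite (vxK v_nv) => <-; rewrite vxK //.
  elim: (td_word td i).2 (td_word td i).1 u_nv w_na => //= a w IHw u u_nv.
  by case/andP=> a_na w_na; rewrite /word_tgt /= endsE //=; apply: IHw;
    rewrite ?vidx_lt.
case: eqP => _; first by rewrite /table_elt i_n word_eltE.
by rewrite rmorph0 table_elt_dead.
Qed.

Lemma table_mulE i j : (i < n)%N -> (j < n)%N ->
  mul i j = foldl (rmul td)
    (if td_tgt td i == (td_word td j).1 then i else n) (td_word td j).2.
Proof.
move=> i_n j_n; rewrite /mul /mul_of tE (nth_map 0%N) ?size_iota //.
by rewrite nth_iota // (nth_map 0%N) ?size_iota // nth_iota.
Qed.

Lemma mul_dead i j : (n <= i)%N || (n <= j)%N -> mul i j = n.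
Proof.
rewrite /mul /mul_of tE; have [i_n /= n_j|n_i _] := ltnP i n; last first.
  by rewrite [nth [::] _ _]nth_default ?size_map ?size_iota // nth_nil.
rewrite (nth_map 0%N) ?size_iota // nth_default //.
by rewrite size_map size_iota.
Qed.

Lemma table_elt_mul i j : table_elt i * table_elt j = table_elt (mul i j).
Proof.
have [i_n|n_i] := ltnP i n; last first.
  by rewrite mul_dead ?n_i // (table_elt_dead n_i) mul0r table_elt_dead.
have [j_n|n_j] := ltnP j n; last first.
  by rewrite mul_dead ?n_j ?orbT // (table_elt_dead n_j) mulr0 table_elt_dead.
have [v_nv w_ok w_na] := td_wordP j_n.
rewrite {2}/table_elt j_n rmorphM mulrA table_elt_vert // table_elt_word //.
by rewrite table_mulE.
Qed.

Lemma pi_path (p : qpath Q) : piA << p >> =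
  table_elt (foldl (rmul td) (td_id td (vidx (path_src p)))
    [seq aidx a | a <- path_arrows p]).
Proof.
case: p => -[v s] ok; rewrite (path_elt K ok) rmorphM.
rewrite -{1}(vidxK v) -table_elt_id ?vidx_lt // /path_src /path_arrows /=.
have -> : \prod_(a <- s) arrow K a = word_elt [seq aidx a | a <- s].
  by rewrite word_eltE -map_comp (eq_map (g := id)) ?map_id // => a /=.
rewrite table_elt_word //; apply/allP => _ /mapP[a _ ->]; exact: aidx_lt.
Qed.

Definition path_nf (p : qpath Q) : nat :=
  foldl (rmul td) (td_id td (vidx (path_src p))) [seq aidx a | a <- path_arrows p].

(* The coordinates of [x] modulo the relations.  That this map kills the ideal
   of relations proves the linear independence of the paths in the table. *)
Definition nf_row (x : KQ) : 'rV[K]_n := lext (fun p => nat_delta K n (path_nf p)) x.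
HB.instance Definition _ := GRing.isLinear.Build K KQ 'rV[K]_n *:%R nf_row
  (lext_is_linear (fun p => nat_delta K n (path_nf p))).

Lemma nat_delta_dead i : (n <= i)%N -> nat_delta K n i = 0.
Proof.
move=> n_i; apply/rowP => j; rewrite !mxE ltn_eqF //.
exact: leq_trans (ltn_ord j) n_i.
Qed.

Lemma mul_foldl i j w : (i < n)%N -> all (gtn na) w ->
  foldl (rmul td) (mul i j) w = mul i (foldl (rmul td) j w).
Proof.
move=> i_n; elim: w j => //= a w IHw j /andP[a_na w_na]; rewrite -IHw //.
have /and3P[/all_belowP/(_ i i_n)/all_belowP assoc _] := mulP.
move=> /all_belowP/(_ i i_n)/eqP nr.
congr foldl; have [j_n|n_j] := ltnP j n.
  by have /all_belowP/(_ a a_na)/eqP := assoc j j_n.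
by rewrite (rmul_dead _ n_j) nr mul_dead ?n_j ?orbT // rmul_dead.
Qed.

Lemma mul_id i v : (i < n)%N -> (v < nv)%N ->
  mul i (td_id td v) = if td_tgt td i == v then i else n.
Proof.
move=> i_n v_nv.
by have /and3P[_ /all_belowP/(_ i i_n)/all_belowP/(_ v v_nv)/eqP] := mulP.
Qed.

Lemma tgt_foldl i w : all (gtn na) w -> (foldl (rmul td) i w < n)%N ->
  td_tgt td (foldl (rmul td) i w) = last (td_tgt td i) [seq (td_end td a).2 | a <- w].
Proof.
elim: w i => //= a w IHw i /andP[a_na w_na] nf_n; rewrite IHw //.
have [j_n|n_j] := ltnP (rmul td i a) n; last first.
  by have := foldl_rmul_dead w n_j; rewrite leqNgt nf_n.
have [i_n|n_i] := ltnP i n; last by rewrite rmul_dead ?ltnn in j_n.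
by have := rmulP i_n a_na; rewrite j_n => -[_ _ ->].
Qed.

Lemma arrows_bound (s : seq (qarrow Q)) : all (gtn na) [seq aidx a | a <- s].
Proof. by apply/allP => _ /mapP[a _ ->]; exact: aidx_lt. Qed.

Lemma path_nf_tgt p : (path_nf p < n)%N -> td_tgt td (path_nf p) = vidx (path_tgt p).
Proof.
move=> nf_n; rewrite /path_nf tgt_foldl ?arrows_bound //.
have [_ idE] := td_idP (vidx_lt (path_src p)).
rewrite {1}/td_tgt idE /word_tgt /= /path_tgt -[RHS]last_map -!map_comp.
by congr last; apply: eq_map => a /=; rewrite endsP.
Qed.

Lemma nf_row_path p : nf_row << p >> = nat_delta K n (path_nf p).
Proof. exact: lextU1. Qed.

(** By [mul_foldl], the product of the normal forms is obtained by letting the arrows of [q] act on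
    the normal form of [p], which also computes the normal form of the concatenation. The vertex of
    [q] accounts for incomposable paths. *)
Lemma nf_row_comp p q : nf_row ((<< p >> : KQ) * << q >>) =
  nat_delta K n (mul (path_nf p) (path_nf q)).
Proof.
rewrite catalgU /=.
have [nf_n|n_nf] := ltnP (path_nf p) n; last first.
  rewrite mul_dead ?n_nf // [RHS]nat_delta_dead //.
  have [pq|pq] := eqVneq (path_tgt p) (path_src q); last by rewrite path_compF ?linear0.
  have [r -> [rs ra]] := path_compT pq; rewrite /= nf_row_path nat_delta_dead //.
  by rewrite /path_nf rs ra map_cat foldl_cat foldl_rmul_dead.
have mulE : mul (path_nf p) (path_nf q) = foldl (rmul td)
    (if path_tgt p == path_src q then path_nf p else n)
    [seq aidx a | a <- path_arrows q].
  rewrite [path_nf q]/path_nf -mul_foldl ?arrows_bound // mul_id ?vidx_lt //.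
  rewrite path_nf_tgt // (can_eq vidxK).
  by [].
rewrite mulE; have [pq|pq] := eqVneq (path_tgt p) (path_src q); last first.
  by rewrite path_compF // linear0 nat_delta_dead // foldl_rmul_dead.
have [r -> [rs ra]] := path_compT pq; rewrite /= nf_row_path.
by rewrite /path_nf rs ra map_cat foldl_cat.
Qed.

(** The kernel of [nf_row] is a two-sided ideal. Hence it contains the ideal of relations as soon as
    it contains the relations. *)
Lemma nf_row_mul0 x y : nf_row y = 0 -> nf_row (x * y) = 0 /\ nf_row (y * x) = 0.
Proof.
move=> y0; elim/catalg_ind: x => [c f g [IHf IHf'] [IHg IHg']|p|].
- rewrite mulrDl mulrDr -scalerAl -scalerAr !linearP /= IHf IHf' IHg IHg'.
  by rewrite scaler0 addr0.
(* Multiplication by a path, on either side, descends to rows: [L] is the linear map induced by the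
   table, so the normal form of a product depends only on that of [y]. *)
- pose L (i : nat -> nat) (u : 'rV[K]_n) : 'rV[K]_n :=
    \sum_j u 0 j *: nat_delta K n (i j).
  have L_lin i c u w : L i (c *: u + w) = c *: L i u + L i w.
    rewrite /L scaler_sumr -big_split; apply: eq_bigr => j _ /=.
    by rewrite !mxE scalerDl scalerA.
  have L0 i : L i 0 = 0 by rewrite /L big1 // => j _; rewrite mxE scale0r.
  have L_delta i k : (forall j, (n <= j)%N -> (n <= i j)%N) ->
      L i (nat_delta K n k) = nat_delta K n (i k).
    move=> i_n; have [k_n|n_k] := ltnP k n; last first.
      by rewrite !nat_delta_dead ?L0 // i_n.
    rewrite /L (bigD1 (Ordinal k_n)) //= mxE eqxx scale1r big1 ?addr0 // => j.
    by rewrite -val_eqE /= mxE => /negPf->; rewrite scale0r.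
  split.
  + suff -> : nf_row ((<< p >> : KQ) * y) = L (mul (path_nf p)) (nf_row y).
      by rewrite y0.
    elim/catalg_ind: (y) => [c f g IHf IHg|q|].
    * by rewrite mulrDr -scalerAr !linearP /= IHf IHg L_lin.
    * rewrite nf_row_comp nf_row_path L_delta // => j n_j.
      by rewrite mul_dead // n_j orbT.
    * by rewrite mulr0 !linear0 L0.
  + suff -> : nf_row (y * (<< p >> : KQ)) = L (mul^~ (path_nf p)) (nf_row y).
      by rewrite y0.
    elim/catalg_ind: (y) => [c f g IHf IHg|q|].
    * by rewrite mulrDl -scalerAl !linearP /= IHf IHg L_lin.
    * by rewrite nf_row_comp nf_row_path L_delta // => j n_j; rewrite mul_dead // n_j.
    * by rewrite mul0r !linear0 L0.
- by rewrite mul0r mulr0 linear0.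
Qed.

Lemma nf_row_vert_word v w : (v < nv)%N -> all (gtn na) w ->
  nf_row (vert_elt K (vx v) * word_elt w) = nat_delta K n (word_nf td v w).
Proof.
move=> v_nv w_na; rewrite word_eltE /word_nf word_ok_path //.
case: ifP => [ok|/negbT/path_elt0->]; last by rewrite linear0 nat_delta_dead.
rewrite -(path_elt K ok) nf_row_path /path_nf /path_src /path_arrows /= vxK //.
rewrite -map_comp; congr (nat_delta K n (foldl _ _ _)).
by apply/map_id_in => a /(allP w_na); exact: arK.
Qed.

(** A word of arrows carries no starting vertex; it is split as the sum of its products with the
    vertices. Relations are accordingly tested at each vertex. *)
Lemma nf_row_word w : all (gtn na) w ->
  nf_row (word_elt w) = \sum_(v <- iota 0 nv) nat_delta K n (word_nf td v w).
Proof.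
move=> w_na; rewrite -[word_elt w]mul1r catalg1E /= /triv_paths big_map enum_vx.
rewrite big_map mulr_suml linear_sum; apply: eq_big_seq => v.
by rewrite mem_iota => /andP[_ v_nv]; exact: nf_row_vert_word.
Qed.

Lemma nf_row_ideal x : piA x = 0 -> nf_row x = 0.
Proof.
move=> /pi_ker/gen_idealP/(_ [pred x | nf_row x == 0]) H; apply/eqP; apply: H.
  split=> [|u v|u v|u v]; rewrite !inE ?linear0 //.
  - by rewrite linearB /= => /eqP-> /eqP->; rewrite subrr.
  - by move/eqP/(nf_row_mul0 u) => [-> _].
  - by move/eqP/(nf_row_mul0 u) => [_ ->].
move=> r; rewrite relsP => /mapP[[u ow] r_td ->]; rewrite inE /rel_elt /=.
have /and5P[_ _ _ _ /and3P[_ /all_belowP nfP]] := tdP.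
move=> /allP/(_ _ r_td)/= /andP[u_na w_na].
have {}nfP v : v \in iota 0 nv -> if ow is Some w then word_nf td v u = word_nf td v w
    else word_nf td v u = n.
  rewrite mem_iota => /andP[_ /nfP/allP/(_ _ r_td)] /=.
  by case: (ow) => [w|] /eqP.
case: ow w_na nfP {r_td} => [w|] /= w_na nfP.
  rewrite linearB /= !nf_row_word // subr_eq0; apply/eqP/eq_big_seq => v /nfP.
  by move=> ->.
rewrite nf_row_word //; apply/eqP; rewrite big1_seq // => v /andP[_ /nfP ->].
exact: nat_delta_dead.
Qed.

Definition table_coord (a : A) : 'rV[K]_n := nf_row (sval (cid (pi_surj a))).

Lemma table_coord_pi x : table_coord (piA x) = nf_row x.
Proof.
rewrite /table_coord; case: cid => y /= yx; apply/eqP; rewrite -subr_eq0 -linearB.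
by apply/eqP/nf_row_ideal; rewrite rmorphB yx subrr.
Qed.

Fact table_coord_linear : linear table_coord.
Proof.
move=> c a a'; have [x <-] := pi_surj a; have [x' <-] := pi_surj a'.
by rewrite -pi_scale -rmorphD !table_coord_pi linearP.
Qed.
HB.instance Definition _ := GRing.isLinear.Build K A 'rV[K]_n *:%R table_coord
  table_coord_linear.

Lemma table_elt_sum a : a = \sum_(i < n) table_coord a 0 i *: table_elt i.
Proof.
have [x <-] := pi_surj a; rewrite table_coord_pi.
elim/catalg_ind: x => [c f g IHf IHg|p|].
- rewrite rmorphD pi_scale IHf IHg scaler_sumr -big_split; apply: eq_bigr => i _.
  by rewrite linearP !mxE scalerDl scalerA.
- rewrite pi_path nf_row_path -/(path_nf p).
  have [p_n|n_p] := ltnP (path_nf p) n; last first.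
    rewrite table_elt_dead // nat_delta_dead // big1 // => i _.
    by rewrite mxE scale0r.
  rewrite (bigD1 (Ordinal p_n)) //= mxE eqxx scale1r big1 ?addr0 // => i.
  by rewrite -val_eqE /= mxE => /negPf->; rewrite scale0r.
- by rewrite rmorph0 linear0 big1 // => i _; rewrite mxE scale0r.
Qed.

Lemma table_coord_elt i : table_coord (table_elt i) = \row_j (j == i :> nat)%:R.
Proof.
rewrite /table_elt; case: ltnP => [i_n|n_i]; last first.
  by rewrite linear0 -[RHS]/(nat_delta K n i) nat_delta_dead.
have [v_nv w_ok w_na] := td_wordP i_n.
rewrite table_coord_pi nf_row_vert_word // /word_nf w_ok.
by have /and5P[_ _ _ /all_belowP/(_ i i_n)/eqP-> _] := tdP.
Qed.

Lemma table_elt_one : 1 = \sum_(v <- td_ids nv td) table_elt v.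
Proof.
rewrite -(rmorph1 piA) catalg1E /= /triv_paths big_map enum_vx !big_map rmorph_sum.
apply: eq_big_seq => v; rewrite mem_iota => /andP[_ v_nv].
by rewrite table_elt_id.
Qed.

Definition table_basis : mult_basis A n mul (td_ids nv td) :=
  MultBasis table_elt_dead table_elt_mul table_elt_sum table_coord_elt table_elt_one.

End TableSoundness.

(** * Dimensions from tables and certificates *)

Definition data_check (td : table_data) (t : seq (seq nat)) (rd : res_data)
    (c0 c1 c1' c2 c2' : co_cert) : bool :=
  let n := size (td_words td) in
  let mul := mul_of n t in
  let dim k c p kap d := [&& co_check n mul rd k c, cc_p c == p, cc_kappa c == kap
    & size (cc_Z c) == d] in
  [&& table_check 3 td, t == table_mul td, mul_check 3 td mul,
      res_check n mul (td_ids 3 td) rd, dim 0 c0 0 1 5,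
      dim 1 c1 0 2 2, dim 1 c1' 2 1 3, dim 2 c2 0 2 2 & dim 2 c2' 2 1 3]%N.

Definition HH_dims (K : fieldType) (A : algType K) : Prop :=
  [/\ has_dim (HH 0 A) 5,
      (2 \notin [pchar K] -> has_dim (HH 1 A) 2) /\
      (2 \in [pchar K] -> has_dim (HH 1 A) 3)
    & (2 \notin [pchar K] -> has_dim (HH 2 A) 2) /\
      (2 \in [pchar K] -> has_dim (HH 2 A) 3)].

Lemma mult_basis_HH_dims (K : fieldType) (A : algType K) td t rd c0 c1 c1' c2 c2' :
  data_check td t rd c0 c1 c1' c2 c2' ->
  mult_basis A (size (td_words td)) (mul_of (size (td_words td)) t) (td_ids 3 td) ->
  HH_dims A.
Proof.
case/and5P=> _ _ _ rdP /and5P[dim0 dim1 dim1' dim2 dim2'] b.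
(* As 2 is prime, membership in the characteristic reduces to 2 = 0, which decides between kappa = 2
   and p = 2. *)
have two_in : (2 \in [pchar K]) = (2%:R == 0 :> K) by rewrite inE.
have HHk k c p kap d : (k <= 2)%N ->
    [&& co_check (size (td_words td)) (mul_of (size (td_words td)) t) rd k c,
        cc_p c == p, cc_kappa c == kap & size (cc_Z c) == d] ->
    p%:R = 0 :> K -> kap%:R != 0 :> K -> has_dim (HH k A) d.
  move=> k2 /and4P[cP /eqP<- /eqP<- /eqP<-]; exact: (has_dim_HH b rdP k2 cP).
rewrite /HH_dims two_in; split.
- by apply: HHk dim0 _ _; rewrite ?oner_eq0.
- split=> [c2_neq0|/eqP c2_eq0].
    exact: HHk dim1 _ _.
  by apply: HHk dim1' _ _; rewrite ?oner_eq0.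
- split=> [c2_neq0|/eqP c2_eq0].
    exact: HHk dim2 _ _.
  by apply: HHk dim2' _ _; rewrite ?oner_eq0.
Qed.

Definition vert3 (v : nat) : 'I_3 := nth v1 [:: v1; v2; v3] v.

Lemma vert3K v : (v < 3)%N -> vert3 v = v :> nat.
Proof. by case: v => [|[|[|]]]. Qed.

Lemma enum_vert3 : enum 'I_3 = [seq vert3 v | v <- iota 0 3].
Proof. by apply: (inj_map val_inj); rewrite val_enum_ord. Qed.

Definition arrow4_idx (a : arrow4) : nat :=
  match a with alpha4 => 0 | beta4 => 1 | gamma4 => 2 | delta4 => 3 end.

Definition arrow5_idx (a : arrow5) : nat :=
  match a with
  | alpha5 => 0 | beta5 => 1 | gamma5 => 2 | delta5 => 3 | sigma5 => 4
  end.

Definition arrow4_nth := nth alpha4 [:: alpha4; beta4; gamma4; delta4].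
Definition arrow5_nth := nth alpha5 [:: alpha5; beta5; gamma5; delta5; sigma5].

Lemma arrow4_nthK a : (a < 4)%N -> arrow4_idx (arrow4_nth a) = a.
Proof. by case: a => [|[|[|[|]]]]. Qed.

Lemma arrow4_idxK : cancel arrow4_idx arrow4_nth. Proof. by case. Qed.

Lemma arrow4_idx_lt a : (arrow4_idx a < 4)%N. Proof. by case: a. Qed.

Lemma arrow5_nthK a : (a < 5)%N -> arrow5_idx (arrow5_nth a) = a.
Proof. by case: a => [|[|[|[|[|]]]]]. Qed.

Lemma arrow5_idxK : cancel arrow5_idx arrow5_nth. Proof. by case. Qed.

Lemma arrow5_idx_lt a : (arrow5_idx a < 5)%N. Proof. by case: a. Qed.

Section BoundQuiver3.
Context (K : fieldType) (B : bound_quiver K) (td : table_data) (t : seq (seq nat)).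
Local Notation Q := (bq_quiver B).
Context (vx : nat -> qvert Q) (vidx : qvert Q -> nat).
Context (ar : nat -> qarrow Q) (aidx : qarrow Q -> nat).

Lemma bound_quiver_HH_dims rd c0 c1 c1' c2 c2' :
  data_check td t rd c0 c1 c1' c2 c2' ->
  (forall v, (v < 3)%N -> vidx (vx v) = v) ->
  enum (qvert Q) = [seq vx v | v <- iota 0 3] ->
  (forall a, (a < size (td_ends td))%N -> aidx (ar a) = a) ->
  cancel aidx ar ->
  (forall a, (aidx a < size (td_ends td))%N) ->
  (forall a : qarrow Q, td_end td (aidx a) = (vidx (qsrc a), vidx (qtgt a))) ->
  bq_rels B = [seq rel_elt ar r | r <- td_rels td] ->
  HH_dims (bound_quiver_alg B).
Proof.
move=> dP vxK enum_vx arK aidxK aidx_lt endsP relsP.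
apply: (mult_basis_HH_dims dP).
have /and4P[tdP /eqP tE mulP _] := dP.
pose I := ProperIdeal2 (gen_ideal_ideal _) (@bq_ideal_proper K B).
apply: (@table_basis K B 3 td t vx vidx ar aidx vxK enum_vx arK aidxK aidx_lt
  endsP relsP tdP tE mulP _ (quotalg_pi I)) => [k x|a|x].
- by have := quotalg_pi_linear I k x 0; rewrite !addr0 (rmorph0 (quotalg_pi I)) addr0.
- by exists (quotalg_repr a); exact: quotalg_piK.
- by rewrite -(rmorph0 (quotalg_pi I)); split=> [/quotalg_eq|xI];
    [|apply/quotalg_eq]; rewrite subr0.
Qed.

End BoundQuiver3.

(** * The five algebras *)

(* The term [c (b l (x) b r)] of the [g]-th summand; the right-hand factor comes
   first in a [bikey], as it belongs to the opposite algebra. *)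
Definition bt (c : int) (l g r : nat) : int * bikey := (c, (g, (r, l))).
Definition ct (c : int) (g i : nat) : int * cokey := (c, (g, i)).
Definition kt (c : int) (j : nat) : int * nat := (c, j).
Arguments bt c%_Z (l g r)%_N.
Arguments ct c%_Z (g i)%_N.
Arguments kt c%_Z j%_N.

(* In the resolutions, the differentials of the arrows and of the relations are
   the usual ones, the latter by Fox calculus; the generators of the syzygies,
   the homotopies and the certificates below were found by linear algebra over
   the integers, or modulo 2. *)
Local Open Scope nat_scope.

(** * The algebra [Lambda4'], of dimension 24 *)

Definition table4 : table_data := TableData
[:: (0, 2); (1, 0); (2, 1); (0, 1)]
[:: (0, [::]); (1, [::]); (2, [::]); (0, [:: 0]); (0, [:: 3]); (1, [:: 1]);
  (2, [:: 2]); (0, [:: 0; 2]); (0, [:: 3; 1]); (1, [:: 1; 0]); (1, [:: 1; 3]);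
  (2, [:: 2; 1]); (0, [:: 0; 2; 1]); (0, [:: 3; 1; 0]); (1, [:: 1; 0; 2]); (1,
  [:: 1; 3; 1]); (2, [:: 2; 1; 3]); (0, [:: 0; 2; 1; 3]); (1, [:: 1; 0; 2;
  1]); (1, [:: 1; 3; 1; 0]); (2, [:: 2; 1; 3; 1]); (0, [:: 0; 2; 1; 3; 1]);
  (1, [:: 1; 0; 2; 1; 3]); (2, [:: 2; 1; 3; 1; 0])]
[:: ([:: 3; 1; 3], Some [:: 0; 2]); ([:: 1; 3; 1; 3; 1; 3; 1], None); ([:: 2;
  1; 0], None)]
[:: ((8, 3), (7, [:: (0, (0, false))])); ((11, 0), (24, [:: (0, (2,
  false))])); ((12, 0), (24, [:: (1, (2, false))])); ((13, 2), (17, [:: (2,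
  (0, true)); (0, (0, false))])); ((15, 3), (14, [:: (1, (0, false))])); ((18,
  0), (24, [:: (2, (2, false))])); ((19, 2), (22, [:: (3, (0, true)); (1, (0,
  false))])); ((20, 3), (24, [:: (2, (0, false)); (0, (2, false))])); ((21,
  0), (24, [:: (0, (0, true)); (2, (0, false)); (3, (2, false))])); ((21, 3),
  (24, [:: (3, (0, false)); (1, (2, false))])); ((22, 1), (24, [:: (1, (0,
  true)); (0, (1, false))])); ((23, 2), (24, [:: (4, (0, true)); (2, (0,
  false)); (0, (2, false))]))].

Definition mul4 : seq (seq nat) := Eval vm_compute in table_mul table4.

(** Each of the four syzygies expresses a product of (beta delta)^3 beta with one arrow through the
    other relations: delta or gamma on the left, delta or alpha on the right. *)
Definition res4 : res_data := ResData
[:: [:: (0, 0); (1, 1); (2, 2)]; [:: (0, 2); (1, 0); (2, 1); (0, 1)]; [:: (0,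
  1); (1, 0); (2, 2)]; [:: (0, 0); (1, 1); (1, 2); (2, 0)]]
[:: [:: [:: bt (-1) 0 0 3; bt 1 3 2 2]; [:: bt 1 5 0 0; bt (-1) 1 1 5]; [:: bt
  1 6 1 1; bt (-1) 2 2 6]; [:: bt (-1) 0 0 4; bt 1 4 1 1]]; [:: [:: bt (-1) 0
  0 6; bt 1 4 1 4; bt (-1) 3 2 1; bt 1 0 3 10; bt 1 8 3 1]; [:: bt 1 1 1 21;
  bt 1 10 1 12; bt 1 14 1 8; bt 1 22 1 0; bt 1 5 3 18; bt 1 15 3 15; bt 1 18 3
  5]; [:: bt 1 11 0 2; bt 1 6 1 3; bt 1 2 2 9]]; [:: [:: bt 1 0 0 18; bt 1 12
  0 5; bt (-1) 4 1 0; bt 1 3 2 11]; [:: bt 1 5 0 14; bt 1 18 0 1; bt (-1) 1 1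
  4; bt 1 9 2 6]; [:: bt 1 15 0 9; bt (-1) 1 1 3; bt 1 19 2 2]; [:: bt 1 11 0
  15; bt (-1) 6 1 0; bt 1 2 2 20]]]
[:: [:: ((0, 3), [:: bt (-1) 0 0 2]); ((0, 4), [:: bt (-1) 0 3 1]); ((0, 7),
  [:: bt (-1) 0 0 6; bt (-1) 3 2 1]); ((0, 8), [:: bt (-1) 4 1 0; bt (-1) 0 3
  5]); ((0, 12), [:: bt (-1) 0 0 11; bt (-1) 7 1 0; bt (-1) 3 2 5]); ((0, 13),
  [:: bt (-1) 8 0 2; bt (-1) 4 1 3; bt (-1) 0 3 9]); ((0, 17), [:: bt (-1) 8 0
  6; bt (-1) 4 1 7; bt (-1) 13 2 1; bt (-1) 0 3 14]); ((0, 21), [:: bt (-1) 8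
  0 11; bt (-1) 4 1 12; bt (-1) 17 1 0; bt (-1) 13 2 5; bt (-1) 0 3 18]); ((1,
  5), [:: bt (-1) 1 1 0]); ((1, 9), [:: bt (-1) 5 0 2; bt (-1) 1 1 3]); ((1,
  10), [:: bt (-1) 1 1 4; bt (-1) 5 3 1]); ((1, 14), [:: bt (-1) 5 0 6; bt
  (-1) 1 1 7; bt (-1) 9 2 1]); ((1, 15), [:: bt (-1) 1 1 8; bt (-1) 10 1 0; bt
  (-1) 5 3 5]); ((1, 18), [:: bt (-1) 5 0 11; bt (-1) 1 1 12; bt (-1) 14 1 0;
  bt (-1) 9 2 5]); ((1, 19), [:: bt (-1) 15 0 2; bt (-1) 1 1 13; bt (-1) 10 1
  3; bt (-1) 5 3 9]); ((1, 22), [:: bt (-1) 15 0 6; bt (-1) 1 1 17; bt (-1) 10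
  1 7; bt (-1) 19 2 1; bt (-1) 5 3 14]); ((2, 6), [:: bt (-1) 2 2 1]); ((2,
  11), [:: bt (-1) 6 1 0; bt (-1) 2 2 5]); ((2, 16), [:: bt (-1) 6 1 4; bt
  (-1) 2 2 10; bt (-1) 11 3 1]); ((2, 20), [:: bt (-1) 6 1 8; bt (-1) 16 1 0;
  bt (-1) 2 2 15; bt (-1) 11 3 5]); ((2, 23), [:: bt (-1) 20 0 2; bt (-1) 6 1
  13; bt (-1) 16 1 3; bt (-1) 2 2 19; bt (-1) 11 3 9])]; [:: ((0, 16), [:: bt
  (-1) 0 0 10; bt 1 8 0 1]); ((0, 20), [:: bt (-1) 0 0 15; bt 1 8 0 5]); ((0,
  23), [:: bt (-1) 0 0 19; bt 1 8 0 9; bt 1 13 2 2]); ((1, 21), [:: bt (-1) 15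
  0 5; bt 1 1 1 0]); ((2, 9), [:: bt 1 2 2 2]); ((2, 14), [:: bt 1 2 2 6]);
  ((2, 18), [:: bt 1 2 2 11]); ((2, 22), [:: bt 1 11 0 10; bt (-1) 20 0 1; bt
  1 2 2 16]); ((3, 10), [:: bt 1 0 0 1]); ((3, 15), [:: bt 1 0 0 5]); ((3,
  19), [:: bt 1 0 0 9; bt 1 3 2 2]); ((3, 22), [:: bt 1 0 0 14; bt 1 3 2 6])];
  [:: ((0, 18), [:: bt 1 0 0 0]); ((0, 22), [:: bt 1 0 0 4; bt (-1) 4 1 1]);
  ((1, 3), [:: bt (-1) 1 2 2]); ((1, 4), [:: bt (-1) 1 1 1]); ((1, 7), [:: bt
  (-1) 1 2 6]); ((1, 8), [:: bt 1 5 0 0; bt (-1) 1 1 5]); ((1, 12), [:: bt 1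
  15 0 0; bt (-1) 1 2 11]); ((1, 13), [:: bt (-1) 1 1 9]); ((1, 17), [:: bt
  (-1) 1 1 14]); ((1, 21), [:: bt 1 18 0 0; bt (-1) 1 1 18]); ((2, 20), [:: bt
  1 2 3 0]); ((2, 23), [:: bt (-1) 6 2 2; bt 1 2 3 3])]].

(** The centre is spanned by 1, (delta beta)^2 + (beta delta)^2 and one longest cycle at each
    vertex. *)
Definition cert4_0 : co_cert := CoCert 0 1
[::]
[:: ((0, 3), [:: ct 1 2 2]); ((0, 13), [:: ct (-1) 0 8; ct (-1) 1 10]); ((1,
  5), [:: ct (-1) 1 1]); ((1, 15), [:: ct (-1) 1 10]); ((1, 18), [:: ct 1 0
  12])]
[:: [:: ct 1 0 21]; [:: ct 1 1 22]; [:: ct 1 2 23]; [:: ct 1 0 12; ct 1 1 14];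
  [:: ct 1 0 0; ct 1 1 1; ct 1 2 2]]
[:: ((0, 0), [:: kt 1 4]); ((0, 21), [:: kt 1 0]); ((1, 14), [:: kt 1 3]);
  ((1, 22), [:: kt 1 1]); ((2, 23), [:: kt 1 2])].

(** The classes are the derivation beta |-> beta (delta beta)^2 and the grading derivation in which
    alpha has degree 2, delta degree 1 and the other arrows degree 0. *)
Definition cert4_1 : co_cert := CoCert 0 2
[:: ((0, 13), [:: ct (-2) 0 8]); ((1, 5), [:: ct 2 0 0]); ((2, 6), [:: ct (-2)
  2 2]); ((2, 16), [:: ct 2 1 10]); ((3, 17), [:: ct 2 1 14])]
[:: ((0, 7), [:: ct (-2) 0 3]); ((0, 17), [:: ct 1 3 7]); ((2, 23), [:: ct 2 1
  15; ct (-1) 3 7])]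
[:: [:: ct 1 1 18]; [:: ct 2 0 3; ct 1 3 4]]
[:: ((1, 5), [:: kt 2 1]); ((1, 18), [:: kt 2 0]); ((3, 4), [:: kt 2 1]); ((3,
  17), [:: kt 2 0])].

(** The additional derivation is delta |-> delta beta delta. It changes delta beta delta by twice
    (delta beta)^2 delta and leaves alpha gamma alone. *)
Definition cert4_1_char2 : co_cert := CoCert 2 1
[:: ((1, 5), [:: ct 1 0 0]); ((1, 15), [:: ct 1 0 8]); ((2, 6), [:: ct 1 2
  2]); ((2, 16), [:: ct 1 0 8; ct 1 1 10]); ((3, 17), [:: ct 1 1 14])]
[:: ((0, 7), [:: ct 1 0 3]); ((0, 17), [:: ct 1 0 13])]
[:: [:: ct 1 3 7]; [:: ct 1 3 4]; [:: ct 1 1 18]]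
[:: ((1, 5), [:: kt 1 1]); ((1, 15), [:: kt 1 0]); ((1, 18), [:: kt 1 2]);
  ((3, 4), [:: kt 1 1]); ((3, 7), [:: kt 1 0]); ((3, 17), [:: kt 1 2])].

(** The cochain with value (delta beta)^2 delta on the first relation is half the coboundary of
    delta |-> delta beta delta; this is the entry of [cc_X] at (0, 17). In characteristic 2 it
    becomes a class of its own. *)
Definition cert4_2 : co_cert := CoCert 0 2
[:: ((0, 7), [:: ct 1 3 4]); ((0, 17), [:: ct 1 3 7]); ((2, 23), [:: ct 2 0
  13; ct 1 3 7])]
[:: ((0, 8), [:: ct (-2) 1 5]); ((0, 12), [:: ct (-2) 1 15]); ((0, 21), [:: ct
  1 0 4])]
[:: [:: ct 1 0 4; ct 2 1 18]; [:: ct 1 1 15; ct 1 2 2]]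
[:: ((1, 18), [:: kt 1 0]); ((2, 2), [:: kt 2 1])].

Definition cert4_2_char2 : co_cert := CoCert 2 1
[:: ((0, 7), [:: ct 1 0 3]); ((2, 23), [:: ct 1 0 13])]
[:: ((0, 8), [:: ct 1 1 5]); ((0, 12), [:: ct 1 1 15]); ((0, 21), [:: ct 1 1
  18])]
[:: [:: ct 1 0 4]; [:: ct 1 0 17]; [:: ct 1 1 15; ct 1 2 2]]
[:: ((0, 4), [:: kt 1 0]); ((0, 17), [:: kt 1 1]); ((2, 2), [:: kt 1 2]); ((2,
  23), [:: kt 1 1])].

(** * The algebra [Lambda5'], of dimension 14 *)

Definition table5 : table_data := TableData
[:: (1, 1); (0, 1); (1, 0); (1, 2); (2, 1)]
[:: (0, [::]); (1, [::]); (2, [::]); (0, [:: 1]); (1, [:: 0]); (1, [:: 3]);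
  (1, [:: 2]); (2, [:: 4]); (0, [:: 1; 0]); (1, [:: 0; 0]); (1, [:: 0; 2]);
  (1, [:: 3; 4]); (2, [:: 4; 3]); (0, [:: 1; 0; 2])]
[:: ([:: 0; 0], Some [:: 2; 1]); ([:: 0; 0; 0], Some [:: 3; 4]); ([:: 1; 3],
  None); ([:: 4; 2], None); ([:: 0; 3], None); ([:: 4; 0], None); ([:: 1; 2],
  None)]
[:: ((3, 2), (14, [:: (0, (6, false))])); ((3, 3), (14, [:: (0, (2,
  false))])); ((4, 3), (14, [:: (0, (4, false))])); ((6, 1), (9, [:: (0, (0,
  true))])); ((7, 0), (14, [:: (0, (5, false))])); ((7, 2), (14, [:: (0, (3,
  false))])); ((8, 0), (14, [:: (1, (0, false)); (0, (6, false))])); ((8, 3),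
  (14, [:: (1, (4, false))])); ((9, 0), (11, [:: (0, (1, false))])); ((9, 2),
  (14, [:: (0, (0, false)); (1, (6, false))])); ((9, 3), (14, [:: (1, (4,
  false))])); ((10, 1), (11, [:: (1, (0, true)); (0, (1, false))])); ((11, 0),
  (14, [:: (1, (5, false))])); ((11, 2), (14, [:: (1, (3, false))])); ((11,
  3), (14, [:: (0, (1, true)); (2, (4, false))])); ((12, 4), (14, [:: (1, (1,
  true)); (0, (5, false))])); ((13, 1), (14, [:: (2, (0, true)); (1, (0,
  false)); (0, (6, false))]))].

Definition mul5 : seq (seq nat) := Eval vm_compute in table_mul table5.

Definition res5 : res_data := ResData
[:: [:: (0, 0); (1, 1); (2, 2)]; [:: (1, 1); (0, 1); (1, 0); (1, 2); (2, 1)];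
  [:: (1, 1); (1, 1); (0, 2); (2, 0); (1, 2); (2, 1); (0, 0)]; [:: (0, 1); (1,
  0); (1, 1); (1, 1); (1, 2); (2, 1); (2, 2)]]
[:: [:: [:: bt (-1) 1 1 4; bt 1 4 1 1]; [:: bt (-1) 0 0 3; bt 1 3 1 1]; [:: bt
  1 6 0 0; bt (-1) 1 1 6]; [:: bt (-1) 1 1 5; bt 1 5 2 2]; [:: bt 1 7 1 1; bt
  (-1) 2 2 7]]; [:: [:: bt 1 1 0 4; bt 1 4 0 1; bt (-1) 6 1 1; bt (-1) 1 2 3];
  [:: bt 1 1 0 9; bt 1 4 0 4; bt 1 9 0 1; bt (-1) 1 3 7; bt (-1) 5 4 1]; [::
  bt 1 0 1 5; bt 1 3 3 2]; [:: bt 1 7 2 0; bt 1 2 4 6]; [:: bt 1 1 0 5; bt 1 4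
  3 2]; [:: bt 1 7 0 1; bt 1 2 4 4]; [:: bt 1 0 1 6; bt 1 3 2 0]]; [:: [:: bt
  1 3 0 4; bt (-1) 3 1 1; bt (-1) 0 2 7; bt 1 0 6 8]; [:: bt 1 4 0 6; bt (-1)
  1 1 6; bt (-1) 5 3 0; bt 1 10 6 0]; [:: bt 1 1 1 4; bt (-1) 4 1 1; bt (-1) 1
  4 7; bt 1 5 5 1]; [:: bt 1 1 0 9; bt 1 9 0 1; bt (-1) 4 1 1; bt (-1) 1 4 7;
  bt 1 6 6 3]; [:: bt (-1) 1 0 5; bt (-1) 6 2 2; bt 1 4 4 2]; [:: bt (-1) 7 0
  1; bt (-1) 2 3 3; bt 1 2 5 4]; [:: bt (-1) 7 4 2; bt 1 2 5 5]]]
[:: [:: ((0, 3), [:: bt (-1) 0 1 1]); ((0, 8), [:: bt (-1) 3 0 1; bt (-1) 0 1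
  4]); ((0, 13), [:: bt (-1) 3 0 6; bt (-1) 0 1 10; bt (-1) 8 2 0]); ((1, 4),
  [:: bt (-1) 1 0 1]); ((1, 5), [:: bt (-1) 1 3 2]); ((1, 6), [:: bt (-1) 1 2
  0]); ((1, 9), [:: bt (-1) 1 0 4; bt (-1) 4 0 1]); ((1, 10), [:: bt (-1) 1 0
  6; bt (-1) 4 2 0]); ((1, 11), [:: bt (-1) 1 3 7; bt (-1) 5 4 1]); ((2, 7),
  [:: bt (-1) 2 4 1]); ((2, 12), [:: bt (-1) 7 3 2; bt (-1) 2 4 5])]; [:: ((0,
  5), [:: bt 1 1 4 2]); ((0, 9), [:: bt 1 1 1 1]); ((0, 10), [:: bt 1 1 0 6;
  bt 1 6 6 0]); ((0, 11), [:: bt 1 1 4 7]); ((1, 5), [:: bt 1 0 2 2]); ((1,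
  6), [:: bt 1 0 6 0]); ((1, 9), [:: bt 1 3 0 1; bt 1 0 6 3]); ((1, 11), [::
  bt 1 0 2 7]); ((2, 3), [:: bt (-1) 1 0 1]); ((2, 8), [:: bt (-1) 1 0 4; bt 1
  1 1 1]); ((2, 13), [:: bt (-1) 1 0 10; bt 1 1 1 6; bt 1 5 3 0]); ((3, 12),
  [:: bt 1 4 0 5; bt (-1) 1 1 5; bt 1 10 2 2]); ((4, 4), [:: bt 1 2 5 1]);
  ((4, 6), [:: bt 1 2 3 0]); ((4, 9), [:: bt 1 7 0 1; bt 1 2 3 3]); ((4, 10),
  [:: bt 1 2 5 6]); ((4, 11), [:: bt 1 7 0 4; bt (-1) 7 1 1; bt 1 2 3 8])];
  [:: ((0, 5), [:: bt (-1) 1 4 2]); ((0, 9), [:: bt 1 1 3 1]); ((0, 10), [::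
  bt (-1) 1 1 0]); ((0, 11), [:: bt (-1) 6 0 1; bt 1 4 2 1; bt 1 1 3 4]); ((1,
  4), [:: bt 1 1 2 1]); ((1, 5), [:: bt (-1) 4 4 2]); ((1, 6), [:: bt (-1) 1 1
  0]); ((1, 9), [:: bt (-1) 1 1 3; bt 1 4 3 1]); ((1, 10), [:: bt (-1) 4 1 0;
  bt 1 1 2 6]); ((1, 11), [:: bt (-1) 1 1 8; bt 1 9 2 1; bt 1 4 3 4]); ((2,
  12), [:: bt (-1) 0 0 5; bt 1 8 4 2]); ((3, 13), [:: bt 1 7 1 0; bt (-1) 2 5
  10]); ((4, 12), [:: bt (-1) 1 3 5]); ((5, 4), [:: bt 1 2 5 1]); ((5, 5), [::
  bt 1 2 6 2]); ((5, 9), [:: bt 1 2 5 4]); ((5, 10), [:: bt 1 2 5 6]); ((5,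
  11), [:: bt 1 2 6 7]); ((6, 8), [:: bt 1 0 0 1]); ((6, 13), [:: bt 1 0 0
  6])]].

Definition cert5_0 : co_cert := CoCert 0 1
[::]
[:: ((1, 3), [:: ct (-1) 0 0]); ((1, 8), [:: ct 1 1 4]); ((3, 5), [:: ct 1 2
  2])]
[:: [:: ct 1 0 13]; [:: ct 1 1 9]; [:: ct 1 1 11]; [:: ct 1 2 12]; [:: ct 1 0
  0; ct 1 1 1; ct 1 2 2]]
[:: ((0, 13), [:: kt 1 0]); ((1, 1), [:: kt 1 4]); ((1, 9), [:: kt 1 1]); ((1,
  11), [:: kt 1 2]); ((2, 12), [:: kt 1 3])].

Definition cert5_1 : co_cert := CoCert 0 2
[:: ((1, 8), [:: ct 2 1 4]); ((2, 6), [:: ct 2 0 0]); ((4, 7), [:: ct (-2) 2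
  2])]
[:: ((0, 9), [:: ct (-2) 1 3]); ((0, 11), [:: ct 1 0 9]); ((1, 11), [:: ct
  (-2) 3 5]); ((4, 5), [:: ct 2 0 1]); ((6, 13), [:: ct 1 0 9; ct 2 2 10])]
[:: [:: ct 1 0 11]; [:: ct 1 0 4; ct 2 1 3; ct 3 3 5]]
[:: ((0, 4), [:: kt 2 1]); ((0, 11), [:: kt 2 0])].

(** The additional derivation is alpha |-> alpha^2: it changes alpha^2 by 2 alpha^3, and the other
    relations are respected since alpha^4 = 0. *)
Definition cert5_1_char2 : co_cert := CoCert 2 1
[:: ((1, 8), [:: ct 1 1 4]); ((2, 6), [:: ct 1 0 0]); ((4, 7), [:: ct 1 2 2])]
[:: ((0, 9), [:: ct 1 1 3]); ((0, 11), [:: ct 1 2 10]); ((1, 9), [:: ct 1 0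
  1]); ((1, 11), [:: ct 1 3 5])]
[:: [:: ct 1 0 11]; [:: ct 1 0 9]; [:: ct 1 0 4; ct 1 3 5]]
[:: ((0, 4), [:: kt 1 2]); ((0, 9), [:: kt 1 1]); ((0, 11), [:: kt 1 0])].

Definition cert5_2 : co_cert := CoCert 0 2
[:: ((0, 9), [:: ct (-2) 1 3]); ((0, 11), [:: ct 1 0 9]); ((1, 11), [:: ct
  (-2) 4 7]); ((4, 5), [:: ct 2 0 1]); ((6, 13), [:: ct 1 0 9; ct 2 2 10])]
[:: ((0, 3), [:: ct (-2) 1 1]); ((0, 8), [:: ct (-2) 0 1; ct (-4) 1 4]); ((2,
  11), [:: ct 2 5 7]); ((3, 9), [:: ct 2 0 1; ct 2 1 4]); ((3, 11), [:: ct 1 0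
  4])]
[:: [:: ct 1 0 4; ct 2 1 9]; [:: ct 1 1 4; ct 1 6 0]]
[:: ((1, 9), [:: kt 1 0]); ((4, 5), [:: kt (-3) 0]); ((6, 0), [:: kt 2 1])].

Definition cert5_2_char2 : co_cert := CoCert 2 1
[:: ((0, 9), [:: ct 1 1 3]); ((1, 11), [:: ct 1 0 4]); ((4, 5), [:: ct 1 0
  1]); ((6, 13), [:: ct 1 1 8])]
[:: ((0, 3), [:: ct 1 1 1]); ((0, 8), [:: ct 1 0 1]); ((2, 11), [:: ct 1 5
  7]); ((3, 9), [:: ct 1 0 1; ct 1 1 4]); ((3, 11), [:: ct 1 1 9])]
[:: [:: ct 1 0 4]; [:: ct 1 0 11]; [:: ct 1 1 4; ct 1 6 0]]
[:: ((0, 4), [:: kt 1 0]); ((0, 11), [:: kt 1 1]); ((6, 0), [:: kt 1 2]); ((6,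
  13), [:: kt 1 1])].

(** * The algebra [Lambda6'], of dimension 22 *)

Definition table6 : table_data := TableData
[:: (0, 1); (1, 0); (2, 1); (1, 2)]
[:: (0, [::]); (1, [::]); (2, [::]); (0, [:: 0]); (1, [:: 1]); (1, [:: 3]);
  (2, [:: 2]); (0, [:: 0; 3]); (1, [:: 1; 0]); (1, [:: 3; 2]); (2, [:: 2; 1]);
  (2, [:: 2; 3]); (0, [:: 0; 3; 2]); (1, [:: 1; 0; 3]); (1, [:: 3; 2; 1]); (1,
  [:: 3; 2; 3]); (2, [:: 2; 1; 0]); (2, [:: 2; 3; 2]); (0, [:: 0; 3; 2; 1]);
  (1, [:: 1; 0; 3; 2]); (2, [:: 2; 1; 0; 3]); (2, [:: 2; 3; 2; 3])]
[:: ([:: 0; 3; 2; 3], None); ([:: 2; 3; 2; 1], None); ([:: 0; 1], None); ([::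
  1; 0], Some [:: 3; 2; 3; 2])]
[:: ((3, 1), (22, [:: (0, (2, false))])); ((8, 1), (22, [:: (1, (2,
  false))])); ((12, 3), (22, [:: (0, (0, false))])); ((14, 0), (19, [:: (2,
  (3, false)); (0, (3, true))])); ((15, 2), (8, [:: (0, (3, true))])); ((16,
  1), (22, [:: (2, (2, false))])); ((17, 1), (22, [:: (0, (1, false))]));
  ((18, 0), (22, [:: (3, (3, false)); (0, (0, false))])); ((19, 1), (22, [::
  (0, (3, false)); (3, (1, false))])); ((19, 3), (22, [:: (1, (0, false))]));
  ((20, 2), (22, [:: (1, (3, false)); (3, (3, true)); (0, (1, false))]));
  ((21, 2), (16, [:: (1, (3, true))]))].

Definition mul6 : seq (seq nat) := Eval vm_compute in table_mul table6.

(** The syzygies come from rewriting alpha beta alpha, beta alpha beta and gamma beta alpha delta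
    gamma delta in two ways. *)
Definition res6 : res_data := ResData
[:: [:: (0, 0); (1, 1); (2, 2)]; [:: (0, 1); (1, 0); (2, 1); (1, 2)]; [:: (0,
  2); (2, 0); (0, 0); (1, 1)]; [:: (0, 1); (1, 0); (2, 2)]]
[:: [:: [:: bt (-1) 0 0 3; bt 1 3 1 1]; [:: bt 1 4 0 0; bt (-1) 1 1 4]; [:: bt
  1 6 1 1; bt (-1) 2 2 6]; [:: bt (-1) 1 1 5; bt 1 5 2 2]]; [:: [:: bt 1 0 0
  15; bt 1 7 2 5; bt 1 3 3 11; bt 1 12 3 2]; [:: bt 1 17 1 0; bt 1 2 2 14; bt
  1 11 2 4; bt 1 6 3 10]; [:: bt 1 0 0 4; bt 1 3 1 0]; [:: bt 1 4 0 1; bt 1 1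
  1 3; bt (-1) 5 2 9; bt (-1) 15 2 1; bt (-1) 1 3 17; bt (-1) 9 3 6]]; [:: [::
  bt 1 0 0 6; bt (-1) 0 2 3; bt 1 3 3 1]; [:: bt 1 5 1 0; bt (-1) 4 2 0; bt 1
  1 3 4]; [:: bt 1 10 0 2; bt (-1) 2 1 7; bt (-1) 6 3 15; bt 1 17 3 5]]]
[:: [:: ((0, 3), [:: bt (-1) 0 0 1]); ((0, 7), [:: bt (-1) 0 0 5; bt (-1) 3 3
  2]); ((0, 12), [:: bt (-1) 0 0 9; bt (-1) 7 2 1; bt (-1) 3 3 6]); ((0, 18),
  [:: bt (-1) 0 0 14; bt (-1) 12 1 0; bt (-1) 7 2 4; bt (-1) 3 3 10]); ((1,
  4), [:: bt (-1) 1 1 0]); ((1, 5), [:: bt (-1) 1 3 2]); ((1, 8), [:: bt (-1)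
  4 0 1; bt (-1) 1 1 3]); ((1, 9), [:: bt (-1) 5 2 1; bt (-1) 1 3 6]); ((1,
  13), [:: bt (-1) 4 0 5; bt (-1) 1 1 7; bt (-1) 8 3 2]); ((1, 14), [:: bt
  (-1) 9 1 0; bt (-1) 5 2 4; bt (-1) 1 3 10]); ((1, 15), [:: bt (-1) 5 2 5; bt
  (-1) 1 3 11; bt (-1) 9 3 2]); ((1, 19), [:: bt (-1) 14 0 1; bt (-1) 9 1 3;
  bt (-1) 5 2 8; bt (-1) 1 3 16]); ((2, 6), [:: bt (-1) 2 2 1]); ((2, 10), [::
  bt (-1) 6 1 0; bt (-1) 2 2 4]); ((2, 11), [:: bt (-1) 2 2 5; bt (-1) 6 3
  2]); ((2, 16), [:: bt (-1) 10 0 1; bt (-1) 6 1 3; bt (-1) 2 2 8]); ((2, 17),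
  [:: bt (-1) 2 2 9; bt (-1) 11 2 1; bt (-1) 6 3 6]); ((2, 20), [:: bt (-1) 10
  0 5; bt (-1) 6 1 7; bt (-1) 2 2 13; bt (-1) 16 3 2]); ((2, 21), [:: bt (-1)
  2 2 15; bt (-1) 11 2 5; bt (-1) 6 3 11; bt (-1) 17 3 2])]; [:: ((0, 4), [::
  bt 1 0 2 0]); ((0, 8), [:: bt 1 0 2 3]); ((0, 13), [:: bt 1 0 2 7]); ((0,
  15), [:: bt 1 0 0 2]); ((0, 19), [:: bt 1 0 0 17; bt 1 12 3 1]); ((1, 12),
  [:: bt 1 1 3 9; bt (-1) 9 3 1]); ((1, 18), [:: bt 1 15 1 0; bt 1 1 3 14]);
  ((2, 14), [:: bt 1 2 1 0]); ((2, 19), [:: bt 1 2 1 3]); ((3, 17), [:: bt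
  (-1) 1 3 1]); ((3, 20), [:: bt 1 4 0 2; bt (-1) 1 3 15; bt 1 9 3 5]); ((3,
  21), [:: bt (-1) 1 3 5])]; [:: ((0, 6), [:: bt 1 0 0 1]); ((0, 10), [:: bt 1
  0 0 4; bt (-1) 3 1 0]); ((0, 11), [:: bt 1 0 0 5]); ((0, 16), [:: bt 1 0 0
  8; bt (-1) 3 1 3]); ((0, 20), [:: bt 1 0 0 13; bt (-1) 3 1 7; bt (-1) 7 2
  2]); ((0, 21), [:: bt 1 0 0 15]); ((1, 7), [:: bt (-1) 2 2 2]); ((1, 12),
  [:: bt 1 10 0 1; bt (-1) 6 1 3; bt (-1) 2 2 6]); ((1, 18), [:: bt 1 10 0 4;
  bt (-1) 16 1 0; bt (-1) 2 2 10]); ((2, 12), [:: bt (-1) 0 0 9]); ((2, 18),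
  [:: bt (-1) 0 0 14]); ((3, 4), [:: bt 1 1 1 0]); ((3, 8), [:: bt 1 1 1 3]);
  ((3, 13), [:: bt 1 1 1 7; bt 1 5 2 2]); ((3, 19), [:: bt (-1) 4 0 9; bt (-1)
  14 0 1; bt 1 1 1 12; bt 1 9 1 3; bt 1 5 2 6])]].

Definition cert6_0 : co_cert := CoCert 0 1
[::]
[:: ((0, 3), [:: ct (-1) 0 0]); ((0, 12), [:: ct 1 1 9; ct 1 2 11]); ((2, 6),
  [:: ct (-1) 2 2]); ((2, 16), [:: ct 1 1 8]); ((2, 17), [:: ct (-1) 2 11])]
[:: [:: ct 1 0 18]; [:: ct 1 1 19]; [:: ct 1 2 20]; [:: ct 1 1 8; ct 1 2 21];
  [:: ct 1 0 0; ct 1 1 1; ct 1 2 2]]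
[:: ((0, 18), [:: kt 1 0]); ((1, 1), [:: kt 1 4]); ((1, 19), [:: kt 1 1]);
  ((2, 20), [:: kt 1 2]); ((2, 21), [:: kt 1 3])].

Definition cert6_1 : co_cert := CoCert 0 2
[:: ((1, 4), [:: ct 2 0 0]); ((1, 14), [:: ct (-2) 1 9; ct (-2) 2 11]); ((2,
  6), [:: ct (-2) 2 2]); ((2, 16), [:: ct 2 1 8]); ((3, 15), [:: ct 2 2 11])]
[:: ((2, 18), [:: ct 2 0 12; ct 1 2 17]); ((3, 8), [:: ct 2 0 3]); ((3, 19),
  [:: ct (-1) 2 17])]
[:: [:: ct 1 3 13]; [:: ct 2 0 3; ct 1 3 5]]
[:: ((2, 6), [:: kt 2 1]); ((2, 16), [:: kt 2 0]); ((3, 5), [:: kt 2 1]); ((3,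
  13), [:: kt 2 0])].

(** The additional derivation is gamma |-> gamma delta gamma, which changes (delta gamma)^2 by twice
    (delta gamma)^3. *)
Definition cert6_1_char2 : co_cert := CoCert 2 1
[:: ((1, 4), [:: ct 1 0 0]); ((1, 14), [:: ct 1 1 9; ct 1 2 11]); ((2, 6), [::
  ct 1 2 2]); ((2, 16), [:: ct 1 1 8]); ((3, 15), [:: ct 1 2 11])]
[:: ((2, 18), [:: ct 1 0 12]); ((3, 8), [:: ct 1 0 3])]
[:: [:: ct 1 3 13]; [:: ct 1 3 5]; [:: ct 1 2 17]]
[:: ((2, 6), [:: kt 1 1]); ((2, 16), [:: kt 1 0]); ((2, 17), [:: kt 1 2]);
  ((3, 5), [:: kt 1 1]); ((3, 13), [:: kt 1 0]); ((3, 15), [:: kt 1 2])].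

Definition cert6_2 : co_cert := CoCert 0 2
[:: ((2, 18), [:: ct 2 0 12; ct 1 2 17]); ((3, 8), [:: ct 2 0 3]); ((3, 19),
  [:: ct (-1) 2 17])]
[:: ((0, 3), [:: ct (-2) 2 0]); ((0, 12), [:: ct 2 0 7]); ((1, 14), [:: ct 2 1
  10])]
[:: [:: ct 1 2 0; ct 1 3 1]; [:: ct (-1) 0 7; ct (-1) 1 10; ct 1 3 9]]
[:: ((3, 1), [:: kt 2 0]); ((3, 9), [:: kt 2 1])].

(** The first class, alpha delta gamma beta on the relation alpha beta, is cohomologous to (delta
    gamma)^3 on the last relation: in characteristic 2 their sum is the coboundary of alpha |->
    alpha delta gamma. *)
Definition cert6_2_char2 : co_cert := CoCert 2 1
[:: ((3, 8), [:: ct 1 0 3]); ((3, 19), [:: ct 1 0 12])]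
[:: ((0, 3), [:: ct 1 2 0]); ((0, 12), [:: ct 1 0 7]); ((1, 14), [:: ct 1 1
  10])]
[:: [:: ct 1 2 18]; [:: ct 1 2 0; ct 1 3 1]; [:: ct 1 0 7; ct 1 1 10; ct 1 3
  9]]
[:: ((2, 18), [:: kt 1 0]); ((3, 1), [:: kt 1 1]); ((3, 9), [:: kt 1 2]); ((3,
  19), [:: kt 1 0])].

(** * The algebra [Lambda7'], of dimension 16 *)

Definition table7 : table_data := TableData
[:: (0, 0); (1, 0); (2, 1); (0, 1); (0, 2)]
[:: (0, [::]); (1, [::]); (2, [::]); (0, [:: 0]); (0, [:: 3]); (0, [:: 4]);
  (1, [:: 1]); (2, [:: 2]); (0, [:: 0; 0]); (0, [:: 0; 3]); (1, [:: 1; 0]);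
  (1, [:: 1; 4]); (2, [:: 2; 1]); (0, [:: 0; 0; 0]); (1, [:: 1; 0; 3]); (2,
  [:: 2; 1; 4])]
[:: ([:: 1; 3], None); ([:: 0; 4], None); ([:: 0; 3], Some [:: 4; 2]); ([:: 2;
  1; 0], None); ([:: 0; 0], Some [:: 3; 1])]
[:: ((3, 4), (16, [:: (0, (1, false))])); ((4, 1), (8, [:: (0, (4, true))]));
  ((5, 2), (9, [:: (0, (2, true))])); ((6, 3), (16, [:: (0, (0, false))]));
  ((8, 3), (16, [:: (1, (2, false)); (0, (1, false))])); ((8, 4), (16, [:: (1,
  (1, false))])); ((9, 1), (13, [:: (1, (4, true))])); ((10, 0), (16, [:: (1,
  (4, false)); (0, (0, false))])); ((10, 4), (16, [:: (1, (1, false))]));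
  ((11, 2), (14, [:: (1, (2, true))])); ((12, 0), (16, [:: (0, (3, false))]));
  ((12, 3), (16, [:: (1, (0, false))])); ((13, 0), (16, [:: (0, (4, false));
  (2, (4, false)); (1, (0, false))])); ((13, 3), (16, [:: (2, (2, false)); (1,
  (1, false))])); ((13, 4), (16, [:: (2, (1, false))])); ((14, 1), (16, [::
  (2, (4, true)); (1, (4, false)); (0, (0, false))])); ((15, 2), (16, [:: (2,
  (2, true)); (0, (3, false))]))].

Definition mul7 : seq (seq nat) := Eval vm_compute in table_mul table7.

Definition res7 : res_data := ResData
[:: [:: (0, 0); (1, 1); (2, 2)]; [:: (0, 0); (1, 0); (2, 1); (0, 1); (0, 2)];
  [:: (1, 1); (0, 2); (0, 1); (2, 0); (0, 0)]; [:: (0, 0); (0, 1); (1, 2); (2,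
  0); (2, 2)]]
[:: [:: [:: bt (-1) 0 0 3; bt 1 3 0 0]; [:: bt 1 6 0 0; bt (-1) 1 1 6]; [:: bt
  1 7 1 1; bt (-1) 2 2 7]; [:: bt (-1) 0 0 4; bt 1 4 1 1]; [:: bt (-1) 0 0 5;
  bt 1 5 2 2]]; [:: [:: bt 1 1 1 4; bt 1 6 3 1]; [:: bt 1 0 0 5; bt 1 3 4 2];
  [:: bt 1 0 0 4; bt (-1) 5 2 1; bt 1 3 3 1; bt (-1) 0 4 7]; [:: bt 1 12 0 0;
  bt 1 7 1 3; bt 1 2 2 10]; [:: bt 1 0 0 3; bt 1 3 0 0; bt (-1) 4 1 0; bt (-1)
  0 3 6]]; [:: [:: bt 1 0 1 12; bt (-1) 0 2 10; bt 1 3 2 6; bt (-1) 5 3 0; bt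
  (-1) 3 4 3; bt 1 8 4 0]; [:: bt 1 4 0 1; bt (-1) 0 1 7; bt (-1) 3 2 1; bt 1
  0 4 4]; [:: bt 1 1 0 11; bt (-1) 10 1 2; bt 1 6 4 5]; [:: bt 1 7 0 6; bt
  (-1) 2 3 3; bt 1 12 4 0]; [:: bt (-1) 12 1 2; bt 1 2 3 5]]]
[:: [:: ((0, 3), [:: bt (-1) 0 0 0]); ((0, 4), [:: bt (-1) 0 3 1]); ((0, 5),
  [:: bt (-1) 0 4 2]); ((0, 8), [:: bt (-1) 0 0 3; bt (-1) 3 0 0]); ((0, 9),
  [:: bt (-1) 0 0 4; bt (-1) 3 3 1]); ((0, 13), [:: bt (-1) 0 0 8; bt (-1) 3 0
  3; bt (-1) 8 0 0]); ((1, 6), [:: bt (-1) 1 1 0]); ((1, 10), [:: bt (-1) 6 0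
  0; bt (-1) 1 1 3]); ((1, 11), [:: bt (-1) 1 1 5; bt (-1) 6 4 2]); ((1, 14),
  [:: bt (-1) 6 0 4; bt (-1) 1 1 9; bt (-1) 10 3 1]); ((2, 7), [:: bt (-1) 2 2
  1]); ((2, 12), [:: bt (-1) 7 1 0; bt (-1) 2 2 6]); ((2, 15), [:: bt (-1) 7 1
  5; bt (-1) 2 2 11; bt (-1) 12 4 2])]; [:: ((0, 5), [:: bt 1 0 1 2]); ((0,
  9), [:: bt 1 0 1 7; bt 1 3 2 1]); ((0, 13), [:: bt 1 0 2 10; bt 1 5 3 0; bt
  1 3 4 3]); ((1, 4), [:: bt 1 1 0 1]); ((1, 8), [:: bt 1 1 0 6; bt 1 6 4 0]);
  ((1, 13), [:: bt 1 1 0 10; bt 1 6 4 3]); ((2, 10), [:: bt 1 2 3 0]); ((2,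
  14), [:: bt 1 2 3 4]); ((3, 6), [:: bt (-1) 0 4 0]); ((3, 10), [:: bt (-1) 0
  4 3]); ((3, 11), [:: bt 1 3 1 2; bt (-1) 0 4 5]); ((3, 14), [:: bt 1 3 1 7;
  bt 1 8 2 1; bt (-1) 0 4 9]); ((4, 7), [:: bt (-1) 0 2 1]); ((4, 12), [:: bt
  (-1) 0 2 6; bt (-1) 3 4 0]); ((4, 15), [:: bt 1 8 1 2; bt (-1) 0 2 11; bt
  (-1) 3 4 5])]; [:: ((0, 11), [:: bt 1 1 2 2]); ((0, 14), [:: bt 1 1 2 7]);
  ((1, 12), [:: bt 1 0 0 0]); ((1, 15), [:: bt 1 0 0 5; bt 1 5 4 2]); ((2,
  14), [:: bt (-1) 0 0 4; bt 1 8 1 1]); ((3, 3), [:: bt (-1) 2 3 0]); ((3, 5),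
  [:: bt 1 2 4 2]); ((3, 8), [:: bt (-1) 2 3 3]); ((3, 9), [:: bt 1 2 4 7]);
  ((3, 13), [:: bt 1 12 0 0; bt 1 2 4 12]); ((4, 4), [:: bt 1 0 1 1]); ((4,
  8), [:: bt 1 0 0 0; bt 1 0 1 6]); ((4, 13), [:: bt 1 0 1 10])]].

Definition cert7_0 : co_cert := CoCert 0 1
[::]
[:: ((1, 6), [:: ct 1 0 0]); ((1, 10), [:: ct 1 0 3]); ((2, 7), [:: ct (-1) 2
  2])]
[:: [:: ct 1 0 8]; [:: ct 1 0 13]; [:: ct 1 1 14]; [:: ct 1 2 15]; [:: ct 1 0
  0; ct 1 1 1; ct 1 2 2]]
[:: ((0, 8), [:: kt 1 0]); ((0, 13), [:: kt 1 1]); ((1, 1), [:: kt 1 4]); ((1,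
  14), [:: kt 1 2]); ((2, 15), [:: kt 1 3])].

(** The classes are alpha |-> alpha^3 and the grading derivation with alpha and sigma in degree 1,
    beta in degree 2, gamma and delta in degree 0. *)
Definition cert7_1 : co_cert := CoCert 0 2
[:: ((2, 7), [:: ct (-2) 2 2]); ((3, 4), [:: ct (-2) 0 0]); ((3, 9), [:: ct
  (-2) 0 3])]
[:: ((0, 14), [:: ct 1 0 8; ct 2 1 10]); ((1, 5), [:: ct 2 0 0]); ((2, 9), [::
  ct (-2) 4 5]); ((4, 8), [:: ct (-2) 1 6]); ((4, 13), [:: ct 1 0 8])]
[:: [:: ct 1 0 13]; [:: ct 1 0 3; ct 2 1 6; ct 1 4 5]]
[:: ((0, 3), [:: kt 2 1]); ((0, 13), [:: kt 2 0])].

(** Again alpha |-> alpha^2 is the additional derivation, as it changes alpha^2 by 2 alpha^3 and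
    respects the other relations. *)
Definition cert7_1_char2 : co_cert := CoCert 2 1
[:: ((2, 7), [:: ct 1 2 2]); ((3, 4), [:: ct 1 0 0]); ((3, 9), [:: ct 1 0 3])]
[:: ((0, 14), [:: ct 1 1 10]); ((1, 5), [:: ct 1 0 0]); ((2, 9), [:: ct 1 4
  5]); ((4, 8), [:: ct 1 1 6])]
[:: [:: ct 1 0 8]; [:: ct 1 0 13]; [:: ct 1 0 3; ct 1 4 5]]
[:: ((0, 3), [:: kt 1 2]); ((0, 8), [:: kt 1 0]); ((0, 13), [:: kt 1 1])].

Definition cert7_2 : co_cert := CoCert 0 2
[:: ((0, 14), [:: ct 1 0 8; ct 2 1 10]); ((1, 5), [:: ct 2 0 0]); ((2, 9), [::
  ct (-2) 2 7]); ((4, 8), [:: ct (-2) 1 6]); ((4, 13), [:: ct 1 0 8])]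
[:: ((0, 13), [:: ct (-2) 3 12]); ((1, 4), [:: ct 2 0 1]); ((1, 9), [:: ct 2 4
  3])]
[:: [:: ct 1 2 4; ct 1 4 3]; [:: ct (-1) 0 1; ct 1 4 0]]
[:: ((1, 5), [:: kt (-2) 0]); ((2, 4), [:: kt 2 0]); ((4, 0), [:: kt 2 1])].

Definition cert7_2_char2 : co_cert := CoCert 2 1
[:: ((1, 5), [:: ct 1 0 0]); ((2, 9), [:: ct 1 0 3]); ((4, 8), [:: ct 1 1 6]);
  ((4, 13), [:: ct 1 1 10])]
[:: ((0, 13), [:: ct 1 3 12]); ((1, 4), [:: ct 1 0 1]); ((1, 9), [:: ct 1 2
  4])]
[:: [:: ct 1 0 14]; [:: ct 1 2 4; ct 1 4 3]; [:: ct 1 0 1; ct 1 4 0]]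
[:: ((0, 14), [:: kt 1 0]); ((4, 0), [:: kt 1 2]); ((4, 3), [:: kt 1 1]); ((4,
  13), [:: kt 1 0])].

(** * The algebra [Lambda8'], of dimension 16, opposite to [Lambda7'] *)

Definition table8 : table_data := TableData
[:: (0, 0); (0, 1); (1, 2); (1, 0); (2, 0)]
[:: (0, [::]); (1, [::]); (2, [::]); (0, [:: 0]); (0, [:: 1]); (1, [:: 3]);
  (1, [:: 2]); (2, [:: 4]); (0, [:: 0; 0]); (0, [:: 0; 1]); (0, [:: 1; 2]);
  (1, [:: 3; 0]); (2, [:: 4; 1]); (0, [:: 0; 0; 0]); (1, [:: 3; 0; 1]); (2,
  [:: 4; 1; 2])]
[:: ([:: 3; 1], None); ([:: 4; 0], None); ([:: 3; 0], Some [:: 2; 4]); ([:: 0;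
  1; 2], None); ([:: 0; 0], Some [:: 1; 3])]
[:: ((4, 3), (8, [:: (0, (4, true))])); ((5, 1), (16, [:: (0, (0, false))]));
  ((6, 4), (11, [:: (0, (2, true))])); ((7, 0), (16, [:: (0, (1, false))]));
  ((8, 1), (16, [:: (0, (4, false)); (1, (0, false))])); ((9, 2), (16, [:: (0,
  (3, false))])); ((9, 3), (13, [:: (1, (4, true))])); ((10, 4), (13, [:: (1,
  (2, true)); (0, (4, true))])); ((11, 0), (16, [:: (0, (2, false)); (1, (1,
  false))])); ((12, 3), (16, [:: (1, (4, true)); (0, (1, false))])); ((13, 0),
  (16, [:: (0, (4, false)); (1, (2, false)); (2, (1, false))])); ((13, 1),
  (16, [:: (1, (4, false)); (2, (0, false))])); ((14, 2), (16, [:: (1, (3,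
  false))])); ((14, 3), (16, [:: (0, (2, false)); (2, (4, true)); (1, (1,
  false))])); ((15, 4), (16, [:: (2, (2, true)); (1, (4, true)); (0, (1,
  false))]))].

Definition mul8 : seq (seq nat) := Eval vm_compute in table_mul table8.

Definition res8 : res_data := ResData
[:: [:: (0, 0); (1, 1); (2, 2)]; [:: (0, 0); (0, 1); (1, 2); (1, 0); (2, 0)];
  [:: (1, 1); (2, 0); (1, 0); (0, 2); (0, 0)]; [:: (0, 0); (0, 2); (1, 0); (2,
  1); (2, 2)]]
[:: [:: [:: bt (-1) 0 0 3; bt 1 3 0 0]; [:: bt (-1) 0 0 4; bt 1 4 1 1]; [:: bt
  (-1) 1 1 6; bt 1 6 2 2]; [:: bt 1 5 0 0; bt (-1) 1 1 5]; [:: bt 1 7 0 0; bt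
  (-1) 2 2 7]]; [:: [:: bt 1 5 1 1; bt 1 1 3 4]; [:: bt 1 7 0 0; bt 1 2 4 3];
  [:: bt 1 5 0 0; bt (-1) 1 2 7; bt 1 1 3 3; bt (-1) 6 4 0]; [:: bt 1 0 0 10;
  bt 1 3 1 6; bt 1 9 2 2]; [:: bt 1 0 0 3; bt 1 3 0 0; bt (-1) 0 1 5; bt (-1)
  4 3 0]]; [:: [:: bt (-1) 10 1 0; bt (-1) 4 2 3; bt 1 9 2 0; bt 1 0 3 7; bt
  (-1) 0 4 8; bt 1 3 4 3]; [:: bt 1 4 0 6; bt (-1) 3 3 2; bt 1 0 4 10]; [:: bt
  1 1 0 5; bt (-1) 6 1 0; bt (-1) 1 2 3; bt 1 5 4 0]; [:: bt 1 12 0 1; bt (-1)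
  2 1 9; bt 1 7 4 4]; [:: bt (-1) 2 1 10; bt 1 7 3 2]]]
[:: [:: ((0, 3), [:: bt (-1) 0 0 0]); ((0, 4), [:: bt (-1) 0 1 1]); ((0, 8),
  [:: bt (-1) 0 0 3; bt (-1) 3 0 0]); ((0, 9), [:: bt (-1) 0 0 4; bt (-1) 3 1
  1]); ((0, 10), [:: bt (-1) 0 1 6; bt (-1) 4 2 2]); ((0, 13), [:: bt (-1) 0 0
  8; bt (-1) 3 0 3; bt (-1) 8 0 0]); ((1, 5), [:: bt (-1) 1 3 0]); ((1, 6),
  [:: bt (-1) 1 2 2]); ((1, 11), [:: bt (-1) 5 0 0; bt (-1) 1 3 3]); ((1, 14),
  [:: bt (-1) 5 0 4; bt (-1) 11 1 1; bt (-1) 1 3 9]); ((2, 7), [:: bt (-1) 2 4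
  0]); ((2, 12), [:: bt (-1) 7 1 1; bt (-1) 2 4 4]); ((2, 15), [:: bt (-1) 7 1
  6; bt (-1) 12 2 2; bt (-1) 2 4 10])]; [:: ((0, 9), [:: bt 1 4 0 1; bt 1 0 4
  4]); ((0, 10), [:: bt 1 0 3 2]); ((0, 13), [:: bt 1 10 1 0; bt 1 4 2 3; bt 1
  0 4 8]); ((1, 5), [:: bt (-1) 0 4 0]); ((1, 11), [:: bt (-1) 0 4 3]); ((1,
  14), [:: bt 1 9 0 1; bt (-1) 0 4 9; bt 1 3 4 4]); ((2, 7), [:: bt (-1) 1 2
  0]); ((2, 12), [:: bt (-1) 1 2 4]); ((2, 15), [:: bt (-1) 1 2 10; bt 1 5 3
  2]); ((3, 4), [:: bt 1 1 0 1]); ((3, 8), [:: bt 1 6 1 0; bt 1 1 2 3]); ((3,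
  10), [:: bt 1 1 0 6]); ((3, 13), [:: bt 1 6 1 3; bt 1 1 2 8]); ((4, 3), [::
  bt 1 2 1 0]); ((4, 8), [:: bt 1 2 1 3]); ((4, 9), [:: bt 1 2 1 4]); ((4,
  13), [:: bt 1 2 1 8])]; [:: ((0, 5), [:: bt 1 1 2 0]); ((0, 11), [:: bt 1 1
  2 3]); ((0, 14), [:: bt 1 1 2 9; bt (-1) 6 3 1]); ((1, 9), [:: bt (-1) 2 3
  1]); ((1, 10), [:: bt (-1) 2 4 2]); ((1, 13), [:: bt 1 7 0 0; bt (-1) 2 4
  7]); ((2, 9), [:: bt (-1) 1 2 4]); ((2, 13), [:: bt (-1) 1 2 8]); ((3, 7),
  [:: bt 1 0 0 0]); ((3, 12), [:: bt 1 0 0 4; bt (-1) 4 2 4]); ((3, 15), [::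
  bt 1 0 0 10; bt (-1) 10 4 2]); ((4, 10), [:: bt 1 0 1 2]); ((4, 13), [:: bt
  (-1) 0 0 3])]].

Definition cert8_0 : co_cert := CoCert 0 1
[::]
[:: ((1, 4), [:: ct (-1) 0 0]); ((1, 9), [:: ct (-1) 0 3]); ((2, 6), [:: ct 1
  2 2])]
[:: [:: ct 1 0 8]; [:: ct 1 0 13]; [:: ct 1 1 14]; [:: ct 1 2 15]; [:: ct 1 0
  0; ct 1 1 1; ct 1 2 2]]
[:: ((0, 8), [:: kt 1 0]); ((0, 13), [:: kt 1 1]); ((1, 1), [:: kt 1 4]); ((1,
  14), [:: kt 1 2]); ((2, 15), [:: kt 1 3])].

Definition cert8_1 : co_cert := CoCert 0 2
[:: ((2, 6), [:: ct 2 2 2]); ((3, 5), [:: ct 2 0 0]); ((3, 11), [:: ct 2 0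
  3])]
[:: ((0, 14), [:: ct 1 0 8; ct 2 1 9]); ((1, 7), [:: ct 2 0 0]); ((2, 11), [::
  ct (-2) 4 7]); ((4, 8), [:: ct (-2) 1 4]); ((4, 13), [:: ct 1 0 8])]
[:: [:: ct 1 0 13]; [:: ct 1 0 3; ct 2 1 4; ct 1 4 7]]
[:: ((0, 3), [:: kt 2 1]); ((0, 13), [:: kt 2 0])].

Definition cert8_1_char2 : co_cert := CoCert 2 1
[:: ((2, 6), [:: ct 1 2 2]); ((3, 5), [:: ct 1 0 0]); ((3, 11), [:: ct 1 0
  3])]
[:: ((0, 14), [:: ct 1 1 9]); ((1, 7), [:: ct 1 0 0]); ((2, 11), [:: ct 1 4
  7]); ((4, 8), [:: ct 1 1 4])]
[:: [:: ct 1 0 8]; [:: ct 1 0 13]; [:: ct 1 0 3; ct 1 4 7]]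
[:: ((0, 3), [:: kt 1 2]); ((0, 8), [:: kt 1 0]); ((0, 13), [:: kt 1 1])].

Definition cert8_2 : co_cert := CoCert 0 2
[:: ((0, 14), [:: ct 1 0 8; ct 2 1 9]); ((1, 7), [:: ct 2 0 0]); ((2, 11), [::
  ct (-2) 2 6]); ((4, 8), [:: ct (-2) 1 4]); ((4, 13), [:: ct 1 0 8])]
[:: ((0, 13), [:: ct 2 3 10]); ((1, 10), [:: ct 2 0 1]); ((2, 11), [:: ct 2 4
  3])]
[:: [:: ct 1 2 5; ct 1 4 3]; [:: ct (-1) 0 1; ct 1 4 0]]
[:: ((1, 7), [:: kt (-2) 0]); ((2, 5), [:: kt 2 0]); ((4, 0), [:: kt 2 1])].

Definition cert8_2_char2 : co_cert := CoCert 2 1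
[:: ((1, 7), [:: ct 1 0 0]); ((2, 11), [:: ct 1 0 3]); ((4, 8), [:: ct 1 1
  4]); ((4, 13), [:: ct 1 1 9])]
[:: ((0, 13), [:: ct 1 3 10]); ((1, 10), [:: ct 1 0 1]); ((2, 11), [:: ct 1 2
  5])]
[:: [:: ct 1 0 14]; [:: ct 1 2 5; ct 1 4 3]; [:: ct 1 0 1; ct 1 4 0]]
[:: ((0, 14), [:: kt 1 0]); ((4, 0), [:: kt 1 2]); ((4, 3), [:: kt 1 1]); ((4,
  13), [:: kt 1 0])].


Local Close Scope nat_scope.

Lemma data4_check : data_check table4 mul4 res4 cert4_0
  cert4_1 cert4_1_char2 cert4_2 cert4_2_char2.
Proof. by vm_compute. Qed.

Lemma data5_check : data_check table5 mul5 res5 cert5_0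
  cert5_1 cert5_1_char2 cert5_2 cert5_2_char2.
Proof. by vm_compute. Qed.

Lemma data6_check : data_check table6 mul6 res6 cert6_0
  cert6_1 cert6_1_char2 cert6_2 cert6_2_char2.
Proof. by vm_compute. Qed.

Lemma data7_check : data_check table7 mul7 res7 cert7_0
  cert7_1 cert7_1_char2 cert7_2 cert7_2_char2.
Proof. by vm_compute. Qed.

Lemma data8_check : data_check table8 mul8 res8 cert8_0
  cert8_1 cert8_1_char2 cert8_2 cert8_2_char2.
Proof. by vm_compute. Qed.

(** The relations are given with powers and nested products, those of the tables as iterated
    products over words; once expanded they agree up to associativity. *)
Ltac rels_to_words rels :=
  rewrite /= /rels /rel_elt /word_elt /= !big_cons !big_nil ?exprS ?expr0;
  by rewrite !mulr1 !mulrA.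

Lemma Lambda4_HH_dims (K : fieldType) : HH_dims (Lambda4' K).
Proof.
apply: (@bound_quiver_HH_dims K (BoundQuiver (@rels_Lambda4P K)) _ _ vert3
  (@nat_of_ord 3) arrow4_nth arrow4_idx _ _ _ _ _ _ data4_check vert3K enum_vert3
  arrow4_nthK arrow4_idxK arrow4_idx_lt) => [[]//|].
rels_to_words rels_Lambda4.
Qed.

Lemma Lambda5_HH_dims (K : fieldType) : HH_dims (Lambda5' K).
Proof.
apply: (@bound_quiver_HH_dims K (BoundQuiver (@rels_Lambda5P K)) _ _ vert3
  (@nat_of_ord 3) arrow5_nth arrow5_idx _ _ _ _ _ _ data5_check vert3K enum_vert3
  arrow5_nthK arrow5_idxK arrow5_idx_lt) => [[]//|].
rels_to_words rels_Lambda5.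
Qed.

Lemma Lambda6_HH_dims (K : fieldType) : HH_dims (Lambda6' K).
Proof.
apply: (@bound_quiver_HH_dims K (BoundQuiver (@rels_Lambda6P K)) _ _ vert3
  (@nat_of_ord 3) arrow4_nth arrow4_idx _ _ _ _ _ _ data6_check vert3K enum_vert3
  arrow4_nthK arrow4_idxK arrow4_idx_lt) => [[]//|].
rels_to_words rels_Lambda6.
Qed.

Lemma Lambda7_HH_dims (K : fieldType) : HH_dims (Lambda7' K).
Proof.
apply: (@bound_quiver_HH_dims K (BoundQuiver (@rels_Lambda7P K)) _ _ vert3
  (@nat_of_ord 3) arrow5_nth arrow5_idx _ _ _ _ _ _ data7_check vert3K enum_vert3
  arrow5_nthK arrow5_idxK arrow5_idx_lt) => [[]//|].
rels_to_words rels_Lambda7.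
Qed.

Lemma Lambda8_HH_dims (K : fieldType) : HH_dims (Lambda8' K).
Proof.
apply: (@bound_quiver_HH_dims K (BoundQuiver (@rels_Lambda8P K)) _ _ vert3
  (@nat_of_ord 3) arrow5_nth arrow5_idx _ _ _ _ _ _ data8_check vert3K enum_vert3
  arrow5_nthK arrow5_idxK arrow5_idx_lt) => [[]//|].
rels_to_words rels_Lambda8.
Qed.

Local Close Scope ring_scope.
Local Open Scope nat_scope.

Theorem proposition7p1 (K : closedFieldType) (A : algType K)
    (hA : A = Lambda4' K \/ A = Lambda5' K \/ A = Lambda6' K \/
          A = Lambda7' K \/ A = Lambda8' K) :
  [/\ has_dim (HH 0 A) 5,
      (2 \notin [pchar K]%R -> has_dim (HH 1 A) 2) /\
      (2 \in [pchar K]%R -> has_dim (HH 1 A) 3)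
    & (2 \notin [pchar K]%R -> has_dim (HH 2 A) 2) /\
      (2 \in [pchar K]%R -> has_dim (HH 2 A) 3)].
Proof.
case: hA => [->|[->|[->|[->|->]]]].
- exact: Lambda4_HH_dims.
- exact: Lambda5_HH_dims.
- exact: Lambda6_HH_dims.
- exact: Lambda7_HH_dims.
- exact: Lambda8_HH_dims.
Qed.
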